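(* Assume that $\lambda_1$ and $\lambda_0$ are both fixed, with $0<\sqrt{\lambda_0/e}<\lambda_1<1$, and that $$\limsup\frac{\log(N/n^2)}{\log n}<\frac{I_{\frac{\lambda_0}{\lambda_1e}}-I_{\sqrt{\frac{\lambda_0}{e}}}}{\left(1-\frac{\lambda_0}{\lambda_1e}\right)I_{\frac{\sqrt{\lambda_1}}{e}}} .$$ Then there is a constant $c>0$ such that the test that rejects for large values of $N^{\rm tree}_k$ with $k=c\log n$ is asymptotically powerful.
   Context: Setting. We observe an undirected simple graph $\mathcal{G}$ on the node set $\mathcal{V}=\{1,\dots,N\}$ with adjacency matrix $(W_{i,j})$ (symmetric, $0/1$, zero diagonal). Under the null hypothesis, with distribution $\mathbb{P}_0$, $\mathcal{G}$ is an Erdős–Rényi graph $\mathbb{G}(N,p_0)$, i.e. the $W_{i,j}$, $i<j$, are i.i.d. Bernoulli($p_0$). For $S\subset\mathcal{V}$ with $|S|=n$, under $\mathbb{P}_S$ the $W_{i,j}$, $i<j$, are independent with $\mathbb{P}_S(W_{i,j}=1)=p_1$ if $i,j\in S$ and $=p_0$ otherwise, where $p_1>p_0$. The alternative is the union over all $S$ with $|S|=n$. The parameters $n,p_0,p_1$ may depend on $N$; all limits are as $N\to\infty$, with $n\to\infty$, $n/N\to0$, $n/\log N\to\infty$, $N^2p_0\to\infty$, $n^2p_1\to\infty$. Notation. $\lambda_0=Np_0$, $\lambda_1=np_1$, and $I_\lambda=\lambda-1-\log\lambda$ for $\lambda>0$. $N^{\rm tree}_k$ is the number of subtrees of size $k$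 of $\mathcal{G}$, i.e. the number of subsets $C\subset\mathcal{V}$ with $|C|=k$ such that the subgraph of $\mathcal{G}$ induced by $C$ is a tree. ($k=c\log n$ is understood up to rounding to an integer.) Tests. A test $\phi$ is a $\{0,1\}$-valued function of the adjacency matrix; its risk is $\gamma_N(\phi)=\mathbb{P}_0(\phi=1)+\max_{|S|=n}\mathbb{P}_S(\phi=0)$. The test that rejects for large values of a statistic $T$ is asymptotically powerful if there are critical values $t=t(N)$ (possibly depending on $p_1$) such that the risk of the test $\{T\ge t\}$ tends to $0$. *)

(* Defs.v *)
From HB Require Import structures.
From mathcomp Require Import all_boot all_order all_algebra.
From mathcomp Require Import all_classical all_reals all_analysis.

Set Implicit Arguments.
Unset Strict Implicit.
Unset Printing Implicit Defensive.

Import Order.TTheory GRing.Theory Num.Theory.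
Import numFieldNormedType.Exports.

Local Open Scope ring_scope.

(* Adjacency matrices of the undirected simple graphs on 'I_N. *)
Definition is_adjacency (N : nat) (W : 'M[bool]_N) : bool :=
  (W^T == W) && [forall i, ~~ W i i].

Record graph (N : nat) := Graph {
  adj :> 'M[bool]_N;
  adjP : is_adjacency adj }.

HB.instance Definition _ N := [isSub for @adj N].
HB.instance Definition _ N := [Countable of graph N by <:].
HB.instance Definition _ N := [Finite of graph N by <:].

Section Trees.
Variables (N : nat) (G : graph N) (C : {set 'I_N}).

Definition induced_edge : rel 'I_N :=
  [rel i j | [&& i \in C, j \in C & G i j]].

Definition induced_connected : Prop :=
  C != finset.set0 /\ {in C &, forall i j, connect induced_edge i j}.

(* The size bound discards the closed walks [::] and [:: i; j], which
   [ucycle] accepts although they are not cycles of a simple graph. *)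
Definition induced_acyclic : Prop :=
  forall s : seq 'I_N, (3 <= size s)%N -> ~ ucycle induced_edge s.

Definition induced_tree : Prop := induced_connected /\ induced_acyclic.

End Trees.

Definition ntree (N : nat) (k : nat) (G : graph N) : nat :=
  #|[set C : {set 'I_N} | (#|C| == k) && `[< induced_tree G C >]]%SET|.

Section Model.
Variables (R : realType) (N : nat).

(* Probability of the event A when the W i j, i < j, are independent
   Bernoulli(p i j). *)
Definition graph_prob (p : 'I_N -> 'I_N -> R) (A : pred (graph N)) : R :=
  \sum_(G : graph N | A G)
    \prod_(i < N) \prod_(j < N | (i < j)%N) bernoulli_pmf (p i j) (G i j).

Definition null_prob (p0 : R) (A : pred (graph N)) : R :=
  graph_prob (fun _ _ => p0) A.

Definition planted_prob (p0 p1 : R) (S : {set 'I_N}) (A : pred (graph N)) : R :=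
  graph_prob (fun i j => if (i \in S) && (j \in S) then p1 else p0) A.

(* The default 0 of the maximum is harmless: for parameters in [0, 1] all
   the terms are nonnegative. *)
Definition risk (n : nat) (p0 p1 : R) (phi : pred (graph N)) : R :=
  null_prob p0 phi +
  \big[Num.max/0]_(S : {set 'I_N} | #|S| == n)
     planted_prob p0 p1 S (fun G => ~~ phi G).

End Model.

Definition asymptotically_powerful (R : realType) (n : nat -> nat)
    (p0 p1 : nat -> R) (T : forall N, graph N -> R) : Prop :=
  exists t : nat -> R,
    (risk (n N) (p0 N) (p1 N) (fun G : graph N => t N <= T N G)
       @[N --> \oo] --> (0 : R))%classic.

Definition Irate (R : realType) (x : R) : R := x - 1 - ln x.

(* Main.v *)
Require Import Defs.
From mathcomp Require Import all_boot all_order all_algebra.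
From mathcomp Require Import all_classical all_reals all_analysis.
From mathcomp Require Import ring lra zify.
Import Order.TTheory GRing.Theory Num.Theory.
Import numFieldNormedType.Exports.

(** Let [s = sqrt (l0 / e)] and [a = l0 / (l1 e)].  With [k = c log n], an induced
    [k]-tree of the planted graph typically meets the planted set [S] in a subtree on
    [(1 - a) k] vertices, and the number of such trees has mean
    [n exp (k (ln l1 + 1 + a))] up to factors that are subexponential in [k].  Under
    the null the variance is at most the sum over pairs of intersecting vertex sets
    of the probability that both induce trees.  Encoding a pair of trees by parent
    maps (shared vertices choose their parent among the shared vertices) bounds it
    by [N (l0 e)^k exp (2 s k)], the dominant pairs sharing a fraction [1 - s] of
    their vertices.  The signal to noise ratio is thus
    [sqrt (n^2 / N) exp (k (I_a - I_s))].  The same encoding, applied to trees whose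
    trace on [S] is a subtree, shows that the planted count concentrates as soon as
    [n] is larger than [exp (2 (1 - a) k I_(sqrt l1 / e))]; the hypothesis leaves room
    for a [c] satisfying both constraints.  Chebyshev's inequality is applied to all
    trees under the null and, under the alternative, separately to the trees
    avoiding [S] and to those meeting [S] in a subtree of the optimal size. *)

(** The overlap of two trees need not be connected, and their union then contains cycles. Each
    surplus edge has probability at most [p1 = theta ^+ 4]; two of the four factors [theta] are
    spread over the vertices at which the two parent maps leave the overlap. Summing over parents
    vertex by vertex then costs only [(1 + theta * k%:R) ^+ (2 * k)], which stays bounded because
    [k] is logarithmic in [n]. Upper bounds keep only the edges that are present; the lower bound on
    the planted mean needs exact events and a Cayley-type count of forests. The condition [s < l1]
    amounts to [a < s]. It makes [I_a - I_s] positive, and it keeps the [a k] vertices outside [S]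
    below the mode [s k] of the overlap sum, so that planted pairs sharing nothing outside [S]
    dominate and only the overlap inside [S] matters for concentration. The null mean is never
    evaluated: the threshold is centred at it, and the trees meeting [S], which are lost in the
    comparison, amount to at most about [exp (- k I_a)] times the planted mean. *)

Set Implicit Arguments.
Unset Strict Implicit.
Unset Printing Implicit Defensive.
Local Open Scope ring_scope.

(** * Expectations over random graphs *)

Section GraphExpectation.
Variable N : nat.
Implicit Types G : graph N.

Lemma graph_sym G i j : G i j = G j i.
Proof.
by case: G => W /= /andP[/eqP/matrixP/(_ i j)]; rewrite mxE => ->.
Qed.

Lemma graph_irr G i : G i i = false.
Proof. by case: G => W /= /andP[_ /forallP/(_ i)/negbTE]. Qed.

Lemma graph_eqP G G' : (forall i j, G i j = G' i j) -> G = G'.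
Proof. by move=> h; apply/val_inj/matrixP. Qed.

(** Only the values of [e] at increasing pairs are read, so an arbitrary relation yields a graph;
    this matches the indexing of the weights by [i < j]. *)
Lemma graph_of_rel_subproof (e : rel 'I_N) :
  is_adjacency (\matrix_(i, j) ((i != j) && (if (i < j)%N then e i j else e j i))).
Proof.
apply/andP; split; last by apply/forallP => i; rewrite mxE eqxx.
apply/eqP/matrixP => i j; rewrite !mxE eq_sym.
by case: (ltngtP i j) => // /val_inj ->.
Qed.

Definition graph_of_rel (e : rel 'I_N) : graph N :=
  Graph (graph_of_rel_subproof e).

Lemma graph_of_relE e i j :
  graph_of_rel e i j = (i != j) && (if (i < j)%N then e i j else e j i).
Proof. by rewrite /= mxE. Qed.

Variables (R : realType) (p : 'I_N -> 'I_N -> R).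

Definition gweight G : R :=
  \prod_(e : 'I_N * 'I_N | (e.1 < e.2)%N)
    bernoulli_pmf (p e.1 e.2) (G e.1 e.2).

Definition Ex (F : graph N -> R) : R := \sum_G gweight G * F G.

Lemma graph_probE A : graph_prob p A = Ex (fun G => (A G)%:R).
Proof.
rewrite /graph_prob /Ex big_mkcond; apply: eq_bigr => G _.
rewrite /gweight pair_big_dep /=.
by case: (A G); rewrite ?mulr1 ?mulr0.
Qed.

Lemma Ex_prod (g : 'I_N -> 'I_N -> bool -> R) :
  Ex (fun G => \prod_(e : 'I_N * 'I_N | (e.1 < e.2)%N) g e.1 e.2 (G e.1 e.2)) =
  \prod_(e : 'I_N * 'I_N | (e.1 < e.2)%N)
    (p e.1 e.2 * g e.1 e.2 true + (1 - p e.1 e.2) * g e.1 e.2 false).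
Proof.
(* Graphs are matched with the functions on all ordered pairs that are [false] off the increasing
   ones; [Q] expresses this constraint and [F] is [1] at the idle pairs, so that the product of sums
   can be distributed. *)
pose Q (e : 'I_N * 'I_N) := [pred b : bool | (e.1 < e.2)%N || ~~ b].
pose F (e : 'I_N * 'I_N) b : R :=
  if (e.1 < e.2)%N then bernoulli_pmf (p e.1 e.2) b * g e.1 e.2 b else 1.
have -> : \prod_(e : 'I_N * 'I_N | (e.1 < e.2)%N)
    (p e.1 e.2 * g e.1 e.2 true + (1 - p e.1 e.2) * g e.1 e.2 false)
    = \prod_(e : 'I_N * 'I_N) \sum_(b | Q e b) F e b.
  rewrite big_mkcond; apply: eq_bigr => e _; rewrite /F /=.
  rewrite big_mkcond big_bool /=.
  by case: ifP => _; rewrite /= ?add0r.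
rewrite bigA_distr_big_dep /Ex.
pose of_graph G := [ffun e : 'I_N * 'I_N => (e.1 < e.2)%N && G e.1 e.2].
pose to_graph (f : {ffun 'I_N * 'I_N -> bool}) :=
  graph_of_rel (fun i j => f (i, j)).
rewrite (reindex_onto to_graph of_graph) /=; last first.
  move=> G _; apply: graph_eqP => i j; rewrite graph_of_relE !ffunE /=.
  rewrite (graph_sym G j i) -val_eqE.
  by case: (ltngtP i j) => //= /val_inj ->; rewrite graph_irr.
have toE f (e : 'I_N * 'I_N) : (e.1 < e.2)%N -> to_graph f e.1 e.2 = f e.
  by case: e => i j /= ij; rewrite mxE ij -val_eqE /= ltn_eqF.
apply: eq_big => [f|f _].
  apply/eqP/familyP => [<- e|hf].
    by rewrite !ffunE /in_mem /=; case: (_ < _)%N.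
  apply/ffunP => e; rewrite ffunE; have := hf e; rewrite /Q /in_mem /=.
  by case: ltnP => //= [/toE ->//|_ /negbTE].
rewrite /gweight -big_split /= [LHS]big_mkcond.
apply: eq_bigr => e _; rewrite /F /=.
by case: ifP => // ij; have /= -> := toE f e ij.
Qed.

Lemma Ex_1 : Ex (fun=> 1) = 1.
Proof.
have := Ex_prod (fun _ _ _ => 1); under [X in _ = X]eq_bigr do rewrite !mulr1 addrC subrK.
by rewrite big1// => <-; apply: eq_bigr => G _; rewrite big1.
Qed.

Hypothesis p01 : forall i j, 0 <= p i j <= 1.

Lemma gweight_ge0 G : 0 <= gweight G.
Proof. by apply: prodr_ge0 => e _; apply: bernoulli_pmf_ge0. Qed.

Lemma Ex_ge0 F : (forall G, 0 <= F G) -> 0 <= Ex F.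
Proof. by move=> F0; apply: sumr_ge0 => G _; rewrite mulr_ge0// gweight_ge0. Qed.

Lemma ler_Ex F F' : (forall G, F G <= F' G) -> Ex F <= Ex F'.
Proof. by move=> h; apply: ler_sum => G _; rewrite ler_wpM2l// gweight_ge0. Qed.

Lemma Ex_sum (I : finType) (P : pred I) (F : I -> graph N -> R) :
  Ex (fun G => \sum_(i | P i) F i G) = \sum_(i | P i) Ex (F i).
Proof. by rewrite /Ex exchange_big; apply: eq_bigr => G _; rewrite mulr_sumr. Qed.

Lemma ExZ a F : Ex (fun G => a * F G) = a * Ex F.
Proof. by rewrite /Ex mulr_sumr; apply: eq_bigr => G _; rewrite mulrCA. Qed.

Lemma chebyshev_Ex (F : graph N -> R) (m t : R) : 0 < t ->
  Ex (fun G => (t <= `|F G - m|)%R%:R) <= Ex (fun G => (F G - m) ^+ 2) / t ^+ 2.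
Proof.
move=> t0; rewrite ler_pdivlMr ?exprn_gt0// mulrC -ExZ; apply: ler_Ex => G.
have [h|_] := lerP t; last by rewrite /= mulr0n mulr0 sqr_ge0.
by rewrite /= mulr1n mulr1 -[leRHS]real_normK ?num_real// ler_sqr ?nnegrE// ltW.
Qed.

Definition local_on (T : Type) (A : {set 'I_N}) (F : graph N -> T) :=
  forall G G', {in A &, forall i j, G i j = G' i j} -> F G = F G'.

Definition mix (B : {set 'I_N}) G G' :=
  graph_of_rel (fun i j => if (i \in B) && (j \in B) then G' i j else G i j).

Lemma mixE B G G' i j :
  mix B G G' i j = if (i \in B) && (j \in B) then G' i j else G i j.
Proof.
rewrite graph_of_relE !(graph_sym _ j i) andbC (andbC (j \in B)) if_same.
have [->|ij] := eqVneq i j; last by rewrite andbT.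
by rewrite !graph_irr if_same.
Qed.

(* Swapping the restrictions to [B] of two independent copies of the graph is a
   measure-preserving involution. *)
Lemma Ex_indep (A B : {set 'I_N}) F F' : A :&: B = finset.set0 ->
  local_on A F -> local_on B F' -> Ex (fun G => F G * F' G) = Ex F * Ex F'.
Proof.
move=> AB0 locF locF'.
pose sw (x : graph N * graph N) := (mix B x.1 x.2, mix B x.2 x.1).
have swK : involutive sw.
  move=> [G G']; congr (_, _); apply: graph_eqP => i j; rewrite !mixE/=;
  by case: ifP => // ->.
transitivity (\sum_(x : graph N * graph N)
    gweight x.1 * gweight x.2 * (F x.1 * F' x.1)).
  rewrite -(pair_bigA _ (fun G G' => gweight G * gweight G' * (F G * F' G))) /=.
  apply: eq_bigr => G _.
  transitivity (gweight G * (F G * F' G) * Ex (fun=> 1)).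
    by rewrite Ex_1 mulr1.
  by rewrite mulr_sumr; apply: eq_bigr => G' _; rewrite mulr1 mulrAC.
transitivity (\sum_(x : graph N * graph N)
    gweight x.1 * gweight x.2 * (F x.1 * F' x.2)); last first.
  rewrite -(pair_bigA _ (fun G G' => gweight G * gweight G' * (F G * F' G'))) /=.
  rewrite mulr_suml; apply: eq_bigr => G _.
  by rewrite mulr_sumr; apply: eq_bigr => G' _; rewrite mulrACA.
rewrite [RHS](reindex_inj (inv_inj swK)) /=; apply: eq_bigr => -[G G'] _ /=.
congr (_ * (_ * _)).
- rewrite /gweight -!big_split /=; apply: eq_bigr => e _; rewrite !mixE.
  by case: ifP => // _; rewrite mulrC.
- apply: locF => i j iA jA; rewrite mixE.
  case: ifP => // /andP[iB _]; have := finset.in_set0 i.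
  by rewrite -AB0 finset.inE iA iB.
- by apply: locF' => i j iB jB; rewrite mixE iB jB.
Qed.

(** Disjoint vertex sets carry independent indicators, so only intersecting pairs have a covariance;
    there the nonnegative product of the means is dropped. *)
Lemma variance_count (CC : {set {set 'I_N}}) (X : {set 'I_N} -> pred (graph N)) :
    (forall C, C \in CC -> local_on C (X C)) ->
  Ex (fun G => (\sum_(C in CC) (X C G)%:R -
                Ex (fun G => \sum_(C in CC) (X C G)%:R)) ^+ 2) <=
  \sum_(C in CC) \sum_(C' in CC | C :&: C' != finset.set0)
     Ex (fun G => (X C G && X C' G)%:R).
Proof.
move=> loc; pose Z G : R := \sum_(C in CC) (X C G)%:R; pose m := Ex Z.
rewrite -[Ex (fun G => \sum_(C in CC) _)]/m.
have sqE x : Ex (fun G => (Z G - x) ^+ 2) =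
    Ex (fun G => Z G ^+ 2) - 2 * x * Ex Z + x ^+ 2.
  rewrite -[X in _ + X]mulr1 -[X in _ + _ * X]Ex_1 -!ExZ /Ex -sumrB -big_split /=.
  by apply: eq_bigr => G _; ring.
rewrite [leLHS](_ : _ = Ex (fun G => Z G ^+ 2) - m ^+ 2); last first.
  by rewrite sqE -/m; ring.
have -> : Ex (fun G => Z G ^+ 2) =
    \sum_(C in CC) \sum_(C' in CC) Ex (fun G => (X C G && X C' G)%:R).
  under [RHS]eq_bigr do rewrite -Ex_sum.
  rewrite -Ex_sum; congr Ex; apply/funext => G.
  rewrite expr2 /Z mulr_suml; apply: eq_bigr => C _.
  by rewrite mulr_sumr; apply: eq_bigr => C' _; rewrite -natrM mulnb.
have -> : m ^+ 2 = \sum_(C in CC) \sum_(C' in CC)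
     Ex (fun G => (X C G)%:R) * Ex (fun G => (X C' G)%:R).
  rewrite expr2 /m Ex_sum mulr_suml; apply: eq_bigr => C _.
  by rewrite mulr_sumr.
rewrite -sumrB; apply: ler_sum => C CCC.
rewrite -sumrB big_mkcondr; apply: ler_sum => C' CC'C.
case: eqP => /= [C0|_]; last first.
  by rewrite gerBl mulr_ge0// Ex_ge0// => G; apply: ler0n.
rewrite -(Ex_indep C0).
- rewrite -[X in _ - X](_ : Ex (fun G => (X C G && X C' G)%:R) = _) ?subrr//.
  by congr Ex; apply/funext => G; rewrite -natrM mulnb.
- by move=> G G' h; rewrite (loc _ CCC _ _ h).
- by move=> G G' h; rewrite (loc _ CC'C _ _ h).
Qed.

(** The representative of an unordered edge among the increasing pairs that index the weights. *)
Definition upair (x y : 'I_N) := if (x < y)%N then (x, y) else (y, x).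

(** Both presence and absence are prescribed, as an induced tree forbids every other edge inside its
    vertex set. *)
Lemma Ex_cylinder (Z : {set 'I_N * 'I_N}) (H : rel 'I_N) :
    (forall e, e \in Z -> (e.1 < e.2)%N) ->
  Ex (fun G => [forall e in Z, G e.1 e.2 == H e.1 e.2]%:R) =
  \prod_(e in Z) bernoulli_pmf (p e.1 e.2) (H e.1 e.2).
Proof.
move=> Zup.
pose g i j b : R := if (i, j) \in Z then (b == H i j)%:R else 1.
rewrite -[LHS](_ : Ex (fun G => \prod_(e : 'I_N * 'I_N | (e.1 < e.2)%N)
    g e.1 e.2 (G e.1 e.2)) = _); last first.
  congr Ex; apply/funext => G.
  case: forallP => [h|nh].
    rewrite big1// => -[i j] _; rewrite /g; case: ifP => // Z_ij.
    by have := h (i, j); rewrite Z_ij /= => ->.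
  have /existsP[e] : [exists e, ~~ ((e \in Z) ==> (G e.1 e.2 == H e.1 e.2))].
    by rewrite -negb_forall; apply/forallP.
  rewrite negb_imply => /andP[eZ ne].
  apply/eqP; rewrite (bigD1 e) ?Zup//= /g -surjective_pairing eZ.
  by rewrite (negbTE ne) mul0r.
rewrite Ex_prod [RHS]big_mkcond [LHS]big_mkcond; apply: eq_bigr => -[i j] _ /=.
rewrite /g; case: ifP => [ij|nij]; last first.
  by case: ifP => // /Zup /=; rewrite nij.
case: ifP => _; last by rewrite !mulr1 addrC subrK.
by case: (H i j); rewrite /= ?mulr1 ?mulr0 ?addr0 ?add0r.
Qed.

Lemma Ex_edges (I : finType) (P : pred I) (a b : I -> 'I_N) :
    (forall i j, p i j = p j i) -> (forall i, P i -> a i != b i) ->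
    {in P &, injective (fun i => upair (a i) (b i))} ->
  Ex (fun G => [forall (i | P i), G (a i) (b i)]%:R) =
  \prod_(i | P i) p (a i) (b i).
Proof.
move=> p_sym ab inj.
pose Z := [set upair (a i) (b i) | i in P]%SET.
have := @Ex_cylinder Z (fun _ _ => true).
rewrite big_imset //= => cyl.
rewrite (eq_bigr (fun i => bernoulli_pmf (p (upair (a i) (b i)).1
    (upair (a i) (b i)).2) true)); last first.
  by move=> i _; rewrite /upair; case: ifP => // _; rewrite p_sym.
rewrite -cyl; last first.
  move=> e /imsetP[i Pi ->]; rewrite /upair; case: ifP => //= /negbT.
  by rewrite -leqNgt leq_eqVlt val_eqE eq_sym (negbTE (ab _ Pi)).
congr Ex; apply/funext => G; congr ((nat_of_bool _)%:R).
have GE x y : G (upair x y).1 (upair x y).2 = G x y.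
  by rewrite /upair; case: ifP => // _; rewrite graph_sym.
apply/forall_inP/forall_inP => /= [h e /imsetP[i Pi ->]|h i Pi].
  by rewrite GE h.
by have := h _ (imset_f _ Pi); rewrite GE => /eqP.
Qed.

End GraphExpectation.

(** * Rooted trees as parent maps *)

Lemma upair_inj N (x y x' y' : 'I_N) : upair x y = upair x' y' ->
  (x = x' /\ y = y') \/ (x = y' /\ y = x').
Proof. by rewrite /upair; do 2 case: ifP => _; case=> -> ->; auto. Qed.

Section Rooting.
Variables (N : nat) (G : graph N).
Implicit Types (B C D E : {set 'I_N}) (f g : 'I_N -> 'I_N) (r : 'I_N).

(** The height is existential: the distance from the root and heights assembled from two forests
    both occur. *)
Definition descends C f := exists h : 'I_N -> nat, {in C, forall v, (h (f v) < h v)%N}.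

(** The third clause makes the parent edges exhaust the edges of [G] inside [C]; this is where
    acyclicity is recorded. *)
Definition rooting C r f : Prop :=
  [/\ r \in C, {in C :\ r, forall v, (f v \in C) && G v (f v)},
    {in C &, forall u v, G u v -> (u != r /\ f u = v) \/ (v != r /\ f v = u)}
    & descends (C :\ r) f].

Lemma induced_edge_sym C : symmetric (induced_edge G C).
Proof. by move=> x y; rewrite /induced_edge /= graph_sym andbCA. Qed.

(** Breadth-first search: the parent is a neighbour closer to [r], and the distance from [r] is the
    height. *)
Lemma connected_parent C r : induced_connected G C -> r \in C ->
  exists f, {in C :\ r, forall v, (f v \in C) && G v (f v)} /\
    descends (C :\ r) f.
Proof.
move=> [_ conn] rC; set e := induced_edge G C in conn.
pose P v m := `[< exists s, [/\ path e r s, last r s = v & size s = m] >].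
(* The distance from [r]; the default [0] of unreachable vertices never occurs on [C]. *)
pose d v := if pselect (exists m, P v m) is left h then ex_minn h else 0%N.
have dP v s : path e r s -> last r s = v -> (d v <= size s)%N.
  move=> ps ls; rewrite /d; case: pselect => [h|[]]; last first.
    by exists (size s); apply/asboolP; exists s.
  by case: ex_minnP => m _; apply; apply/asboolP; exists s.
pose f v := odflt v [pick u | [&& u \in C, G v u & (d u < d v)%N]].
have fP : {in C :\ r, forall v, [&& f v \in C, G v (f v) & (d (f v) < d v)%N]}.
  move=> v; rewrite !finset.inE => /andP[vr vC]; rewrite /f; case: pickP => //= no.
  have /connectP[s0 ps0 ls0] := conn _ _ rC vC.
  have [s [ps ls ss]] : exists s, [/\ path e r s, last r s = v & size s = d v].
    rewrite /d; case: pselect => [h|[]]; last first.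
      by exists (size s0); apply/asboolP; exists s0.
    by case: ex_minnP => m /asboolP.
  case/lastP: s ps ls ss => [|s x]; first by move=> _ /= rv; rewrite rv eqxx in vr.
  rewrite rcons_path last_rcons size_rcons => /andP[ps /and3P[uC _ Gu]] xv ss.
  have := no (last r s); rewrite uC graph_sym -xv Gu /= xv -ss ltnS.
  by rewrite (dP _ s).
exists f; split; first by move=> v /fP /and3P[-> ->].
by exists d => v /fP /and3P[].
Qed.

Lemma descends_connect (e : rel 'I_N) C r f : descends (C :\ r) f ->
    {in C :\ r, forall v, (f v \in C) && e v (f v)} ->
  {in C, forall v, connect e v r}.
Proof.
move=> [h hf] fC v; have [n] := ubnP (h v); elim: n v => // n IH v hv vC.
have [->|vr] := eqVneq v r; first exact: connect0.
have vCr : v \in C :\ r by rewrite !finset.inE vr.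
have /andP[fvC ev] := fC _ vCr.
apply: connect_trans (connect1 ev) (IH _ _ fvC).
exact: leq_trans (hf _ vCr) _.
Qed.

(** An edge between [u] and [v] that is not a parent edge would be bypassed by the parent edges,
    which join both ends to [r]; the bypass and the edge close up to a cycle. *)
Lemma tree_rooting C r : induced_tree G C -> r \in C ->
  exists f, rooting C r f.
Proof.
move=> [conn acyc] rC; have [f [fC desc]] := connected_parent conn rC.
exists f; split=> // u v uC vC Guv.
have [fuv|nuv] := pselect (u != r /\ f u = v); first by left.
have [fvu|nvu] := pselect (v != r /\ f v = u); first by right.
exfalso.
pose bad x y := (x == u) && (y == v).
pose e x y := induced_edge G C x y && ~~ (bad x y || bad y x).
have e_sym : symmetric e by move=> x y; rewrite /e induced_edge_sym orbC.
have cr : {in C, forall w, connect e w r}.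
  apply: descends_connect desc _ => w wCr; have /andP[fwC Gw] := fC _ wCr.
  move: wCr; rewrite !finset.inE => /andP[wr wC].
  rewrite fwC /e /induced_edge /= wC fwC Gw /= negb_or /bad; apply/andP; split; apply/negP.
    by move=> /andP[/eqP wu /eqP fwv]; apply: nuv; rewrite -wu.
  by move=> /andP[/eqP fwu /eqP wv]; apply: nvu; rewrite -wv.
have : connect e u v.
  by apply: connect_trans (cr _ uC) _; rewrite (sym_connect_sym) ?cr.
move=> /connectP[s0 ps0 ls0]; move: ls0; case/shortenP: ps0 => s ps us _ ls.
have ies : path (induced_edge G C) u s.
  by apply: sub_path ps => x y /andP[].
apply: (acyc (u :: s)); last first.
  by rewrite /ucycle us andbT /= rcons_path ies -ls /induced_edge /= graph_sym Guv uC vC.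
(* Distinct ends and the deleted edge exclude bypasses of length 0 and 1, so the cycle has at least
   three vertices. *)
case: s ps ls {us ies} => [_ /= vu|x [|y s]] //=.
  by move: Guv; rewrite vu graph_irr.
by move=> /andP[exu _] xv; move: exu; rewrite /e /bad xv !eqxx /= andbF.
Qed.

(** Induction on the height of [g]: if [f] pointed from [g v] back to [v], the induction hypothesis
    at [g v] would make [g] swap the two. With [B = C] this is uniqueness; for smaller [B] it says
    that the parent map of a subtree is a restriction. *)
Lemma rooting_unique B C r f g : rooting C r f -> rooting B r g -> B \subset C ->
  {in B :\ r, f =1 g}.
Proof.
move=> [_ _ edge _] [_ gB _ [h hg]] BC v.
have [n] := ubnP (h v); elim: n v => // n IH v hv vBr.
have /andP[gvB Gv] := gB _ vBr.
have /andP[vr vB] : (v != r) && (v \in B) by move: vBr; rewrite !finset.inE.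
have [[_ //]|[gvr fgv]] := edge _ _ (fintype.subsetP BC _ vB) (fintype.subsetP BC _ gvB) Gv.
have gvBr : g v \in B :\ r by rewrite !finset.inE gvr.
have hgv := hg _ vBr.
have := IH _ (leq_trans hgv hv) gvBr; rewrite fgv => vgg.
by have := hg _ gvBr; rewrite -vgg ltnNge (ltnW hgv).
Qed.

Lemma descends_edge_inj E f : descends E f ->
  {in E &, injective (fun v => upair v (f v))}.
Proof.
move=> [h hf] u v uE vE /upair_inj[[]//|[uf fu]].
by have := hf _ uE; have := hf _ vE; rewrite -uf fu => hu /(ltn_trans hu); rewrite ltnn.
Qed.

Lemma rooting_edge_inj C r f : rooting C r f ->
  {in C :\ r &, injective (fun v => upair v (f v))}.
Proof. by move=> [_ _ _ /descends_edge_inj]. Qed.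

Definition edges_in D : {set 'I_N * 'I_N} :=
  [set e : 'I_N * 'I_N | [&& (e.1 < e.2)%N, e.1 \in D, e.2 \in D & G e.1 e.2]]%SET.

Lemma upair_edges_in D x y : (upair x y \in edges_in D) =
  [&& x \in D, y \in D & G x y].
Proof.
rewrite finset.inE /upair; case: (ltngtP x y) => [xy|yx|/val_inj ->] /=.
  by rewrite xy.
  by rewrite yx /= graph_sym andbCA.
by rewrite ltnn graph_irr !andbF.
Qed.

(** Each edge inside [D] is charged to its child. The count of edges does not mention the rooting,
    so two trees with overlap [D] leave it equally often, provided both roots or neither lie in
    [D]. *)
Lemma card_rooting C D r f : rooting C r f -> D \subset C ->
  #|[set v in D :\ r | f v \in D]%SET| = #|edges_in D|.
Proof.
move=> rt DC; have [rC fC edge _] := rt.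
have sub : {subset [set v in D :\ r | f v \in D]%SET <= C :\ r}.
  move=> v; rewrite !finset.inE => /andP[/andP[-> vD] _].
  exact: fintype.subsetP DC _ vD.
rewrite -(card_in_imset (f := fun v => upair v (f v))); last first.
  by move=> u v /sub uC /sub vC; apply: (rooting_edge_inj rt).
congr #|pred_of_set _|; apply/setP => e; apply/imsetP/idP => [[v vD ->]|].
  rewrite upair_edges_in; have /andP[_ ->] := fC _ (sub _ vD).
  by move: vD; rewrite !finset.inE => /andP[/andP[_ ->] ->].
rewrite finset.inE => /and4P[lt12 e1D e2D Ge].
have [[e1r fe1]|[e2r fe2]] := edge _ _ (fintype.subsetP DC _ e1D) (fintype.subsetP DC _ e2D) Ge.
  exists e.1; first by rewrite !finset.inE e1r e1D fe1.
  by rewrite fe1 /upair lt12; case: e {lt12 e1D e2D Ge e1r fe1}.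
exists e.2; first by rewrite !finset.inE e2r e2D fe2.
rewrite fe2 /upair ltnNge (ltnW lt12) /=.
by case: e {lt12 e1D e2D Ge e2r fe2}.
Qed.

(** On a cycle, both neighbours of a vertex of maximal height would have to be its parent. *)
Lemma rooting_tree C r f : rooting C r f -> induced_tree G C.
Proof.
move=> [rC fC edge [h hf]]; split.
  split; first by apply/set0Pn; exists r.
  have cr : {in C, forall v, connect (induced_edge G C) v r}.
    apply: (descends_connect (f := f)); first by exists h.
    move=> v vC; have /andP[fvC Gv] := fC _ vC.
    by move: vC; rewrite !finset.inE => /andP[_ vC]; rewrite /induced_edge /= vC fvC.
  move=> x y xC yC; apply: connect_trans (cr _ xC) _.
  by rewrite (sym_connect_sym (@induced_edge_sym C)) cr.
move=> s s3 /andP[cyc uniq_s].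
have s0 : exists x, x \in s by case: s s3 {cyc uniq_s} => // x s; exists x; rewrite mem_head.
have [x xs xmax] : exists2 x, x \in s & {in s, forall y, (h y <= h x)%N}.
  have [x0 x0s] := s0.
  case: (@arg_maxnP _ x0 (mem s) h x0s) => x xs xm.
  by exists x => // y; apply: xm.
have [i t st] := rot_to xs.
have {cyc}: cycle (induced_edge G C) (x :: t) by rewrite -st rot_cycle.
have {uniq_s}: uniq (x :: t) by rewrite -st rot_uniq.
have {}s3 : (3 <= size (x :: t))%N by rewrite -st size_rot.
have {xs}xm : {in t, forall y, (h y <= h x)%N}.
  by move=> y yt; apply: xmax; rewrite -(mem_rot i) st in_cons yt orbT.
have nb y : y \in t -> induced_edge G C x y -> f x = y.
  move=> yt /and3P[xC yC Gxy].
  have [[//]|[yr fy]] := edge _ _ xC yC Gxy.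
  have yCr : y \in C :\ r by rewrite !finset.inE yr.
  by have := hf _ yCr; rewrite fy ltnNge xm.
case: t {st} s3 xm nb => [//|y t]; case/lastP: t => [//|t z] _ _ nb uniq_s.
rewrite /= rcons_path last_rcons => /andP[xy /andP[_ zx]].
have fy := nb y (mem_head _ _) xy.
have fz : f x = z.
  by apply: nb; rewrite ?in_cons ?mem_rcons ?mem_head ?orbT// induced_edge_sym.
move: uniq_s; rewrite /= => /and3P[_ + _].
by rewrite -fy fz mem_rcons mem_head.
Qed.

End Rooting.

(** * Encoding of a pair of intersecting trees *)

Section CoreTree.
Variable N : nat.
Implicit Types (G : graph N) (U C D : {set 'I_N}) (r : 'I_N).

(** If [C] lies in [U] this is just an induced tree on [C], so a single second-moment argument
    serves the counts under the null and the planted ones. *)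
Definition core_tree U C G : bool :=
  `[< induced_tree G C /\ induced_connected G (C :&: U) >].

Lemma core_tree_local U C : local_on C (core_tree U C).
Proof.
move=> G G' GG'; rewrite /core_tree.
have E D : D \subset C -> induced_edge G D = induced_edge G' D.
  move=> /fintype.subsetP DC; rewrite /induced_edge; congr SimplRel.
  apply/funext => x; apply/funext => y /=.
  case xD: (x \in D) => //=; case yD: (y \in D) => //=.
  by rewrite GG' ?DC.
rewrite /induced_tree /induced_connected /induced_acyclic.
by rewrite !E ?subsetIl.
Qed.

(** The trace on [U] is a tree with the same root, so its parent map is the restriction of [f]. A
    vertex of [U] therefore chooses its parent among [#|C :&: U|] vertices only. *)
Lemma core_rooting G U C r : core_tree U C G -> r \in C :&: U ->
  exists2 f, rooting G C r f & {in C :\ r, forall v, v \in U -> f v \in U}.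
Proof.
move=> /asboolP[treeC connCU] rCU; have CUC : C :&: U \subset C by apply: subsetIl.
have [f rf] := tree_rooting treeC (fintype.subsetP CUC _ rCU).
have treeCU : induced_tree G (C :&: U).
  split=> // s s3 /andP[cyc us]; apply: (treeC.2 s s3); rewrite /ucycle us andbT.
  apply: sub_cycle cyc => x y /=; rewrite /induced_edge /= !finset.inE.
  by move=> /and3P[/andP[-> _] /andP[-> _] ->].
have [g rg] := tree_rooting treeCU rCU.
exists f => // v; rewrite !finset.inE => /andP[vr vC] vU.
have vCU : v \in (C :&: U) :\ r by rewrite !finset.inE vr vC.
rewrite (rooting_unique rf rg CUC vCU).
by have [_ /(_ _ vCU)] := rg; rewrite !finset.inE => /andP[/andP[_ ->]].
Qed.

Lemma descends_exit C r f D : descends (C :\ r) f -> D \subset C :\ r ->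
  D != finset.set0 -> exists2 v, v \in D & f v \notin D.
Proof.
move=> [h hf] /fintype.subsetP DC /set0Pn[v0 v0D].
case: (@arg_minnP _ v0 (mem D) h v0D) => v vD vmin.
exists v => //; apply/negP => /vmin; rewrite leqNgt.
by rewrite (hf v (DC _ vD)).
Qed.

(** Index of a required edge: [inl v] for the edge from [v] to its parent in the first tree, [inr v]
    for a kept one of the second; a fixed point of [h] means that none is kept. *)
Definition code_idx C r (f h : {ffun 'I_N -> 'I_N}) (i : 'I_N + 'I_N) : bool :=
  match i with inl v => v \in C :\ r | inr v => h v != v end.
Definition code_src (i : 'I_N + 'I_N) : 'I_N :=
  match i with inl v => v | inr v => v end.
Definition code_dst (f h : {ffun 'I_N -> 'I_N}) (i : 'I_N + 'I_N) : 'I_N :=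
  match i with inl v => f v | inr v => h v end.

Section Pair.
Variables (U C C' : {set 'I_N}) (r r' : 'I_N).
Local Notation D := (C :&: C').
Local Notation idx := (code_idx C r).
Local Notation src := code_src.
Local Notation dst := code_dst.

(* [f] is the parent map of the first tree rooted at [r]; [h] is the parent map
   of the second tree rooted at [r'], kept only where it leaves [C], so that no
   edge is listed twice. *)
Definition pair_code (fh : {ffun 'I_N -> 'I_N} * {ffun 'I_N -> 'I_N}) : bool :=
  let: (f, h) := fh in
  [&& [forall v, if v \in C :\ r then [&& f v \in C, (v \in U) ==> (f v \in U) & f v != v]
                 else f v == v],
      [forall v, if v \in C' :\ r' :\: D
                 then [&& h v \in C', (v \in U) ==> (h v \in U) & h v != v]
                 else (h v == v) || (v \in D) && (h v \in C' :\: D)],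
      #|[set v in D :\ r | f v \notin D]%SET| == #|[set v in D | h v != v]%SET|,
      (r' \notin D) && (D != finset.set0) ==> (0 < #|[set v in D | h v != v]%SET|)%N &
      [forall i, forall j, [&& idx f h i, idx f h j &
         upair (src i) (dst f h i) == upair (src j) (dst f h j)] ==> (i == j)]].

Lemma core_pair_code G : core_tree U C G -> core_tree U C' G ->
    r \in C :&: U -> r' \in C' :&: U -> #|D :\ r| = #|D :\ r'| ->
  exists2 fh, pair_code fh &
    [forall (i | idx fh.1 fh.2 i), G (src i) (dst fh.1 fh.2 i)].
Proof.
move=> XC XC' rCU rCU' cardD.
have [f0 rf fU] := core_rooting XC rCU.
have [g rg gU] := core_rooting XC' rCU'.
have DC : D \subset C by apply: subsetIl.
have DC' : D \subset C' by apply: subsetIr.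
have [_ fC _ [hf hfP]] := rf; have [_ gC _ [hg hgP]] := rg.
pose f : {ffun 'I_N -> 'I_N} := [ffun v => if v \in C :\ r then f0 v else v].
(* A parent edge of the second tree with both ends in the overlap is an edge of [G] inside [C],
   hence already listed by the first tree. *)
pose keep v := (v \in C' :\ r') && ((v \notin D) || (g v \notin D)).
pose h : {ffun 'I_N -> 'I_N} := [ffun v => if keep v then g v else v].
have gne v : v \in C' :\ r' -> g v != v.
  by move=> vC; apply/eqP => gv; have := hgP _ vC; rewrite gv ltnn.
have hne v : (h v != v) = keep v.
  rewrite ffunE; case: ifP => [/andP[vC _]|]; last by rewrite eqxx.
  exact: gne.
have hE v : keep v -> h v = g v by rewrite ffunE => ->.
have fE v : v \in C :\ r -> f v = f0 v by rewrite ffunE => ->.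
have setA : [set v in D | h v != v]%SET = [set v in D :\ r' | g v \notin D]%SET.
  apply/setP => v; rewrite !finset.inE hne /keep !finset.inE.
  by case: (v \in C); case: (v \in C'); rewrite ?andbF//= ?andbT.
exists (f, h) => /=.
  apply/and5P; split.
  - apply/forallP => v; rewrite ffunE; case vC: (v \in C :\ r); last by rewrite eqxx.
    have /andP[-> _] := fC _ vC; rewrite /=; apply/andP; split; first by apply/implyP; apply: (fU _ vC).
    by apply/eqP => fv; have := hfP _ vC; rewrite fv ltnn.
  - apply/forallP => v; case: ifP => vCD.
      have /andP[vnD vC] : (v \notin D) && (v \in C' :\ r') by rewrite -finset.in_setD.
      have kv : keep v by rewrite /keep vC vnD.
      rewrite hE//; have /andP[-> _] := gC _ vC; rewrite gne// andbT /=.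
      by apply/implyP; apply: (gU _ vC).
    case kv: (keep v); last by rewrite ffunE kv eqxx.
    rewrite hE//; case/andP: kv => vC kv.
    have vD : v \in D by move: vCD; rewrite finset.in_setD vC andbT => /negbFE.
    have /andP[gvC _] := gC _ vC; move: kv; rewrite vD /= => gvD.
    by rewrite finset.in_setD gvD gvC orbT.
  (* Equal numbers of exits: each tree has as many parent edges inside [D] as [G] has edges
     there. *)
  - rewrite setA; apply/eqP.
    have cf := card_rooting rf DC; have cg := card_rooting rg DC'.
    have sep (P : pred 'I_N) (B : {set 'I_N}) :
        [set v in B | ~~ P v]%SET = B :\: [set v in B | P v]%SET.
      by apply/setP => v; rewrite !finset.inE; case: (v \in B); case: (P v).
    have -> : [set v in D :\ r | f v \notin D]%SET = [set v in D :\ r | f0 v \notin D]%SET.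
      apply/setP => v; rewrite finset.in_set [RHS]finset.in_set; apply: andb_id2l => vD.
      by rewrite fE//; apply: (fintype.subsetP (finset.setSD _ DC)).
    rewrite !sep.
    rewrite (cardsD (D :\ r)) (cardsD (D :\ r')).
    have sub (P : pred 'I_N) (B : {set 'I_N}) : B :&: [set v in B | P v]%SET = [set v in B | P v]%SET.
      by apply/setP => v; rewrite !finset.inE; case: (v \in B).
    by rewrite !sub cf cg cardD.
  - apply/implyP => /andP[rD D0]; rewrite setA.
    have DCr : D \subset C' :\ r'.
      apply/fintype.subsetP => v vD; rewrite finset.in_setD1 (fintype.subsetP DC' _ vD) andbT.
      by apply: contraNneq rD => <-.
    have [v vD gvD] : exists2 v, v \in D & g v \notin D.
      by apply: descends_exit DCr D0; exists hg.
    apply/card_gt0P; exists v; rewrite finset.inE finset.in_setD1 vD gvD !andbT.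
    by apply: contraNneq rD => <-.
  (* An edge listed twice would have both ends in [C] and in [C'], hence in [D], and would not have
     been kept. *)
  - have mixed v u : v \in C :\ r -> keep u -> upair v (f0 v) = upair u (g u) -> False.
      move=> vC /andP[uC uD] /upair_inj eq_e.
      have vCC : v \in C by move: vC; rewrite finset.in_setD1 => /andP[].
      have uCC : u \in C' by move: uC; rewrite finset.in_setD1 => /andP[].
      have /andP[fvC _] := fC _ vC; have /andP[guC _] := gC _ uC.
      have {eq_e} [uC2 guC2] : u \in C /\ g u \in C by case: eq_e => -[<- <-].
      by move: uD; rewrite /D !finset.in_setI uC2 uCC guC2 guC.
    apply/forallP => -[v|v]; apply/forallP => -[u|u]; apply/implyP => /=;
      rewrite ?hne => /and3P[vC uC /eqP].
    + rewrite !fE// => /(rooting_edge_inj rf vC uC) -> //.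
    + by rewrite fE// hE// => /(mixed _ _ vC uC).
    + by rewrite fE// hE// => /esym /(mixed _ _ uC vC).
    + rewrite !hE//; case/andP: vC => vC _; case/andP: uC => uC _.
      by move=> /(rooting_edge_inj rg vC uC) ->.
apply/forall_inP => -[v|v] /=.
  by move=> vC; rewrite fE//; have /andP[] := fC _ vC.
by rewrite hne => kv; rewrite hE//; case/andP: kv => /gC /andP[].
Qed.

Variables (R : realType) (p : 'I_N -> 'I_N -> R).
Hypothesis p_sym : forall i j, p i j = p j i.
Hypothesis p01 : forall i j, 0 <= p i j <= 1.

Lemma Ex_pair_code fh : pair_code fh ->
  Ex p (fun G => [forall (i | idx fh.1 fh.2 i), G (src i) (dst fh.1 fh.2 i)]%:R) =
  \prod_(v in C :\ r) p v (fh.1 v) * \prod_(v | fh.2 v != v) p v (fh.2 v).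
Proof.
case: fh => f h /= /and5P[/forallP fP _ _ _ /forallP inj].
rewrite Ex_edges// ?big_sumType//.
  case=> v /=; last by rewrite eq_sym.
  by move=> vC; have := fP v; rewrite vC => /and3P[_ _]; rewrite eq_sym.
move=> i j Pi Pj /eqP eij; have /forallP/(_ j) := inj i.
by rewrite [idx _ _ i]Pi [idx _ _ j]Pj eij /= => /eqP.
Qed.

Lemma Ex_pair_sum : r \in C :&: U -> r' \in C' :&: U -> #|D :\ r| = #|D :\ r'| ->
  Ex p (fun G => (core_tree U C G && core_tree U C' G)%:R) <=
  \sum_(fh | pair_code fh)
    \prod_(v in C :\ r) p v (fh.1 v) * \prod_(v | fh.2 v != v) p v (fh.2 v).
Proof.
move=> rC rC' cardD.
under eq_bigr => fh fhP do rewrite -(Ex_pair_code fhP).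
rewrite -Ex_sum; apply: ler_Ex => // G.
case: andP => [[XC XC']|_]; last by apply: sumr_ge0 => fh _; apply: ler0n.
have [fh fhP allG] := core_pair_code XC XC' rC rC' cardD.
rewrite (bigD1 fh)//= allG ler_wpDr// sumr_ge0// => *; exact: ler0n.
Qed.

(** * Weighted sum over the codes *)

Variables (pi0 pi1 theta : R).
Hypothesis (pi0_ge0 : 0 <= pi0) (pi01 : pi0 <= pi1).
Hypothesis (theta01 : 0 <= theta <= 1) (pi1_theta : pi1 <= theta ^+ 4).
Let w v := if v \in U then pi1 else pi0.
Hypothesis p_le : forall i j, i \in C :|: C' -> p i j <= w i.

Let pi1_ge0 : 0 <= pi1. Proof. exact: le_trans pi01. Qed.
Let w_ge0 v : 0 <= w v. Proof. by rewrite /w; case: ifP. Qed.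
Let theta_ge0 : 0 <= theta. Proof. by case/andP: theta01. Qed.

(* If the trees share a root and the shared vertices induce a forest with [x + 1]
   components, then the maps [f] and [h] both leave it [x] times, and [x] edges are
   present beyond those of a connected overlap.  Their probability, at most
   [theta ^+ (4 * x)], is shared out as one factor [theta] per exit of [f] and of
   [h], so that the sum over codes factorizes over the vertices. *)
Let Phi v u : R :=
  if v \in C :\ r then
    if (u \in C) && ((v \in U) ==> (u \in U))
    then w v * (if (v \in D) && (u \notin D) then theta else 1) else 0
  else (u == v)%:R.

Let Psi v u : R :=
  if v \in C' :\ r' :\: D then
    if (u \in C') && ((v \in U) ==> (u \in U)) then w v else 0
  else if v \in D then
    (u == v)%:R + (u \in C')%:R * theta
  else (u == v)%:R.

Let Phi_ge0 v u : 0 <= Phi v u.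
Proof.
rewrite /Phi; do 2 (case: ifP => _; rewrite ?ler0n//).
by rewrite mulr_ge0//; case: ifP.
Qed.

Let Psi_ge0 v u : 0 <= Psi v u.
Proof.
rewrite /Psi; case: ifP => _; first by case: ifP.
by case: ifP; rewrite ?addr_ge0 ?mulr_ge0 ?ler0n.
Qed.

(** Then some vertex of the overlap leaves it through [h], so at least one surplus edge is present
    and a factor [theta ^+ 2] can be spared. *)
Definition separate_roots : bool := (r' \notin D) && (D != finset.set0).

Let pair_term_le fh : pair_code fh ->
  \prod_(v in C :\ r) p v (fh.1 v) * \prod_(v | fh.2 v != v) p v (fh.2 v) <=
  (if separate_roots then theta ^+ 2 else 1) *
  (\prod_v Phi v (fh.1 v) * \prod_v Psi v (fh.2 v)).
Proof.
case: fh => f h /= /and5P[/forallP fP /forallP hP /eqP cardA sepP _].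
set a' := #|[set v in D | h v != v]%SET| in cardA sepP.
have memf v : (v \in [set v in D :\ r | f v \notin D]%SET) = (v \in D :\ r) && (f v \notin D).
  exact: finset.in_set.
have memh v : (v \in [set v in D | h v != v]%SET) = (v \in D) && (h v != v).
  exact: finset.in_set.
have Phi_f : \prod_v Phi v (f v) = \prod_(v in C :\ r) w v * theta ^+ a'.
  rewrite -cardA -[X in _ * X]prodr_const [X in _ * X]big_mkcond.
  rewrite [X in X * _]big_mkcond -big_split /=; apply: eq_bigr => v _.
  rewrite /Phi memf; have := fP v; case vC: (v \in C :\ r); last first.
    move=> /eqP ->; rewrite eqxx; case: ifP; rewrite ?mulr1//.
    move: vC; rewrite !finset.in_setD1 finset.in_setI => vC.
    by move=> /andP[/andP[vr /andP[vC2 _]] _]; rewrite vr vC2 in vC.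
  have vDr : (v \in D :\ r) = (v \in D).
    by move: vC; rewrite !finset.in_setD1 => /andP[-> _].
  by move=> /and3P[-> -> _]; rewrite vDr.
have Psi_h : \prod_(v in C' :\ r' :\: D) w v * theta ^+ a' <= \prod_v Psi v (h v).
  rewrite -[X in _ * X]prodr_const [X in _ * X]big_mkcond.
  rewrite [X in X * _]big_mkcond -big_split /=; apply: ler_prod => v _.
  apply/andP; split.
    by rewrite mulr_ge0//; case: ifP.
  have := hP v; rewrite /Psi memh.
  case vC: (v \in C' :\ r' :\: D).
    move=> /and3P[-> -> _] /=; case vD: (v \in D) => /=; last by rewrite mulr1.
    by move: vC; rewrite finset.in_setD vD.
  rewrite mul1r; case vD: (v \in D) => /=; last by rewrite orbF => ->.
  case: eqP => [->|_] /=.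
    by rewrite -[leLHS]addr0 lerD// mulr_ge0// ler0n.
  by rewrite finset.in_setD => /andP[_ ->]; rewrite add0r mul1r.
have h_le : \prod_(v | h v != v) p v (h v) <=
    \prod_(v in C' :\ r' :\: D) w v * theta ^+ (4 * a').
  rewrite exprM -[X in _ * X]prodr_const [X in _ * X]big_mkcond [leLHS]big_mkcond.
  rewrite [X in X * _]big_mkcond -big_split /=; apply: ler_prod => v _.
  apply/andP; split; first by case: ifP => // _; have /andP[] := p01 v (h v).
  have := hP v; rewrite memh.
  case vC: (v \in C' :\ r' :\: D).
    have vnD : v \in D = false.
      by move: vC; rewrite finset.in_setD => /andP[/negbTE].
    move=> /and3P[_ _ ->]; rewrite vnD /= mulr1 p_le//.
    move: vC; rewrite finset.in_setD finset.in_setD1 finset.in_setU.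
    by move=> /and3P[_ _ ->]; rewrite orbT.
  rewrite mul1r; case: eqP => [_|_]; rewrite ?andbF//= ?andbT => /andP[vD _].
  rewrite vD (le_trans (p_le _ _))//; first by rewrite finset.in_setU (fintype.subsetP (finset.subsetIl _ _) _ vD).
  by rewrite /w; case: ifP => _//; apply: le_trans pi1_theta.
rewrite Phi_f.
(* Of the [4 * a'] factors [theta], [2 * a'] pay for the exits of [f] and of [h]; with separate
   roots [a'] is positive, and the rest still contains [theta ^+ 2]. *)
have c_le : theta ^+ (4 * a') <= (if separate_roots then theta ^+ 2 else 1) *
    theta ^+ a' * theta ^+ a'.
  rewrite -mulrA -exprD; move: sepP; rewrite -/separate_roots.
  case: separate_roots => /= [a0|_].
    rewrite -exprD; apply: ler_wiXn2l => //.
      by case/andP: theta01.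
    by move: a0; lia.
  by rewrite mul1r; apply: ler_wiXn2l => //; [case/andP: theta01 | lia].
have w1 : 0 <= \prod_(v in C :\ r) w v by apply: prodr_ge0.
have w2 : 0 <= \prod_(v in C' :\ r' :\: D) w v by apply: prodr_ge0.
have c0 : 0 <= (if separate_roots then theta ^+ 2 else 1 : R).
  by case: ifP => // _; rewrite exprn_ge0.
apply: (@le_trans _ _ (\prod_(v in C :\ r) w v *
    (\prod_(v in C' :\ r' :\: D) w v * theta ^+ (4 * a')))).
  apply: ler_pM => //.
  - by apply: prodr_ge0 => v _; have /andP[] := p01 v (f v).
  - by apply: prodr_ge0 => v _; have /andP[] := p01 v (h v).
  apply: ler_prod => v vC; have /andP[-> _] := p01 v (f v) => /=.
  by apply: p_le; move: vC; rewrite finset.in_setD1 finset.in_setU => /andP[_ ->].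
apply: le_trans (ler_wpM2l c0 (ler_wpM2l (mulr_ge0 w1 (exprn_ge0 _ theta_ge0)) Psi_h)).
rewrite [leRHS](_ : _ = \prod_(v in C :\ r) w v * (\prod_(v in C' :\ r' :\: D) w v *
   ((if separate_roots then theta ^+ 2 else 1) * theta ^+ a' * theta ^+ a'))).
  by rewrite !ler_wpM2l.
by ring.
Qed.

(** The constraints linking [f] and [h] are forgotten once the terms are bounded, and the sum over
    all pairs of maps factorizes over the vertices. *)
Let pair_sum_le :
  \sum_(fh | pair_code fh)
    \prod_(v in C :\ r) p v (fh.1 v) * \prod_(v | fh.2 v != v) p v (fh.2 v) <=
  (if separate_roots then theta ^+ 2 else 1) *
  ((\prod_v (\sum_u Phi v u)) * \prod_v (\sum_u Psi v u)).
Proof.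
have distr (F : 'I_N -> 'I_N -> R) : \prod_v (\sum_u F v u) =
    \sum_(f : {ffun 'I_N -> 'I_N}) \prod_v F v (f v) by exact: bigA_distr_bigA.
rewrite !distr mulr_suml.
under [X in _ * X]eq_bigr do rewrite mulr_sumr.
rewrite pair_bigA mulr_sumr [leRHS](bigID pair_code) /= -[leLHS]addr0 lerD//.
  exact: ler_sum => fh /pair_term_le.
apply: sumr_ge0 => fh _; rewrite mulr_ge0//.
  by case: ifP => // _; rewrite exprn_ge0.
by rewrite mulr_ge0// prodr_ge0.
Qed.

Variables k q : nat.
Hypotheses (cardC : #|C| = k) (cardC' : #|C'| = k).
Hypotheses (cardCU : #|C :&: U| = q) (cardCU' : #|C' :&: U| = q).
Local Notation d := #|D|.
Local Notation d1 := #|D :&: U|.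

Let sumr_pred1 (v : 'I_N) : \sum_u (u == v)%:R = 1 :> R.
Proof.
rewrite (bigD1 v)//= eqxx big1 ?addr0// => u /negbTE -> //.
Qed.

Let wq v : R := if v \in U then q%:R else k%:R.
Let wd v : R := if v \in U then d1%:R else d%:R.

Let card_target (B : {set 'I_N}) v (a b : nat) : #|B| = a -> #|B :&: U| = b ->
  \sum_(u | (u \in B) && ((v \in U) ==> (u \in U))) 1 =
  (if v \in U then b%:R else a%:R) :> R.
Proof.
move=> <- <-; case: ifP => vU.
  rewrite (eq_bigl [in B :&: U]) ?sumr_const// => u.
  by rewrite finset.in_setI.
by rewrite (eq_bigl [in B]) ?sumr_const// => u; rewrite andbT.
Qed.

Let sum_Phi v : \sum_u Phi v u <=
  if v \in C :\ r then
    w v * (if v \in D then wd v + theta * k%:R else wq v)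
  else 1.
Proof.
rewrite /Phi; case: (v \in C :\ r); last by rewrite sumr_pred1.
rewrite -big_mkcond -mulr_sumr ler_wpM2l//.
case: ifP => vD /=; last by rewrite (card_target _ cardC cardCU).
(* Parents in the overlap have weight at most [1 + theta]; the [theta] is summed over all
   candidates, at most [k] of them, whether or not they lie in the overlap. *)
apply: (@le_trans _ _ (\sum_(u | (u \in C) && ((v \in U) ==> (u \in U)))
    ((u \in D)%:R + theta * 1))).
  apply: ler_sum => u _; case: (u \in D) => /=; last by rewrite add0r mulr1.
  by rewrite mulr1 lerDl.
rewrite big_split /= -mulr_sumr (card_target _ cardC cardCU) lerD//.
  rewrite /wd -(card_target v (erefl #|D|) erefl) big_mkcond [leRHS]big_mkcond.
  apply: ler_sum => u _; rewrite finset.in_setI.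
  by case: (u \in C); case: (u \in C'); case: (_ ==> _).
apply: ler_wpM2l => //; case: ifP => // _; rewrite ler_nat -cardC -cardCU.
by apply: subset_leq_card; apply: finset.subsetIl.
Qed.

Let sum_Psi v : \sum_u Psi v u <=
  if v \in C' :\ r' :\: D then w v * wq v
  else if v \in D then 1 + theta * k%:R else 1.
Proof.
rewrite /Psi; case: ifP => _.
  rewrite -big_mkcond /wq -(card_target v cardC' cardCU') mulr_sumr.
  by under [leRHS]eq_bigr do rewrite mulr1.
case: ifP => _; last by rewrite sumr_pred1.
rewrite big_split /= sumr_pred1 lerD2l -mulr_suml mulrC ler_wpM2l//.
by rewrite -natr_sum ler_nat -cardC' -sum1_card [leqRHS]big_mkcond /= leq_sum// => u _; case: ifP.
Qed.

Let prod_core (B : {set 'I_N}) (x y : R) :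
  \prod_(v in B) (if v \in U then x else y) = x ^+ #|B :&: U| * y ^+ #|B :\: U|.
Proof.
rewrite (big_setID U) /=; congr (_ * _).
  rewrite -prodr_const; apply: eq_bigr => v.
  by rewrite finset.in_setI => /andP[_ ->].
rewrite -prodr_const; apply: eq_bigr => v.
by rewrite finset.in_setD => /andP[/negbTE -> _].
Qed.

Lemma Ex_pair_le : r \in C :&: U -> r' \in C' :&: U -> #|D :\ r| = #|D :\ r'| ->
  Ex p (fun G => (core_tree U C G && core_tree U C' G)%:R) <=
  (if separate_roots then theta ^+ 2 else 1) *
  ((pi1 * (d1%:R + theta * k%:R)) ^+ #|(D :\ r) :&: U| *
   (pi0 * (d%:R + theta * k%:R)) ^+ #|(D :\ r) :\: U| *
   ((pi1 * q%:R) ^+ #|(C :\ r :\: D) :&: U| * (pi0 * k%:R) ^+ #|(C :\ r :\: D) :\: U|) *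
   ((pi1 * q%:R) ^+ #|(C' :\ r' :\: D) :&: U| * (pi0 * k%:R) ^+ #|(C' :\ r' :\: D) :\: U|) *
   (1 + theta * k%:R) ^+ d).
Proof.
move=> rC rC' cardD; apply: le_trans (Ex_pair_sum rC rC' cardD) _.
apply: le_trans pair_sum_le _; apply: ler_wpM2l.
  by case: ifP => // _; rewrite exprn_ge0.
rewrite -[leRHS]mulrA; apply: ler_pM; try by apply: prodr_ge0 => v _; apply: sumr_ge0.
  apply: (@le_trans _ _ (\prod_(v in C :\ r) (w v * (if v \in D then wd v + theta * k%:R else wq v)))).
    rewrite [leRHS]big_mkcond; apply: ler_prod => v _.
    by rewrite sum_Phi sumr_ge0.
  rewrite (big_setID D) /= -!prod_core.
  have -> : D :\ r = (C :\ r) :&: D.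
    apply/setP => v; rewrite finset.in_setI !finset.in_setD1 !finset.in_setI.
    by case: (v == r); case: (v \in C).
  rewrite le_eqVlt; apply/orP; left; apply/eqP; congr (_ * _); apply: eq_bigr => v.
    by rewrite finset.in_setI => /andP[_ ->]; rewrite /w /wd; case: ifP.
  by rewrite finset.in_setD => /andP[/negbTE -> _]; rewrite /w /wq; case: ifP.
apply: (@le_trans _ _ (\prod_(v in C' :\ r' :\: D) (w v * wq v) *
   \prod_(v in D) (1 + theta * k%:R))); last first.
  rewrite prodr_const -prod_core le_eqVlt; apply/orP; left; apply/eqP; congr (_ * _).
  by apply: eq_bigr => v _; rewrite /w /wq; case: ifP.
rewrite [X in X * _]big_mkcond [X in _ * X]big_mkcond -big_split /=.
apply: ler_prod => v _; rewrite sumr_ge0//=; apply: le_trans (sum_Psi v) _.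
case: ifP => vC; last by rewrite mul1r.
by case/finset.setDP: vC => _ /negbTE ->; rewrite mulr1.
Qed.

End Pair.
End CoreTree.

(** * Second moment of tree counts *)

Lemma bin_le_expr (R : numFieldType) (n m : nat) : ('C(n, m))%:R <= n%:R ^+ m / m`!%:R :> R.
Proof.
rewrite ler_pdivlMr ?ltr0n ?fact_gt0// -natrM bin_ffact -natrX ler_nat.
elim: m n => [|m IH] [|n]; rewrite ?ffactn0 ?ffact0n//.
rewrite ffactSS expnS leq_mul2l /=; apply: leq_trans (IH n) _.
by case: m {IH} => // m; rewrite leq_exp2r.
Qed.

(** The number of choices of [m] vertices times their weights, expressed by a bound [L] on the
    expected degree. *)
Lemma bin_scaled_le (R : realFieldType) (u m : nat) (a x L : R) :
  0 <= a -> 0 <= x -> u%:R * a <= L ->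
  ('C(u, m))%:R * (a * x) ^+ m <= L ^+ m * (x ^+ m / m`!%:R).
Proof.
move=> a0 x0 uL.
apply: (@le_trans _ _ (u%:R ^+ m / m`!%:R * (a * x) ^+ m)).
  by rewrite ler_wpM2r ?exprn_ge0 ?mulr_ge0// bin_le_expr.
rewrite [leLHS](_ : _ = (u%:R * a) ^+ m * (x ^+ m / m`!%:R)).
  rewrite ler_wpM2r ?divr_ge0 ?exprn_ge0// lerXn2r ?nnegrE ?mulr_ge0//.
  by apply: le_trans uL; rewrite mulr_ge0.
by rewrite !exprMn; ring.
Qed.

Section SecondMoment.
Variables (N : nat) (U : {set 'I_N}) (R : realType) (p : 'I_N -> 'I_N -> R).
Implicit Types C D : {set 'I_N}.
Hypothesis p_sym : forall i j, p i j = p j i.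
Hypothesis p01 : forall i j, 0 <= p i j <= 1.
Variables (pi0 pi1 theta : R).
Hypothesis (pi0_ge0 : 0 <= pi0) (pi01 : pi0 <= pi1) (pi1_gt0 : 0 < pi1).
Hypothesis (theta01 : 0 <= theta <= 1) (pi1_theta : pi1 <= theta ^+ 4).
Variables k q : nat.
Hypothesis q_gt0 : (0 < q)%N.
Local Notation K := ((1 + theta * k%:R) ^+ (2 * k)).

Let theta_ge0 : 0 <= theta. Proof. by case/andP: theta01. Qed.

(** Turns the additive exit term into the uniform factor that is collected in [K]; for [a = 0] there
    would be nothing to absorb it. *)
Lemma natr_affine_le (a : nat) : (0 < a)%N -> a%:R + theta * k%:R <= a%:R * (1 + theta * k%:R).
Proof.
move=> a0; rewrite mulrDr mulr1 lerD2l ler_peMl ?mulr_ge0//.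
by rewrite ler1n.
Qed.

Lemma inflation_base_ge1 : 1 <= 1 + theta * k%:R.
Proof. by rewrite lerDl mulr_ge0. Qed.

Section OnePair.
Variables C C' : {set 'I_N}.
Hypotheses (cardC : #|C| = k) (cardC' : #|C'| = k).
Hypotheses (cardCU : #|C :&: U| = q) (cardCU' : #|C' :&: U| = q).
Hypothesis p_le : forall i j, i \in C :|: C' -> p i j <= if i \in U then pi1 else pi0.
Local Notation D := (C :&: C').
Let d1 := #|D :&: U|.
Let d2 := #|D :\: U|.

Lemma card_core_diff : #|(C :\: D) :&: U| = (q - d1)%N /\ #|(C' :\: D) :&: U| = (q - d1)%N.
Proof.
have sub (B B' : {set 'I_N}) : #|B :&: U| = q ->
    #|(B :\: (B :&: B')) :&: U| = (q - #|B :&: B' :&: U|)%N.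
  move=> <-; have -> : (B :\: (B :&: B')) :&: U = (B :&: U) :\: (B :&: B' :&: U).
    by apply/setP => v; rewrite !finset.inE; case: (v \in B); case: (v \in U); rewrite ?andbF ?andbT.
  rewrite cardsD; congr (_ - #|pred_of_set _|)%N.
  by apply/setP => v; rewrite !finset.inE; case: (v \in B); case: (v \in U); rewrite ?andbF ?andbT.
by split; [exact: sub | rewrite /d1 (finset.setIC C C'); exact: sub].
Qed.

Lemma card_out_diff : #|(C :\: D) :\: U| = (k - q - d2)%N /\ #|(C' :\: D) :\: U| = (k - q - d2)%N.
Proof.
have sub (B B' : {set 'I_N}) : #|B| = k -> #|B :&: U| = q ->
    #|(B :\: (B :&: B')) :\: U| = (k - q - #|B :&: B' :\: U|)%N.
  move=> <- <-; have -> : (B :\: (B :&: B')) :\: U = (B :\: U) :\: (B :&: B' :\: U).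
    by apply/setP => v; rewrite !finset.inE; case: (v \in B); case: (v \in U); rewrite ?andbF ?andbT.
  rewrite (cardsD (B :\: U)) (cardsD B U); congr (_ - #|pred_of_set _|)%N.
  by apply/setP => v; rewrite !finset.inE; case: (v \in B); case: (v \in U); rewrite ?andbF ?andbT.
by split; [exact: sub | rewrite /d2 (finset.setIC C C'); exact: sub].
Qed.

(** One factor [pi1] is missing for a root in the shared core. If the overlap misses [U], two roots
    are missing, and [theta ^+ 2] comes from the surplus edge that this forces. *)
Definition pair_bound (e1 e2 : nat) : R :=
  (if e1 == 0%N then theta ^+ 2 / pi1 else 1) / pi1 *
  (pi1 * e1%:R) ^+ e1 * (pi1 * q%:R) ^+ (2 * (q - e1)) *
  ((pi0 * (e1 + e2)%:R) ^+ e2 * (pi0 * k%:R) ^+ (2 * (k - q - e2))) * K.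

Lemma pair_le : D != finset.set0 ->
  Ex p (fun G => (core_tree U C G && core_tree U C' G)%:R) <= pair_bound d1 d2.
Proof.
move=> D0; have [E1 E1'] := card_core_diff; have [E2 E2'] := card_out_diff.
have dE : #|D| = (d1 + d2)%N by rewrite -(cardsID U D).
have d_gt0 : (0 < d1 + d2)%N by rewrite -dE card_gt0.
have dk : (#|D| <= k)%N by rewrite -cardC subset_leq_card// finset.subsetIl.
have Kd : (1 + theta * k%:R) ^+ (d1 + d2 + #|D|) <= K.
  by rewrite ler_weXn2l ?inflation_base_ge1// -dE addnn -mul2n leq_mul2l.
have K0 : 0 <= 1 + theta * k%:R by apply: le_trans inflation_base_ge1.
have aff (x : R) (a e : nat) : 0 <= x -> (0 < a)%N ->
    (x * (a%:R + theta * k%:R)) ^+ e <= (x * a%:R) ^+ e * (1 + theta * k%:R) ^+ e.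
  move=> x0 a0; rewrite -exprMn lerXn2r ?nnegrE ?mulr_ge0 ?addr_ge0 ?mulr_ge0//.
  by rewrite -mulrA ler_wpM2l// natr_affine_le.
have pi10 := ltW pi1_gt0.
(* If the overlap meets [U], both trees are rooted at a common vertex there; otherwise their roots
   lie in [U], outside the overlap. *)
rewrite /pair_bound; have [d10|d10] := posnP d1; last first.
  have /card_gt0P[r rDU] := d10.
  have [rD rU] : r \in D /\ r \in U by move: rDU; rewrite finset.in_setI => /andP[].
  have [rC rC'] : r \in C /\ r \in C' by move: rD; rewrite finset.in_setI => /andP[].
  apply: le_trans (Ex_pair_le p_sym p01 pi0_ge0 pi01 theta01 pi1_theta p_le cardC cardC'
    cardCU cardCU' (r := r) (r' := r) _ _ erefl) _; rewrite ?finset.in_setI ?rC ?rC' ?rU//.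
  have -> : separate_roots C C' r = false by rewrite /separate_roots rD.
  have rem (B : {set 'I_N}) : B :\ r :\: D = B :\: D.
    by apply/setP => v; rewrite !finset.in_setD finset.in_set1; case: eqP => // ->; rewrite rD.
  have Dr1 : #|(D :\ r) :&: U| = d1.-1.
    rewrite /d1 (cardsD1 r (D :&: U)) rDU /=; congr #|pred_of_set _|.
    by apply/setP => v; rewrite !finset.inE; case: (v == r).
  have Dr2 : (D :\ r) :\: U = D :\: U.
    apply/setP => v; rewrite !finset.in_setD finset.in_set1; case: eqP => // ->.
    by rewrite rU.
  rewrite !rem E1 E1' E2 E2' Dr1 Dr2 -/d2 -/d1 dE mul1r.
  set a := _ ^+ d1.-1; set b := _ ^+ d2; set X1 := _ ^+ (q - d1); set X2 := _ ^+ (k - q - d2).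
  have X10 : 0 <= X1 by rewrite exprn_ge0// mulr_ge0.
  have X20 : 0 <= X2 by rewrite exprn_ge0// mulr_ge0.
  have ha : a <= (pi1 * d1%:R) ^+ d1.-1 * (1 + theta * k%:R) ^+ d1.-1 by apply: aff.
  have hb : b <= (pi0 * (d1 + d2)%:R) ^+ d2 * (1 + theta * k%:R) ^+ d2 by apply: aff.
  have a0 : 0 <= a by rewrite exprn_ge0// mulr_ge0// addr_ge0// mulr_ge0.
  have b0 : 0 <= b by rewrite exprn_ge0// mulr_ge0// addr_ge0// mulr_ge0.
  rewrite /=.
  apply: (@le_trans _ _ (((pi1 * d1%:R) ^+ d1.-1 * (1 + theta * k%:R) ^+ d1.-1) *
     ((pi0 * (d1 + d2)%:R) ^+ d2 * (1 + theta * k%:R) ^+ d2) *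
     (X1 * X2) * (X1 * X2) * (1 + theta * k%:R) ^+ (d1 + d2))).
    rewrite ler_wpM2r ?exprn_ge0// ler_wpM2r ?mulr_ge0// ler_wpM2r ?mulr_ge0//.
    exact: ler_pM.
  rewrite [leLHS](_ : _ = (pi1 * d1%:R) ^+ d1.-1 * (X1 ^+ 2 * ((pi0 * (d1 + d2)%:R) ^+ d2 * X2 ^+ 2)) *
    (1 + theta * k%:R) ^+ (d1.-1 + d2 + (d1 + d2))); last by rewrite !exprD; ring.
  rewrite [leRHS](_ : _ = ((pi1 * d1%:R) ^+ d1.-1 * d1%:R) * (X1 ^+ 2 * ((pi0 * (d1 + d2)%:R) ^+ d2 * X2 ^+ 2)) * K).
    apply: ler_pM.
    - by rewrite !mulr_ge0 ?exprn_ge0 ?mulr_ge0.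
    - by rewrite exprn_ge0.
    - rewrite ler_wpM2r ?mulr_ge0 ?exprn_ge0 ?mulr_ge0// ler_peMr ?exprn_ge0 ?mulr_ge0//.
      by rewrite ler1n.
    - apply: le_trans Kd; rewrite dE ler_weXn2l ?inflation_base_ge1//.
      by rewrite leq_add2r leq_add2r leq_pred.
  rewrite -!exprM ![(_ * 2)%N]mulnC -[in LHS](prednK d10) exprS prednK// -/X1.
  by rewrite div1r; field; rewrite gt_eqF.
have DU0 : D :&: U = finset.set0 by apply/eqP; rewrite -cards_eq0 -/d1 d10.
have ex (B : {set 'I_N}) : #|B :&: U| = q -> exists r, r \in B :&: U.
  by move=> Bq; apply/card_gt0P; rewrite Bq.
have [r rCU] := ex C cardCU; have [r' rCU'] := ex C' cardCU'.
have notD x : x \in U -> x \notin D.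
  move=> xU; apply/negP => xD; have := finset.in_set0 x.
  by rewrite -DU0 finset.in_setI xD xU.
have [rC rU] : r \in C /\ r \in U by move: rCU; rewrite finset.in_setI => /andP[].
have [rC' rU'] : r' \in C' /\ r' \in U by move: rCU'; rewrite finset.in_setI => /andP[].
have Drem x : x \in U -> D :\ x = D.
  move=> xU; apply/setP => v; rewrite finset.in_setD finset.in_set1.
  by case: eqP => // ->; rewrite (negbTE (notD _ xU)).
apply: le_trans (Ex_pair_le p_sym p01 pi0_ge0 pi01 theta01 pi1_theta p_le cardC cardC'
    cardCU cardCU' rCU rCU' _) _.
  by rewrite !Drem.
have -> : separate_roots C C' r' by rewrite /separate_roots notD.
have core1 (B : {set 'I_N}) x : x \in B :&: U -> #|B :&: U| = q -> D :&: U = finset.set0 ->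
    #|(B :\ x :\: D) :&: U| = q.-1.
  move=> xBU <- _; rewrite (cardsD1 x (B :&: U)) xBU /=; congr #|pred_of_set _|.
  apply/setP => v; rewrite finset.in_setI finset.in_setD !finset.in_setD1 (finset.in_setI v B U).
  case vU: (v \in U); rewrite ?andbF//.
  by rewrite (notD _ vU) /= !andbT.
have out1 (B : {set 'I_N}) x : x \in U -> (B :\ x :\: D) :\: U = (B :\: D) :\: U.
  move=> xU; apply/setP => v; rewrite !finset.in_setD !finset.in_set1.
  by case: eqP => // ->; rewrite xU.
rewrite !core1// !out1// E2 E2' Drem// -/d1 -/d2 dE d10 add0n.
set b := _ ^+ d2; set X1 := _ ^+ q.-1; set X2 := _ ^+ (k - q - d2).
have d20 : (0 < d2)%N by move: d_gt0; rewrite d10.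
have X10 : 0 <= X1 by rewrite exprn_ge0// mulr_ge0.
have X20 : 0 <= X2 by rewrite exprn_ge0// mulr_ge0.
have hb : b <= (pi0 * d2%:R) ^+ d2 * (1 + theta * k%:R) ^+ d2 by apply: aff.
have b0 : 0 <= b by rewrite exprn_ge0// mulr_ge0// addr_ge0// mulr_ge0.
rewrite !expr0 mul1r subn0.
apply: (@le_trans _ _ (theta ^+ 2 * (((pi0 * d2%:R) ^+ d2 * (1 + theta * k%:R) ^+ d2) *
     (X1 * X2) * (X1 * X2) * (1 + theta * k%:R) ^+ d2))).
  rewrite ler_wpM2l ?exprn_ge0// ler_wpM2r ?exprn_ge0// ler_wpM2r ?mulr_ge0// ler_wpM2r ?mulr_ge0//.
rewrite [leLHS](_ : _ = (theta ^+ 2 * X1 ^+ 2 * ((pi0 * d2%:R) ^+ d2 * X2 ^+ 2)) *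
    (1 + theta * k%:R) ^+ (d2 + d2)); last by rewrite !exprD; ring.
rewrite [leRHS](_ : _ = (theta ^+ 2 * (X1 ^+ 2 * q%:R ^+ 2) * ((pi0 * d2%:R) ^+ d2 * X2 ^+ 2)) * K).
  apply: ler_pM.
  - by rewrite !mulr_ge0 ?exprn_ge0 ?mulr_ge0.
  - by rewrite exprn_ge0.
  - rewrite ler_wpM2r ?mulr_ge0 ?exprn_ge0 ?mulr_ge0// ler_wpM2l ?exprn_ge0//.
    by rewrite ler_peMr ?exprn_ge0 ?mulr_ge0 ?exprn_ege1 ?ler1n.
  - by apply: le_trans Kd; rewrite dE d10 add0n.
have X1E : (pi1 * q%:R) ^+ (2 * q) = X1 ^+ 2 * (pi1 * q%:R) ^+ 2.
  by rewrite /X1 -exprM -exprD -mulSnr prednK// mulnC.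
have X2E : (pi0 * k%:R) ^+ (2 * (k - q - d2)) = X2 ^+ 2 by rewrite /X2 -exprM mulnC.
by rewrite X1E X2E; field; rewrite gt_eqF.
Qed.
End OnePair.

(** A pair of sets is determined by its six pieces: shared, only in the first, only in the second,
    each inside and outside [U]. *)
Lemma card_pairs_le (CC : {set {set 'I_N}}) (d1 d2 : nat) :
    {in CC, forall C, #|C| = k /\ #|C :&: U| = q} ->
  (#|[set x : {set 'I_N} * {set 'I_N} | [&& x.1 \in CC, x.2 \in CC,
      #|x.1 :&: x.2 :&: U| == d1 & #|x.1 :&: x.2 :\: U| == d2]]%SET| <=
  'C(#|U|, d1) * 'C(#|U|, q - d1) ^ 2 * ('C(N, d2) * 'C(N, k - q - d2) ^ 2))%N.
Proof.
move=> CCP; set P := [set x | _]%SET.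
pose dr (B : {set 'I_N}) m := [set A : {set 'I_N} | A \subset B & #|A| == m]%SET.
pose code (x : {set 'I_N} * {set 'I_N}) :=
  ((x.1 :&: x.2 :&: U, ((x.1 :\: (x.1 :&: x.2)) :&: U, (x.2 :\: (x.1 :&: x.2)) :&: U)),
   (x.1 :&: x.2 :\: U, ((x.1 :\: (x.1 :&: x.2)) :\: U, (x.2 :\: (x.1 :&: x.2)) :\: U))).
have code_inj : injective code.
  move=> [A A'] [B B'] [/setP h1 /setP h2 /setP h3 /setP h4 /setP h5 /setP h6].
  have rec v : (v \in A, v \in A') = (v \in B, v \in B').
    move: (h1 v) (h2 v) (h3 v) (h4 v) (h5 v) (h6 v); rewrite !finset.inE.
    by case: (v \in A); case: (v \in A'); case: (v \in B); case: (v \in B'); case: (v \in U).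
  by congr (_, _); apply/setP => v; have [] := rec v.
rewrite -(card_imset _ code_inj).
apply: (@leq_trans #|finset.setX (finset.setX (dr U d1) (finset.setX (dr U (q - d1)%N) (dr U (q - d1)%N)))
   (finset.setX (dr [set: 'I_N]%SET d2) (finset.setX (dr [set: 'I_N]%SET (k - q - d2)%N) (dr [set: 'I_N]%SET (k - q - d2)%N)))|).
  apply/subset_leq_card/fintype.subsetP => _ /imsetP[[C C'] xP ->].
  move: xP; rewrite finset.inE /= => /and4P[/CCP[cC cCU] /CCP[cC' cCU'] /eqP e1 /eqP e2].
  have [] := card_core_diff cCU cCU'; have [] := card_out_diff cC cC' cCU cCU'.
  rewrite e1 e2 => o1 o2 c1 c2.
  by rewrite !finset.in_setX !finset.inE /= !finset.subsetIr !finset.subsetT e1 e2 o1 o2 c1 c2 !eqxx.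
by rewrite !cardsX !cards_draws cardsT card_ord !mulnn.
Qed.

(** Term [(i, j)] bounds the contribution of the pairs that share [i] vertices of [U] and [j]
    others, up to the common factor [K / pi1]; [L1] and [L0] stand for the degrees [#|U| pi1] and
    [N pi0], and [e] for [k - q]. *)
Definition second_moment (L1 L0 : R) (e : nat) : R :=
  \sum_(i < q.+1) \sum_(j < e.+1 | (0 < i + j)%N)
    (if i == 0 :> nat then theta ^+ 2 / pi1 else 1) *
    (L1 ^+ i * (i%:R ^+ i / i`!%:R)) * (L1 ^+ (q - i) * (q%:R ^+ (q - i) / (q - i)`!%:R)) ^+ 2 *
    ((L0 ^+ j * ((i + j)%:R ^+ j / j`!%:R)) * (L0 ^+ (e - j) * (k%:R ^+ (e - j) / (e - j)`!%:R)) ^+ 2).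

Lemma second_moment_ge0 (L1 L0 : R) (e : nat) :
  0 <= L1 -> 0 <= L0 -> 0 <= second_moment L1 L0 e.
Proof.
move=> L10 L00; apply: sumr_ge0 => i _; apply: sumr_ge0 => j _.
have c0 : 0 <= (if i == 0 :> nat then theta ^+ 2 / pi1 else 1).
  by case: ifP => // _; rewrite divr_ge0 ?exprn_ge0// ltW.
by repeat (apply: mulr_ge0 || apply: exprn_ge0 || apply: divr_ge0).
Qed.

Lemma sum_pairs_le (CC : {set {set 'I_N}}) (L1 L0 : R) :
    {in CC, forall C, #|C| = k /\ #|C :&: U| = q} ->
    (forall C i j, C \in CC -> i \in C -> p i j <= if i \in U then pi1 else pi0) ->
    #|U|%:R * pi1 <= L1 -> N%:R * pi0 <= L0 ->
  \sum_(C in CC) \sum_(C' in CC | C :&: C' != finset.set0)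
     Ex p (fun G => (core_tree U C G && core_tree U C' G)%:R) <=
  K / pi1 * second_moment L1 L0 (k - q).
Proof.
move=> CCP p_le L1P L0P.
pose d1 (x : {set 'I_N} * {set 'I_N}) := #|x.1 :&: x.2 :&: U|.
pose d2 (x : {set 'I_N} * {set 'I_N}) := #|x.1 :&: x.2 :\: U|.
pose P (x : {set 'I_N} * {set 'I_N}) := (x.1 \in CC) && ((x.2 \in CC) && (x.1 :&: x.2 != finset.set0)).
rewrite pair_big_dep /=.
apply: (@le_trans _ _ (\sum_(x | P x) pair_bound (d1 x) (d2 x))).
  apply: ler_sum => -[C C'] /and3P[/= CCC CCC' D0].
  have [cC cCU] := CCP _ CCC; have [cC' cCU'] := CCP _ CCC'.
  apply: pair_le => // i j; rewrite finset.in_setU => /orP[]; exact: p_le.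
have d1_lt x : P x -> (d1 x < q.+1)%N.
  move=> /and3P[/CCP[_ <-] _ _]; rewrite ltnS subset_leq_card//.
  by apply: finset.setSI; apply: finset.subsetIl.
have d2_lt x : P x -> (d2 x < (k - q).+1)%N.
  move=> /and3P[/CCP[cC cCU] _ _]; rewrite ltnS -cC -cCU -cardsD subset_leq_card//.
  by apply: finset.setSD; apply: finset.subsetIl.
pose key x : 'I_q.+1 * 'I_(k - q).+1 := (inord (d1 x), inord (d2 x)).
rewrite (partition_big key (fun y => (0 < y.1 + y.2)%N)) /=; last first.
  move=> x Px; rewrite !inordK ?d1_lt ?d2_lt//.
  by rewrite cardsID card_gt0; have /and3P[] := Px.
rewrite /second_moment [X in _ / pi1 * X]pair_big_dep /= mulr_sumr; apply: ler_sum => -[i j] /= ij0.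
apply: (@le_trans _ _ (('C(#|U|, i) * 'C(#|U|, q - i) ^ 2 * ('C(N, j) * 'C(N, k - q - j) ^ 2))%N%:R * pair_bound i j)).
  have pb0 : 0 <= pair_bound i j.
    have pi10 := ltW pi1_gt0; have K0 := le_trans ler01 inflation_base_ge1.
    rewrite /pair_bound; repeat (apply: mulr_ge0 || apply: exprn_ge0 => //) => //.
      by case: ifP => // _; rewrite divr_ge0 ?exprn_ge0.
    by rewrite invr_ge0.
  apply: (@le_trans _ _ (\sum_(x | [&& x.1 \in CC, x.2 \in CC, d1 x == i & d2 x == j]) pair_bound i j)).
    rewrite big_mkcond [leRHS]big_mkcond; apply: ler_sum => x _.
    case: ifP => [/andP[Px /eqP [<- <-]]|_]; last by case: ifP.
    rewrite !inordK ?d1_lt ?d2_lt// !eqxx.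
    by have /and3P[-> -> _] := Px.
  rewrite sumr_const -[leLHS]mulr_natl ler_wpM2r// ler_nat.
  apply: leq_trans (card_pairs_le i j CCP).
  by apply/subset_leq_card/fintype.subsetP => x; rewrite finset.inE.
rewrite -!mulnn !natrM /pair_bound.
have pi10 := ltW pi1_gt0; have K0 : 0 <= K by rewrite exprn_ge0// (le_trans ler01 inflation_base_ge1).
have c0 : 0 <= (if i == 0 :> nat then theta ^+ 2 / pi1 else 1).
  by case: ifP => // _; rewrite divr_ge0 ?exprn_ge0.
have B1 := bin_scaled_le i pi10 (ler0n R i) L1P.
have B2 := bin_scaled_le (q - i) pi10 (ler0n R q) L1P.
have B3 := bin_scaled_le j pi0_ge0 (ler0n R (i + j)) L0P.
have B4 := bin_scaled_le (k - q - j) pi0_ge0 (ler0n R k) L0P.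
set KK := K in K0 *; rewrite !(mulnC 2%N) !exprM.
set b1 := _ * (pi1 * i%:R) ^+ i in B1; set b2 := _ * (pi1 * q%:R) ^+ (q - i) in B2.
set b3 := _ * (pi0 * (i + j)%:R) ^+ j in B3; set b4 := _ * (pi0 * k%:R) ^+ (k - q - j) in B4.
have b10 : 0 <= b1 by rewrite mulr_ge0 ?exprn_ge0 ?mulr_ge0.
have b20 : 0 <= b2 by rewrite mulr_ge0 ?exprn_ge0 ?mulr_ge0.
have b30 : 0 <= b3 by rewrite mulr_ge0 ?exprn_ge0 ?mulr_ge0.
have b40 : 0 <= b4 by rewrite mulr_ge0 ?exprn_ge0 ?mulr_ge0.
set c := (if _ then _ else _) in c0 *.
rewrite [leLHS](_ : _ = KK / pi1 * (c * b1 * b2 ^+ 2 * (b3 * b4 ^+ 2))); last first.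
  by rewrite /b1 /b2 /b3 /b4; ring.
apply: ler_wpM2l; first by rewrite divr_ge0.
have sq (a b : R) : 0 <= a -> a <= b -> a ^+ 2 <= b ^+ 2.
  by move=> a0 ab; rewrite lerXn2r ?nnegrE// (le_trans a0).
have cb0 : 0 <= c * b1 by rewrite mulr_ge0.
apply: ler_pM; [by rewrite mulr_ge0 ?exprn_ge0|by rewrite mulr_ge0 ?exprn_ge0| |].
  by apply: ler_pM; [by []|by rewrite exprn_ge0|exact: ler_wpM2l|exact: sq].
by apply: ler_pM; [by []|by rewrite exprn_ge0|by []|exact: sq].
Qed.
End SecondMoment.

(** * Forests with given roots *)

(** The binomial theorem after [m * 'C(e.+1, m) = e.+1 * 'C(e, m.-1)]. It is the recursion of the
    forest numbers [a * (a + e) ^ e.-1] when the [m] vertices attached directly to the [a] roots are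
    split off. *)
Lemma layer_sum (a e : nat) : (e.+1 * (a * (a + e.+1) ^ e) =
  \sum_(m < e.+2) 'C(e.+1, m) * (a ^ m * (m * e.+1 ^ (e.+1 - m))))%N.
Proof.
rewrite big_ord_recl /= mul0n !muln0 add0n addnC expnDn big_distrr big_distrr /=.
apply: eq_bigr => i _; rewrite /bump /= add1n subSS.
rewrite [RHS](_ : _ = a ^ i.+1 * (i.+1 * 'C(e.+1, i.+1)) * e.+1 ^ (e - i))%N; last by ring.
by rewrite -mul_bin_diag expnS; ring.
Qed.

Section Forests.
Variable N : nat.
Implicit Types Q E B : {set 'I_N}.

(** Being the identity off [E] makes a forest correspond to exactly one map. *)
Definition forest Q E : {set {ffun 'I_N -> 'I_N}} :=
  [set f : {ffun 'I_N -> 'I_N} |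
    [forall v, if v \in E then f v \in Q :|: E else f v == v]
    && `[< descends E f >]]%SET.

Lemma forestP Q E (f : {ffun 'I_N -> 'I_N}) :
  reflect [/\ {in E, forall v, f v \in Q :|: E}, (forall v, v \notin E -> f v = v)
             & descends E f] (f \in forest Q E).
Proof.
rewrite finset.inE; apply: (iffP andP) => [[/forallP h /asboolP d]|[h1 h2 d]]; split => //.
- by move=> v vE; have := h v; rewrite vE.
- by move=> v /negbTE vE; have := h v; rewrite vE => /eqP.
- by apply/forallP => v; case: ifP => [/h1//|/negbT/h2 ->].
- exact/asboolP.
Qed.

Definition glue B (f g : {ffun 'I_N -> 'I_N}) : {ffun 'I_N -> 'I_N} :=
  [ffun v => if v \in B then f v else g v].

Lemma glue_inj B (F1 F2 : {set {ffun 'I_N -> 'I_N}}) :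
    (forall f v, f \in F1 -> v \notin B -> f v = v) ->
    (forall g v, g \in F2 -> v \in B -> g v = v) ->
  {in finset.setX F1 F2 &, injective (fun x => glue B x.1 x.2)}.
Proof.
move=> h1 h2 [f g] [f' g']; rewrite !finset.in_setX /= => /andP[fF gF] /andP[fF' gF'].
move=> /ffunP eq_fg; congr (_, _); apply/ffunP => v.
  case vB: (v \in B); first by have := eq_fg v; rewrite !ffunE vB.
  by rewrite (h1 _ _ fF) ?(h1 _ _ fF') ?vB.
case vB: (v \in B); last by have := eq_fg v; rewrite !ffunE vB.
by rewrite (h2 _ _ gF) ?(h2 _ _ gF').
Qed.

Definition maps_to B Q : {set {ffun 'I_N -> 'I_N}} :=
  [set f : {ffun 'I_N -> 'I_N} | [forall v, if v \in B then f v \in Q else f v == v]]%SET.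

Lemma card_maps_to B Q : #|maps_to B Q| = (#|Q| ^ #|B|)%N.
Proof.
have -> : #|maps_to B Q| =
    #|[in family (fun v => if v \in B then [in Q] else pred1 v)]|.
  apply: eq_card => f; rewrite finset.inE; apply/forallP/familyP => h v; have := h v;
  by case: ifP.
rewrite card_family foldrE big_map big_enum /= -prod_nat_const [RHS]big_mkcond /=.
by apply: eq_bigr => v _; case: ifP => _ //; rewrite card1.
Qed.

Lemma sum_card_subsets E (F : nat -> nat) :
  (\sum_(B : {set 'I_N} | B \subset E) F #|B| = \sum_(m < #|E|.+1) 'C(#|E|, m) * F m)%N.
Proof.
rewrite (partition_big (fun B : {set 'I_N} => inord #|B| : 'I_#|E|.+1) predT) //=.
apply: eq_bigr => m _; rewrite -(cards_draws E m) -sum_nat_const.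
apply: eq_big => [B|B /andP[BE /eqP <-]].
  rewrite finset.inE; apply: andb_id2l => BE.
  by rewrite -val_eqE /= inordK// ltnS subset_leq_card.
by rewrite inordK// ltnS subset_leq_card.
Qed.

(* The vertices at height one are split off first; [f] is then a map from them to
   the roots together with a forest on which they act as roots. *)
Lemma card_forest_ge_layers Q E : [disjoint Q & E] ->
  (\sum_(B : {set 'I_N} | B \subset E) #|Q| ^ #|B| * #|forest B (E :\: B)| <= #|forest Q E|)%N.
Proof.
move=> dQE; pose layer (f : {ffun 'I_N -> 'I_N}) := [set v in E | f v \in Q]%SET.
rewrite -[leqRHS]sum1_card (partition_big layer (fun B => B \subset E)) /=; last first.
  by move=> f _; apply/fintype.subsetP => v; rewrite finset.inE => /andP[].
apply: leq_sum => B BE; rewrite sum1dep_card -card_maps_to -cardsX.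
have inj : {in finset.setX (maps_to B Q) (forest B (E :\: B)) &,
    injective (fun x => glue B x.1 x.2)}.
  apply: glue_inj => [f v|g v /forestP[_ h _] vB].
    by rewrite finset.inE => /forallP /(_ v) + /negbTE vB; rewrite vB => /eqP.
  by apply: h; rewrite finset.in_setD vB.
rewrite -(card_in_imset inj).
apply/subset_leq_card/fintype.subsetP => fg /imsetP[[f g]]; rewrite finset.in_setX /=.
move=> /andP[]; rewrite finset.inE => /forallP fP /forestP[g1 g2 [h hg]] ->.
have BE' v : v \in B -> v \in E by apply: (fintype.subsetP BE).
have QE v : v \in Q -> v \in E = false by apply: (disjointFr dQE).
have gE v : v \in E -> v \in B = false -> g v \in E.
  move=> vE vB; have := g1 v; rewrite finset.in_setD vB vE => /(_ isT).
  by rewrite finset.in_setU finset.in_setD => /orP[/BE'//|/andP[]].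
have fQ v : v \in B -> f v \in Q by move=> vB; have := fP v; rewrite vB.
rewrite finset.inE; apply/andP; split.
  apply/forestP; split=> [v vE|v vE|].
  - rewrite ffunE finset.in_setU; case: ifP => [/fQ ->//|vB].
    by rewrite gE ?orbT.
  - rewrite ffunE; case: ifP => [/BE'|vB]; first by rewrite (negbTE vE).
    by apply: g2; rewrite finset.in_setD vB /= vE.
  exists (fun v => if v \in E then (h v).+1 else 0%N) => v vE.
  rewrite ffunE vE; case vB: (v \in B); first by rewrite QE ?fQ.
  by rewrite gE// ltnS hg// finset.in_setD vB vE.
apply/eqP/setP => v; rewrite finset.inE ffunE.
case vB: (v \in B); first by rewrite BE'// fQ.
case vE: (v \in E) => //=; apply/negP => /QE.
by rewrite gE.
Qed.

(** Half of Cayley's formula, which counts [#|Q| * (#|Q| + #|E|) ^ (#|E| - 1)] forests; the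
    multiplication by [#|Q| + #|E|] covers the empty [E] without a negative exponent. *)
Lemma card_forest_ge Q E : [disjoint Q & E] ->
  (#|Q| * (#|Q| + #|E|) ^ #|E| <= (#|Q| + #|E|) * #|forest Q E|)%N.
Proof.
have [m] := ubnP #|E|; elim: m Q E => // m IH Q E Em dQE.
have [E0|E_gt0] := posnP #|E|.
  rewrite E0 expn0 muln1 addn0 leq_pmulr// card_gt0; apply/set0Pn.
  move/eqP: E0; rewrite cards_eq0 => /eqP ->.
  exists (finfun id); apply/forestP; split => [v|v _|].
  - by rewrite finset.in_set0.
  - by rewrite ffunE.
  by exists (fun=> 0%N) => v; rewrite finset.in_set0.
set e := #|E| in E_gt0 *; set a := #|Q|.
suff : (e * (a * (a + e) ^ e.-1) <= e * #|forest Q E|)%N.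
  rewrite leq_pmul2l// => h; apply: leq_trans (leq_mul (leqnn (a + e)) h).
  by rewrite mulnCA -expnS prednK.
apply: leq_trans (leq_mul (leqnn e) (card_forest_ge_layers dQE)).
rewrite big_distrr /=.
apply: (@leq_trans (\sum_(B : {set 'I_N} | B \subset E) a ^ #|B| * (#|B| * e ^ (e - #|B|)))).
  rewrite (sum_card_subsets E (fun b => a ^ b * (b * e ^ (e - b)))%N) -/e.
  by have := layer_sum a e.-1; rewrite prednK// => ->.
apply: leq_sum => B BE.
have [->|B0] := eqVneq B finset.set0; first by rewrite cards0 mul0n muln0.
have cB : #|E :\: B| = (e - #|B|)%N by rewrite cardsD (finset.setIidPr BE).
have b_gt0 : (0 < #|B|)%N by rewrite card_gt0.
have be : (#|B| <= e)%N by apply: subset_leq_card.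
have dB : [disjoint B & E :\: B].
  by rewrite -finset.setI_eq0; apply/eqP/setP => v; rewrite !finset.inE; case: (v \in B).
have := IH B (E :\: B) _ dB; rewrite cB subnKC// => IHB.
rewrite [leqRHS]mulnCA leq_mul2l IHB ?orbT//.
by apply: leq_trans (_ : (e - #|B| < e)%N) _; rewrite ?ltnS // ltn_subrL b_gt0.
Qed.

End Forests.

(** * Planted trees *)

Section PlantedMean.
Variables (N : nat) (U : {set 'I_N}) (R : realType) (p : 'I_N -> 'I_N -> R).
Variables (pi0 pi1 : R).
Hypothesis pE : forall i j, p i j = if (i \in U) && (j \in U) then pi1 else pi0.
Hypotheses (pi0_ge0 : 0 <= pi0) (pi01 : pi0 <= pi1) (pi1_le1 : pi1 <= 1).

Let p_sym i j : p i j = p j i. Proof. by rewrite !pE andbC. Qed.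
Let pi1_ge0 : 0 <= pi1. Proof. exact: le_trans pi01. Qed.
Let p01 i j : 0 <= p i j <= 1.
Proof. by rewrite pE; case: ifP; rewrite ?pi0_ge0 ?pi1_ge0 ?(le_trans pi01). Qed.

Section OneSet.
Variables (C : {set 'I_N}) (r : 'I_N) (k q : nat).
Hypotheses (rCU : r \in C :&: U) (cardC : #|C| = k) (cardCU : #|C :&: U| = q).
Local Notation core := ((C :&: U) :\ r).

(** A tree on the trace, rooted at [r], glued with a forest that hangs the vertices outside [U] on
    the trace. *)
Definition tree_maps : {set {ffun 'I_N -> 'I_N}} :=
  [set glue core x.1 x.2 |
    x in finset.setX (forest [set r]%SET core) (forest (C :&: U) (C :\: U))]%SET.

Let rC : r \in C. Proof. by move: rCU; rewrite finset.in_setI => /andP[]. Qed.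
Let rU : r \in U. Proof. by move: rCU; rewrite finset.in_setI => /andP[]. Qed.

(** There are at least [q ^ (q - 2)] trees on the trace and [q * k ^ (k - q - 1)] forests hanging
    from it; the factor [q * k] clears negative exponents. *)
Lemma card_tree_maps : (q ^ q * k ^ (k - q) <= q * k * #|tree_maps|)%N.
Proof.
rewrite card_in_imset; last first.
  apply: glue_inj => [f v /forestP[_ h _] vB|g v /forestP[_ h _]]; first exact: h.
  by rewrite finset.in_setD1 finset.in_setI => /and3P[_ _ vU]; apply: h; rewrite finset.in_setD vU.
have q_gt0 : (0 < q)%N by rewrite -cardCU card_gt0; apply/set0Pn; exists r.
have qk : (q <= k)%N by rewrite -cardC -cardCU subset_leq_card// finset.subsetIl.
rewrite cardsX; have := @card_forest_ge N [set r]%SET core.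
have -> : #|core| = q.-1 by rewrite -cardCU (cardsD1 r (C :&: U)) rCU.
rewrite cards1 add1n prednK// mul1n -finset.setI_eq0 => /(_ _) F1.
have {}F1 := F1 _; rewrite (_ : [set r]%SET :&: core == finset.set0) in F1; last first.
  by apply/eqP/setP => v; rewrite finset.in_setI finset.in_setD1 !finset.inE; case: (v == r).
have := @card_forest_ge N (C :&: U) (C :\: U).
rewrite cardsD cardC cardCU subnKC// -finset.setI_eq0 => /(_ _) F2.
have {}F2 := F2 _; rewrite (_ : (C :&: U) :&: (C :\: U) == finset.set0) in F2; last first.
  by apply/eqP/setP => v; rewrite !finset.inE; case: (v \in U); rewrite ?andbF.
have := leq_mul (F1 isT) (F2 isT).
rewrite mulnA -expnSr prednK// => h.
by apply: leq_trans h _; rewrite mulnACA.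
Qed.

Lemma tree_mapsP f : f \in tree_maps ->
  [/\ {in core, forall v, f v \in C :&: U}, {in C :\: U, forall v, f v \in C},
     (forall v, v \notin C :\ r -> f v = v) & descends (C :\ r) f].
Proof.
move=> /imsetP[[g h] /finset.setXP[/forestP[g1 g2 [a ga]] /forestP[h1 h2 [b hb]]] ->] /=.
have coreE v : v \in core = [&& v != r, v \in C & v \in U].
  by rewrite finset.in_setD1 finset.in_setI.
have core_sub v : v \in core -> v \in C :&: U.
  by rewrite finset.in_setD1 => /andP[].
have gCU v : v \in core -> g v \in C :&: U.
  by move=> vc; have := g1 v vc; rewrite finset.in_setU => /orP[/finset.set1P ->|/core_sub].
have outE v : v \in C :\: U -> v \in core = false.
  by rewrite finset.in_setD coreE => /andP[/negbTE -> _]; rewrite !andbF.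
have hC v : v \in C :\: U -> h v \in C.
  move=> vc; have := h1 v vc; rewrite finset.in_setU => /orP[|/finset.setDP[]//].
  by rewrite finset.in_setI => /andP[].
split=> [v vc|v vc|v vc|].
- by rewrite ffunE vc gCU.
- by rewrite ffunE outE// hC.
- rewrite ffunE coreE; move: vc; rewrite finset.in_setD1 negb_and negbK => vc.
  case: ifP => [/and3P[vr vC _]|_]; first by rewrite (negbTE vr) vC in vc.
  apply: h2; rewrite finset.in_setD negb_and negbK; case/orP: vc => [/eqP ->|->].
    by rewrite rU.
  by rewrite orbT.
(* Lifts the heights outside [U] above all those in [U], since a parent edge may enter [U] but not
   leave it. *)
pose M := (\max_v a v).+1.
exists (fun v => if v \in U then a v else (M + b v)%N) => v.
rewrite finset.in_setD1 => /andP[vr vC]; rewrite ffunE coreE vr vC /=.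
case vU: (v \in U).
  have vc : v \in core by rewrite coreE vr vC.
  by have := gCU v vc; rewrite finset.in_setI => /andP[_ ->]; apply: ga.
have vo : v \in C :\: U by rewrite finset.in_setD vU vC.
case: ifP => hU; last by rewrite ltn_add2l hb.
by apply: leq_trans (leq_addr _ _); rewrite ltnS leq_bigmax.
Qed.

Definition map_edge (f : {ffun 'I_N -> 'I_N}) : rel 'I_N :=
  [rel x y | (x != r) && (f x == y) || (y != r) && (f y == x)].

Definition inner_pairs : {set 'I_N * 'I_N} :=
  [set e : 'I_N * 'I_N | [&& (e.1 < e.2)%N, e.1 \in C & e.2 \in C]]%SET.

(** Absent edges are prescribed as well, so the events for different maps in [tree_maps] are
    disjoint. *)
Definition realizes (f : {ffun 'I_N -> 'I_N}) (G : graph N) : bool :=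
  [forall e in inner_pairs, G e.1 e.2 == map_edge f e.1 e.2].

Lemma realizesE f G : f \in tree_maps -> realizes f G ->
  {in C &, forall u v, G u v = map_edge f u v}.
Proof.
move=> /tree_mapsP[_ _ _ [h hf]] /forall_inP fG u v uC vC.
have symE x y : map_edge f x y = map_edge f y x by rewrite /map_edge /= orbC.
case: (ltngtP u v) => [uv|vu|/val_inj uv].
- by apply/eqP; apply: (fG (u, v)); rewrite finset.inE /= uv uC vC.
- rewrite graph_sym symE; apply/eqP; apply: (fG (v, u)).
  by rewrite finset.inE /= vu uC vC.
rewrite -uv graph_irr /map_edge /= orbb; apply/esym/negbTE; rewrite negb_and.
case: eqP => //= /eqP ur; apply/eqP => fu.
by have := hf u; rewrite finset.in_setD1 ur uC => /(_ isT); rewrite fu ltnn.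
Qed.

Lemma realizes_rooting f G : f \in tree_maps -> realizes f G ->
  rooting G C r f /\ rooting G (C :&: U) r f.
Proof.
move=> fT fG; have GE := realizesE fT fG; have [f1 f2 f3 [h hf]] := tree_mapsP fT.
have fC v : v \in C :\ r -> f v \in C.
  rewrite finset.in_setD1 => /andP[vr vC]; case vU: (v \in U).
    have := f1 v; rewrite finset.in_setD1 finset.in_setI vr vC vU => /(_ isT).
    by rewrite finset.in_setI => /andP[].
  by apply: f2; rewrite finset.in_setD vU vC.
have Gf v : v \in C :\ r -> G v (f v).
  move=> vCr; have vfC := fC _ vCr; move: vCr; rewrite finset.in_setD1 => /andP[vr vC].
  by rewrite GE// /map_edge /= vr eqxx.
have edge : {in C &, forall u v, G u v -> (u != r /\ f u = v) \/ (v != r /\ f v = u)}.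
  move=> u v uC vC; rewrite GE// /map_edge /= => /orP[] /andP[? /eqP ?]; [left|right]; by [].
split; split=> //.
- by move=> v vCr; rewrite fC ?Gf.
- by exists h.
- move=> v vc; rewrite f1// Gf//.
  by move: vc; rewrite !finset.in_setD1 finset.in_setI => /and3P[-> ->].
- by move=> u v /finset.setIP[uC _] /finset.setIP[vC _]; apply: edge.
- exists h => v vc; apply: hf.
  by move: vc; rewrite !finset.in_setD1 finset.in_setI => /and3P[-> ->].
Qed.

Lemma realizes_core f G : f \in tree_maps -> realizes f G -> core_tree U C G.
Proof.
move=> fT fG; have [rtC rtCU] := realizes_rooting fT fG.
by apply/asboolP; split; [apply: rooting_tree rtC|have [] := rooting_tree rtCU].
Qed.

Lemma realizes_inj f g G : f \in tree_maps -> g \in tree_maps ->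
  realizes f G -> realizes g G -> f = g.
Proof.
move=> fT gT fG gG; have [rf _] := realizes_rooting fT fG.
have [rg _] := realizes_rooting gT gG.
have [_ _ f3 _] := tree_mapsP fT; have [_ _ g3 _] := tree_mapsP gT.
apply/ffunP => v; case vC: (v \in C :\ r).
  exact: (rooting_unique rf rg (fintype.subxx _)).
by rewrite f3 ?g3 ?vC.
Qed.

(** A non-root vertex of [U] has its parent in [U], whence [pi1]; the other parent edges have rate
    [pi0]. Each of the at most [k ^ 2] remaining pairs is absent with probability at least
    [1 - pi1]. *)
Lemma Ex_realizes f : f \in tree_maps ->
  pi1 ^+ q.-1 * pi0 ^+ (k - q) * (1 - pi1) ^+ (k ^ 2) <=
  Ex p (fun G => (realizes f G)%:R).
Proof.
move=> fT; have [f1 f2 f3 df] := tree_mapsP fT.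
rewrite /realizes Ex_cylinder; last by move=> e; rewrite finset.inE => /andP[].
rewrite (bigID (fun e : 'I_N * 'I_N => map_edge f e.1 e.2)) /=.
have c0 : 0 <= 1 - pi1 by rewrite subr_ge0.
apply: ler_pM; rewrite ?mulr_ge0 ?exprn_ge0//; last first.
  apply: (@le_trans _ _ (\prod_(e in inner_pairs | ~~ map_edge f e.1 e.2) (1 - pi1))).
    rewrite prodr_const; apply: ler_wiXn2l => //; first by rewrite gerBl.
    apply: (@leq_trans #|finset.setX C C|); last by rewrite cardsX cardC mulnn.
    apply/subset_leq_card/fintype.subsetP => e /andP[]; rewrite !finset.inE.
    by move=> /and3P[_ -> ->].
  apply: ler_prod => e /andP[_ /negbTE ne]; rewrite c0 /= /bernoulli_pmf ne lerD2l lerN2.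
  by rewrite pE; case: ifP.
have fC v : v \in C :\ r -> f v \in C.
  rewrite finset.in_setD1 => /andP[vr vC]; case vU: (v \in U).
    have := f1 v; rewrite finset.in_setD1 finset.in_setI vr vC vU => /(_ isT).
    by rewrite finset.in_setI => /andP[].
  by apply: f2; rewrite finset.in_setD vU vC.
have ne v : v \in C :\ r -> f v != v.
  by move=> vC; case: df => h /(_ v vC); apply: contraTneq => ->; rewrite ltnn.
rewrite (eq_bigl [in [set upair v (f v) | v in C :\ r]%SET]); last first.
  move=> e; apply/andP/imsetP => [[]|[v vC ->]].
    rewrite finset.inE => /and3P[e12 e1C e2C] /orP[] /andP[er /eqP fe].
      exists e.1; first by rewrite finset.in_setD1 er.
      by rewrite fe /upair e12; case: e {e12 e1C e2C er fe}.
    exists e.2; first by rewrite finset.in_setD1 er.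
    by rewrite fe /upair ltnNge (ltnW e12) /=; case: e {e12 e1C e2C er fe}.
  have := fC v vC; have := ne v vC; move: vC; rewrite finset.in_setD1 => /andP[vr vC] nev fvC.
  rewrite /upair finset.inE; case: ifP => /= vfv; rewrite ?vfv vC fvC /map_edge /= vr eqxx /= ?orbT//.
  split=> //; rewrite ltn_neqAle val_eqE nev /= andbT.
  by rewrite leqNgt vfv.
rewrite big_imset /=; last exact: descends_edge_inj.
rewrite (eq_bigr (fun v => if v \in U then pi1 else pi0)); last first.
  move=> v vC.
  have -> : map_edge f (upair v (f v)).1 (upair v (f v)).2.
    move: vC; rewrite finset.in_setD1 => /andP[vr _].
    by rewrite /upair; case: ifP => _; rewrite /map_edge /= vr eqxx ?orbT.
  rewrite /bernoulli_pmf.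
  have -> : p (upair v (f v)).1 (upair v (f v)).2 = p v (f v).
    by rewrite /upair; case: ifP.
  rewrite pE; case vU: (v \in U) => //=.
  have := f1 v; move: vC; rewrite !finset.in_setD1 finset.in_setI vU => /andP[-> ->] /(_ isT).
  by rewrite finset.in_setI => /andP[_ ->].
rewrite (big_setID U) /= le_eqVlt; apply/orP; left; apply/eqP; congr (_ * _).
  rewrite (eq_bigr (fun=> pi1)); last by move=> v /finset.setIP[_ ->].
  rewrite prodr_const; congr (_ ^+ _); rewrite -cardCU (cardsD1 r (C :&: U)) rCU /=.
  by congr #|pred_of_set _|; apply/setP => v; rewrite !finset.inE andbA.
rewrite (eq_bigr (fun=> pi0)); last by move=> v /finset.setDP[_ /negbTE ->].
rewrite prodr_const; congr (_ ^+ _); rewrite -cardC -cardCU -cardsD.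
congr #|pred_of_set _|; apply/setP => v; rewrite !finset.inE.
by case: eqP => // ->; rewrite rU.
Qed.

(** The disjoint events [realizes f] all imply [core_tree], so their probabilities add up. *)
Lemma Ex_core_ge :
  q%:R ^+ q * k%:R ^+ (k - q) * (pi1 ^+ q.-1 * pi0 ^+ (k - q) * (1 - pi1) ^+ (k ^ 2)) <=
  q%:R * k%:R * Ex p (fun G => (core_tree U C G)%:R).
Proof.
set x := pi1 ^+ _ * _ * _.
have x0 : 0 <= x by rewrite !mulr_ge0 ?exprn_ge0 ?subr_ge0.
apply: (@le_trans _ _ (q%:R * k%:R * (#|tree_maps|%:R * x))).
  by rewrite [leRHS]mulrA ler_wpM2r// -!natrX -!natrM ler_nat card_tree_maps.
rewrite ler_wpM2l//.
apply: (@le_trans _ _ (\sum_(f in tree_maps) Ex p (fun G => (realizes f G)%:R))).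
  by rewrite mulr_natl -sumr_const; apply: ler_sum => f; apply: Ex_realizes.
rewrite -Ex_sum; apply: ler_Ex => // G.
have [/existsP[f /andP[fT fG]]|no] := boolP [exists f in tree_maps, realizes f G].
  rewrite (bigD1 f)//= (realizes_core fT fG) fG big1 ?addr0// => g /andP[gT gf].
  case gG: (realizes g G) => //.
  by rewrite (realizes_inj gT fT gG fG) eqxx in gf.
rewrite big1 ?ler0n// => f fT; case fG: (realizes f G) => //.
by case/negP: no; apply/existsP; exists f; rewrite fT fG.
Qed.

End OneSet.

Lemma card_core_sets (k q : nat) : (q <= k)%N ->
  ('C(#|U|, q) * 'C(N - #|U|, k - q) <=
   #|[set C : {set 'I_N} | (#|C| == k) && (#|C :&: U| == q)]%SET|)%N.
Proof.
move=> qk; pose dr (B : {set 'I_N}) m := [set A : {set 'I_N} | A \subset B & #|A| == m]%SET.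
have -> : (N - #|U|)%N = #|~: U| by rewrite [RHS]cardsCs finset.setCK card_ord.
rewrite -!cards_draws -cardsX.
have split_sets (A B : {set 'I_N}) : A \subset U -> B \subset ~: U ->
    (A :|: B) :&: U = A /\ (A :|: B) :\: U = B.
  move=> /fintype.subsetP AU /fintype.subsetP BU; split; apply/setP => v.
    rewrite !finset.inE; have := AU v; have := BU v; rewrite finset.inE.
    by case: (v \in A); case: (v \in B); case: (v \in U) => hB hA; do ?[by have := hA isT]; do ?[by have := hB isT].
  rewrite !finset.inE; have := AU v; have := BU v; rewrite finset.inE.
  by case: (v \in A); case: (v \in B); case: (v \in U) => hB hA; do ?[by have := hA isT]; do ?[by have := hB isT].
rewrite -(card_in_imset (f := fun x : {set 'I_N} * {set 'I_N} => x.1 :|: x.2)); last first.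
  move=> [A B] [A' B']; rewrite !finset.in_setX !finset.inE /=.
  move=> /andP[/andP[AU _] /andP[BU _]] /andP[/andP[AU' _] /andP[BU' _]] eqAB.
  have [e1 e2] := split_sets _ _ AU BU; have [e1' e2'] := split_sets _ _ AU' BU'.
  by congr (_, _); [rewrite -[LHS]e1 eqAB e1'|rewrite -[LHS]e2 eqAB e2'].
apply/subset_leq_card/fintype.subsetP => _ /imsetP[[A B] + ->].
rewrite finset.in_setX !finset.inE /= => /andP[/andP[AU /eqP cA] /andP[BU /eqP cB]].
have [e1 e2] := split_sets _ _ AU BU.
by rewrite -(cardsID U (A :|: B)) e1 e2 cA cB subnKC// !eqxx.
Qed.

End PlantedMean.

(** * Risk of the tree-count test *)

Section RiskBound.
Variables (N : nat) (R : realType).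
Implicit Types (S C : {set 'I_N}) (G : graph N).

(* Swapping the restrictions to [A] of two independent graphs, one from each
   law, preserves the joint weight. *)
Lemma Ex_local_eq (p p' : 'I_N -> 'I_N -> R) (A : {set 'I_N}) (F : graph N -> R) :
  local_on A F -> {in A &, p =2 p'} -> Ex p F = Ex p' F.
Proof.
move=> locF pp'.
pose sw (x : graph N * graph N) := (mix A x.1 x.2, mix A x.2 x.1).
have swK : involutive sw.
  move=> [G G']; congr (_, _); apply: graph_eqP => i j; rewrite !mixE/=;
  by case: ifP => // ->.
have ExE (p1 p2 : 'I_N -> 'I_N -> R) : Ex p1 F =
    \sum_(x : graph N * graph N) gweight p1 x.1 * gweight p2 x.2 * F x.1.
  rewrite -(pair_bigA _ (fun G G' => gweight p1 G * gweight p2 G' * F G)) /=.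
  apply: eq_bigr => G _; rewrite -[LHS]mulr1 -(Ex_1 p2) /Ex mulr_sumr.
  by apply: eq_bigr => G' _; rewrite mulr1 mulrAC.
have ExE' (p1 p2 : 'I_N -> 'I_N -> R) : Ex p2 F =
    \sum_(x : graph N * graph N) gweight p1 x.1 * gweight p2 x.2 * F x.2.
  rewrite -(pair_bigA _ (fun G G' => gweight p1 G * gweight p2 G' * F G')) /=.
  rewrite exchange_big; apply: eq_bigr => G' _; rewrite -[LHS]mulr1 -(Ex_1 p1) /Ex mulr_sumr.
  by apply: eq_bigr => G _; rewrite mulr1; ring.
rewrite (ExE p p') (ExE' p p') [RHS](reindex_inj (inv_inj swK)) /=.
apply: eq_bigr => -[G G'] _ /=; congr (_ * _).
  rewrite /gweight -!big_split /=; apply: eq_bigr => e _; rewrite !mixE.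
  by case: ifP => [/andP[e1 e2]|_//]; rewrite mulrC pp'.
by apply: locF => i j iA jA; rewrite mixE iA jA.
Qed.

Lemma core_tree_sub (U : {set 'I_N}) C G : C \subset U -> core_tree U C G = core_tree [set: 'I_N]%SET C G.
Proof. by move=> /finset.setIidPl CU; rewrite /core_tree CU finset.setIT. Qed.

Lemma ntree_sum k G : (ntree k G)%:R =
  \sum_(C in [set C : {set 'I_N} | #|C| == k]%SET) (core_tree [set: 'I_N]%SET C G)%:R :> R.
Proof.
have coreE C : core_tree [set: 'I_N]%SET C G = `[< induced_tree G C >].
  by rewrite /core_tree finset.setIT; apply/asboolP/asboolP => [[]//|[c a]]; split.
rewrite /ntree -sum1_card natr_sum [LHS]big_mkcond [RHS]big_mkcond /=.
apply: eq_bigr => C _; rewrite !finset.inE coreE.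
by case: eqP => //= _; case: asboolP.
Qed.

Variables (n k q : nat) (p0 p1 theta : R).
Hypotheses (p0_gt0 : 0 < p0) (p01 : p0 <= p1) (p1_le1 : p1 <= 1).
Hypotheses (theta01 : 0 <= theta <= 1) (p1_theta : p1 <= theta ^+ 4).
Hypotheses (q_gt0 : (0 < q)%N) (qk : (q <= k)%N).

Definition inflation : R := (1 + theta * k%:R) ^+ (2 * k).
(** Here all trees lie in [U] and [pi0 = pi1 = p0], hence [q = k] and nothing remains outside. *)
Definition null_variance : R := inflation / p0 * second_moment p0 theta k k (N%:R * p0) (N%:R * p0) 0.
Definition planted_variance : R := inflation / p1 * second_moment p1 theta k q (n%:R * p1) (N%:R * p0) (k - q).
(** A vertex of the planted set and [k.-1] further vertices are chosen; the last factor bounds the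
    probability of a single tree under the null. *)
Definition hitting_mean : R := n%:R * ('C(N, k.-1))%:R * (inflation / p0 * (p0 * k%:R) ^+ k).
(** A lower bound for the mean rather than the mean: the number of vertex sets times the bound of
    [Ex_core_ge]. *)
Definition planted_mean : R := ('C(n, q) * 'C(N - n, k - q))%:R *
  (q%:R ^+ q * k%:R ^+ (k - q) *
    (p1 ^+ q.-1 * p0 ^+ (k - q) * (1 - p1) ^+ (k ^ 2)) / (q%:R * k%:R)).
Definition null_mean : R := Ex (fun _ _ => p0) (fun G : graph N => (ntree k G)%:R).

Definition planted_rate S (i j : 'I_N) := if (i \in S) && (j \in S) then p1 else p0.

Let p0_01 : 0 <= p0 <= 1. Proof. by rewrite ltW//= (le_trans p01). Qed.
Let p1_ge0 : 0 <= p1. Proof. by apply: le_trans p01; apply: ltW. Qed.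
Let pS_01 S i j : 0 <= planted_rate S i j <= 1.
Proof. by rewrite /planted_rate; case: ifP; rewrite ?p0_01 // p1_ge0 p1_le1. Qed.
Let pS_sym S i j : planted_rate S i j = planted_rate S j i. Proof. by rewrite /planted_rate andbC. Qed.
Let k_gt0 : (0 < k)%N. Proof. exact: leq_trans qk. Qed.

(** Covers the null with [U] everything and the planted law with [U] the complement of [S]; in both,
    edges at a vertex of [U] have rate [p0]. *)
Lemma variance_trees (p : 'I_N -> 'I_N -> R) (U : {set 'I_N}) (CC : {set {set 'I_N}}) :
    (forall i j, p i j = p j i) -> (forall i j, 0 <= p i j <= 1) ->
    {in U, forall i j, p i j <= p0} ->
    {in CC, forall C, #|C| = k /\ C \subset U} ->
  Ex p (fun G => (\sum_(C in CC) (core_tree U C G)%:R -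
                  Ex p (fun G => \sum_(C in CC) (core_tree U C G)%:R)) ^+ 2) <= null_variance.
Proof.
move=> p_sym p_01 p_le CCP.
have loc C : C \in CC -> local_on C (core_tree U C) by move=> _; apply: core_tree_local.
apply: le_trans (variance_count p_01 loc) _.
rewrite /null_variance -(subnn k); apply: (@sum_pairs_le N U R p p_sym p_01 p0 p0 theta) => //.
- exact: ltW.
- exact: le_trans p01 p1_theta.
- by move=> C /CCP[Ck /finset.setIidPl ->].
- move=> C i j /CCP[_ /fintype.subsetP CU] /CU iU.
  by rewrite iU p_le.
- apply: ler_wpM2r; first exact: ltW.
  by rewrite ler_nat -[leqRHS]card_ord max_card.
Qed.

Lemma null_prob_le tau : 0 < tau ->
  null_prob p0 (fun G : graph N => null_mean + tau <= (ntree k G)%:R) <= null_variance / tau ^+ 2.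
Proof.
move=> tau0; rewrite /null_prob graph_probE.
pose Z G : R := (ntree k G)%:R.
apply: (@le_trans _ _ (Ex (fun _ _ => p0) (fun G => (tau <= `|Z G - null_mean|)%R%:R))).
  apply: ler_Ex => // G; rewrite ler_nat; case: (lerP _ _) => // h.
  by rewrite lt0b (le_trans _ (ler_norm _))// lerBrDl.
apply: le_trans (chebyshev_Ex _ _ _ tau0) _ => //.
apply: ler_wpM2r; first by rewrite invr_ge0 exprn_ge0// ltW.
pose Zs (G : graph N) : R := \sum_(C in [set C : {set 'I_N} | #|C| == k]%SET)
  (core_tree [set: 'I_N]%SET C G)%:R.
have ZE : Z = Zs by apply/funext => G; apply: ntree_sum.
rewrite /null_mean -[fun G => (ntree k G)%:R]/Z ZE.
apply: (@variance_trees (fun _ _ => p0) [set: 'I_N]%SET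
  [set C : {set 'I_N} | #|C| == k]%SET) => // C.
by rewrite finset.inE => /eqP; rewrite finset.subsetT.
Qed.

(** The two laws agree on sets avoiding [S], so the null mean is lost only through the sets that
    meet [S]. *)
Lemma mean_outside_ge S : #|S| = n ->
  null_mean - hitting_mean <= \sum_(C in [set C : {set 'I_N} | (#|C| == k) && (C \subset ~: S)]%SET)
     Ex (planted_rate S) (fun G => (core_tree (~: S) C G)%:R).
Proof.
move=> Sn; rewrite lerBlDr.
have -> : null_mean = \sum_(C in [set C : {set 'I_N} | #|C| == k]%SET)
    Ex (fun _ _ => p0) (fun G => (core_tree [set: 'I_N]%SET C G)%:R).
  rewrite -Ex_sum /null_mean; congr Ex; apply/funext => G; exact: ntree_sum.
rewrite (bigID [pred C : {set 'I_N} | C \subset ~: S]) /=; apply: lerD.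
  rewrite le_eqVlt; apply/orP; left; apply/eqP.
  apply: eq_big => [C|C /andP[_ CS]]; first by rewrite !finset.inE.
  rewrite (@Ex_local_eq _ (planted_rate S) C).
  - by congr Ex; apply/funext => G; rewrite core_tree_sub.
  - by move=> G G' GG'; rewrite (@core_tree_local _ _ _ _ _ GG').
  move=> i j /(fintype.subsetP CS) + _; rewrite finset.inE => /negbTE iS.
  by rewrite /planted_rate iS.
apply: (@le_trans _ _ (\sum_(C in [set C : {set 'I_N} | #|C| == k]%SET | ~~ (C \subset ~: S))
    (inflation / p0 * (p0 * k%:R) ^+ k))).
  apply: ler_sum => C /andP[]; rewrite finset.inE => /eqP Ck _.
  (* The pair bound for [C' = C] bounds the probability of one tree. *)
  have := @pair_le N [set: 'I_N]%SET R (fun _ _ => p0) (fun _ _ => erefl) (fun _ _ => p0_01)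
    p0 p0 theta (ltW p0_gt0) (lexx _) p0_gt0 theta01 (le_trans p01 p1_theta) k k k_gt0 C C Ck Ck.
  rewrite !finset.setIT finset.setIid => /(_ Ck Ck).
  rewrite /pair_bound finset.setDT cards0 Ck subnn addn0 muln0 !expr0 !mulr1.
  rewrite (gtn_eqF k_gt0) => h.
  rewrite [leLHS](_ : _ = Ex (fun _ _ => p0) (fun G : graph N =>
      (core_tree [set: 'I_N]%SET C G && core_tree [set: 'I_N]%SET C G)%:R)); last first.
    by congr Ex; apply/funext => G; rewrite andbb.
  apply: le_trans (h _ _) _.
  - by move=> i j; rewrite finset.inE /=; case: ifP.
  - by rewrite -card_gt0 Ck.
  by rewrite -/inflation le_eqVlt; apply/orP; left; apply/eqP; rewrite div1r; ring.
rewrite sumr_const -[leLHS]mulr_natl /hitting_mean -natrM ler_wpM2r//.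
  by rewrite mulr_ge0 ?divr_ge0 ?exprn_ge0 ?mulr_ge0 ?addr_ge0 ?mulr_ge0 ?(ltW p0_gt0)//; case/andP: theta01.
rewrite ler_nat.
have -> : 'C(N, k.-1) = #|[set B : {set 'I_N} | B \subset [set: 'I_N]%SET & #|B| == k.-1]%SET|.
  by rewrite cards_draws cardsT card_ord.
rewrite -Sn -cardsX.
apply: leq_trans (leq_imset_card (fun x : 'I_N * {set 'I_N} => x.1 |: x.2) _).
apply/subset_leq_card/fintype.subsetP => C /andP[]; rewrite finset.inE => /eqP Ck.
move=> /fintype.subsetPn[s sC]; rewrite finset.inE negbK => sS.
apply/imsetP; exists (s, C :\ s); last by rewrite finset.setD1K.
rewrite finset.in_setX sS finset.inE finset.subsetT /=.
by rewrite -Ck (cardsD1 s C) sC.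
Qed.

Lemma mean_planted_ge S : #|S| = n ->
  planted_mean <= \sum_(C in [set C : {set 'I_N} | (#|C| == k) && (#|C :&: S| == q)]%SET)
     Ex (planted_rate S) (fun G => (core_tree S C G)%:R).
Proof.
move=> Sn; rewrite /planted_mean; set x := (X in _ * X <= _).
apply: (@le_trans _ _ (\sum_(C in [set C : {set 'I_N} | (#|C| == k) && (#|C :&: S| == q)]%SET) x)).
  rewrite sumr_const -[leRHS]mulr_natl ler_wpM2r//.
    by rewrite /x !mulr_ge0 ?invr_ge0 ?mulr_ge0 ?exprn_ge0 ?subr_ge0 ?(ltW p0_gt0).
  by rewrite ler_nat -Sn card_core_sets.
apply: ler_sum => C; rewrite finset.inE => /andP[/eqP Ck /eqP CSq].
have [r rCS] : exists r, r \in C :&: S by apply/card_gt0P; rewrite CSq.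
rewrite /x ler_pdivrMr ?mulr_gt0 ?ltr0n// [leRHS]mulrC.
by apply: (@Ex_core_ge N S R (planted_rate S) p0 p1 _ _ _ _ C r k q) => //; apply: ltW.
Qed.

Let K_ge0 : 0 <= inflation.
Proof. by rewrite exprn_ge0// addr_ge0// mulr_ge0//; case/andP: theta01. Qed.

Let V_ge0 : 0 <= null_variance.
Proof.
apply: mulr_ge0; first by rewrite divr_ge0// ltW.
by apply: second_moment_ge0 => //; rewrite mulr_ge0// ltW.
Qed.

Let V'0 : 0 <= planted_variance.
Proof.
apply: mulr_ge0; first by rewrite divr_ge0.
apply: second_moment_ge0 => //; rewrite ?mulr_ge0//; last exact: ltW.
exact: lt_le_trans p01.
Qed.

Lemma planted_prob_le S : #|S| = n -> 0 < planted_mean -> hitting_mean <= planted_mean / 8 ->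
  planted_prob p0 p1 S (fun G : graph N => ~~ (null_mean + planted_mean / 2 <= (ntree k G)%:R)) <=
  64 * null_variance / planted_mean ^+ 2 + 16 * planted_variance / planted_mean ^+ 2.
Proof.
move=> Sn sig0 loss_le; rewrite /planted_prob graph_probE -/(planted_rate S).
pose CM := [set C : {set 'I_N} | (#|C| == k) && (C \subset ~: S)]%SET.
pose CN := [set C : {set 'I_N} | (#|C| == k) && (#|C :&: S| == q)]%SET.
pose M (G : graph N) : R := \sum_(C in CM) (core_tree (~: S) C G)%:R.
pose Z (G : graph N) : R := \sum_(C in CN) (core_tree S C G)%:R.
have MZ G : M G + Z G <= (ntree k G)%:R.
  rewrite ntree_sum [leRHS](bigID [pred C : {set 'I_N} | C \subset ~: S]) /=; apply: lerD.
    rewrite le_eqVlt; apply/orP; left; apply/eqP.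
    apply: eq_big => [C|C]; first by rewrite !finset.inE.
    by rewrite finset.inE => /andP[_ CS]; rewrite core_tree_sub.
  rewrite /Z [leLHS]big_mkcond [leRHS]big_mkcond; apply: ler_sum => C _.
  rewrite !finset.inE; case: (#|C| == k) => //=.
  case: eqP => [CS|_]; last by case: ifP.
  have -> : C \subset ~: S = false.
    apply/negbTE; rewrite -finset.disjoints_subset -finset.setI_eq0 -card_gt0 CS.
    by rewrite lt0n -lt0n.
  rewrite /= ler_nat; case cS: (core_tree S C G) => //.
  suff -> : core_tree [set: 'I_N]%SET C G by [].
  by move/asboolP: cS => [tC _]; apply/asboolP; rewrite finset.setIT; split=> //; case: tC.
have EM : null_mean - hitting_mean <= Ex (planted_rate S) M by rewrite /M Ex_sum mean_outside_ge.
have EZ : planted_mean <= Ex (planted_rate S) Z by rewrite /Z Ex_sum mean_planted_ge.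
have EZ0 : 0 < Ex (planted_rate S) Z by apply: lt_le_trans EZ.
(* The budget: [M] loses [1/8] of [planted_mean] to [hitting_mean] and [1/8] to deviation, [Z] keeps
   at least [3/4] of it, so the threshold at [1/2] is reached. *)
pose bad1 G := (planted_mean / 8 <= `|M G - Ex (planted_rate S) M|)%R.
pose bad2 G := (Ex (planted_rate S) Z / 4 <= `|Z G - Ex (planted_rate S) Z|)%R.
apply: (@le_trans _ _ (Ex (planted_rate S) (fun G => (bad1 G)%:R) + Ex (planted_rate S) (fun G => (bad2 G)%:R))).
  rewrite /Ex -big_split /=; apply: ler_sum => G _; rewrite -mulrDr ler_wpM2l ?gweight_ge0//.
  case b1: (bad1 G); first by rewrite ler_wpDr ?ler0n// lern1; case: (~~ _).
  case b2: (bad2 G); first by rewrite ler_wpDl ?ler0n// lern1; case: (~~ _).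
  rewrite addr0 lern0 eqb0 negbK; apply: le_trans (MZ G).
  move/negbT: b1; move/negbT: b2; rewrite /bad1 /bad2 -!ltNge.
  by move=> /ltr_normlP[h1 h2] /ltr_normlP[h3 h4]; lra.
apply: lerD.
  apply: le_trans (chebyshev_Ex _ _ _ _) _ => //; first by rewrite divr_gt0.
  rewrite [leRHS](_ : _ = null_variance / (planted_mean / 8) ^+ 2); last by field; rewrite gt_eqF.
  rewrite ler_wpM2r ?invr_ge0 ?exprn_ge0 ?divr_ge0 ?(ltW sig0)//.
  apply: variance_trees => //.
  - by move=> i; rewrite finset.inE => /negbTE iS j; rewrite /planted_rate iS.
  by move=> C; rewrite finset.inE => /andP[/eqP].
apply: le_trans (chebyshev_Ex _ _ _ _) _ => //; first by rewrite divr_gt0.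
apply: (@le_trans _ _ (planted_variance / (Ex (planted_rate S) Z / 4) ^+ 2)).
  rewrite ler_wpM2r ?invr_ge0 ?exprn_ge0 ?divr_ge0 ?(ltW EZ0)//.
  have loc C : C \in CN -> local_on C (core_tree S C) by move=> _; apply: core_tree_local.
  apply: le_trans (variance_count (pS_01 S) loc) _.
  apply: (@sum_pairs_le N S R (planted_rate S) (pS_sym S) (pS_01 S) p0 p1 theta) => //.
  - exact: ltW.
  - exact: lt_le_trans p01.
  - by move=> C; rewrite finset.inE => /andP[/eqP -> /eqP].
  - by move=> C i j _ _; rewrite /planted_rate; case: (i \in S) => //=; case: ifP.
  - by rewrite Sn.
rewrite [leRHS](_ : _ = planted_variance / (planted_mean / 4) ^+ 2); last by field; rewrite gt_eqF.
rewrite ler_wpM2l// lef_pV2 ?posrE ?exprn_gt0 ?divr_gt0// lerXn2r ?nnegrE ?divr_ge0 ?(ltW EZ0) ?(ltW sig0)//.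
by rewrite ler_wpM2r.
Qed.

(** In [68 = 4 + 64], the [4] comes from the null error with deviation one half, the [64] from the
    trees avoiding [S] with deviation one eighth; [16] comes from deviation one quarter. *)
Lemma risk_le : 0 < planted_mean -> hitting_mean <= planted_mean / 8 ->
  risk n p0 p1 (fun G : graph N => null_mean + planted_mean / 2 <= (ntree k G)%:R) <=
  68 * null_variance / planted_mean ^+ 2 + 16 * planted_variance / planted_mean ^+ 2.
Proof.
move=> sig0 loss_le.
have -> : 68 * null_variance / planted_mean ^+ 2 + 16 * planted_variance / planted_mean ^+ 2 =
    null_variance / (planted_mean / 2) ^+ 2 + (64 * null_variance / planted_mean ^+ 2 + 16 * planted_variance / planted_mean ^+ 2).
  by field; rewrite gt_eqF.
apply: lerD; first by apply: null_prob_le; rewrite divr_gt0.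
apply: bigmax_le => [|S /eqP Sn]; last exact: planted_prob_le.
have s20 : 0 <= planted_mean ^+ 2 by rewrite exprn_ge0// ltW.
by apply: addr_ge0; apply: divr_ge0 => //; apply: mulr_ge0.
Qed.

Lemma risk_ge0 phi : 0 <= risk n p0 p1 (phi : pred (graph N)).
Proof.
rewrite addr_ge0//; last exact: bigmax_ge_id.
by rewrite /null_prob graph_probE Ex_ge0// => G; apply: ler0n.
Qed.

End RiskBound.

(** * Exponential estimates *)

Section Factorials.
Variable R : realType.
Implicit Types (x : R) (m k : nat).

Lemma expr_fact_le x m : 0 <= x -> x ^+ m / m`!%:R <= expR x.
Proof.
move=> x0; case: m => [|m]; first by rewrite expr0 divr1 -expR0 ler_expR.
by apply: le_trans (expR_ge1Dxn m x0); rewrite lerDr.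
Qed.

Lemma expR1_pow_le m : expR 1 * m.+1%:R ^+ m.+2 <= m.+2%:R ^+ m.+2 :> R.
Proof.
have m2 : (0 : R) < m.+2%:R by rewrite ltr0n.
have h : expR (m.+2%:R^-1) * m.+1%:R <= m.+2%:R :> R.
  have := expR_ge1Dx (- m.+2%:R^-1 : R); rewrite expRN.
  rewrite -(ler_pM2l (expR_gt0 (m.+2%:R^-1))) divff ?gt_eqF ?expR_gt0// => h.
  have -> : m.+1%:R = (1 - m.+2%:R^-1) * m.+2%:R :> R.
    by rewrite mulrBl mulVf ?gt_eqF// mul1r -[m.+2%:R]natr1 addrK.
  by rewrite mulrA; apply: ler_piMl.
have -> : expR 1 = expR (m.+2%:R^-1) ^+ m.+2 :> R.
  by rewrite -expRM_natl mulfV ?gt_eqF.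
by rewrite -exprMn lerXn2r// nnegrE ?mulr_ge0 ?expR_ge0// ltW.
Qed.

(** Stirling's bound up to a polynomial factor; the induction step is the inequality between [e] and
    [((m + 2) / (m + 1)) ^ (m + 2)]. *)
Lemma fact_expR_le m : m.+1`!%:R * expR 1 ^+ m <= m.+1%:R ^+ m.+2 :> R.
Proof.
elim: m => [|m IH]; first by rewrite expr0 mulr1 expr1n.
rewrite factS natrM exprS [leLHS](_ : _ = m.+2%:R * (expR 1 * (m.+1`!%:R * expR 1 ^+ m))); last by ring.
rewrite [leRHS]exprS ler_wpM2l//; apply: le_trans (expR1_pow_le m).
by rewrite ler_wpM2l// expR_ge0.
Qed.

Lemma expr_fact_ge m : (0 < m)%N ->
  expR m%:R / (expR 1 * m%:R) <= m%:R ^+ m / m`!%:R :> R.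
Proof.
case: m => // m _; have e0 := expR_gt0 (1 : R).
rewrite ler_pdivrMr ?mulr_gt0// mulrAC ler_pdivlMr ?ltr0n ?fact_gt0//.
rewrite -[m.+1%:R]mulr1 expRM_natl mulr1 exprS.
rewrite [leLHS](_ : _ = expR 1 * (m.+1`!%:R * expR 1 ^+ m)); last by ring.
rewrite [leRHS](_ : _ = expR 1 * (m.+1%:R ^+ m.+2)); last by rewrite [in RHS]exprSr; ring.
by rewrite ler_pM2l// fact_expR_le.
Qed.

(* Rounding down the exponent to the mode of the exponential series costs only a
   polynomial factor. *)
Lemma expr_fact_floor_ge x m : m%:R <= x -> x < m.+1%:R ->
  expR x / (expR 1 ^+ 2 * m.+1%:R) <= x ^+ m / m`!%:R.
Proof.
move=> mx xm; have e0 := expR_gt0 (1 : R).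
have ex : expR x <= expR m%:R * expR 1 by rewrite -expRD ler_expR natr1 ltW.
have [m0|m_gt0] := posnP m.
  move: ex; rewrite m0 expR0 mul1r expr0 divr1 mulr1 => ex.
  rewrite ler_pdivrMr ?exprn_gt0// mul1r (le_trans ex)//.
  by rewrite expr2 ler_peMl ?ltW// -expR0 ltr_expR.
apply: (@le_trans _ _ (m%:R ^+ m / m`!%:R)); last first.
  by rewrite ler_wpM2r// lerXn2r// nnegrE ?(le_trans _ mx).
apply: le_trans (expr_fact_ge m_gt0).
rewrite ler_pdivrMr ?mulr_gt0 ?exprn_gt0// (le_trans ex)//.
rewrite [leRHS](_ : _ = (expR m%:R * expR 1) * (m.+1%:R / m%:R)).
  by rewrite ler_peMr ?mulr_ge0 ?expR_ge0// ler_pdivlMr ?ltr0n// mul1r ler_nat.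
by field; rewrite !gt_eqF ?ltr0n.
Qed.

(** Below the mode, consecutive terms have ratio [x / j.+1 >= 1]. *)
Lemma expr_fact_mono x i m : (i <= m)%N -> m%:R <= x ->
  x ^+ i / i`!%:R <= x ^+ m / m`!%:R.
Proof.
move=> /subnK <-; elim: (m - i)%N => // d IH; rewrite addSn => dx.
apply: le_trans (IH _) _; first by apply: le_trans dx; rewrite ler_nat.
set j := (d + i)%N in dx *; rewrite exprS factS natrM invfM.
have x0 : 0 <= x by apply: le_trans dx.
rewrite [leRHS](_ : _ = (x / j.+1%:R) * (x ^+ j / j`!%:R)); last by ring.
rewrite ler_peMl ?divr_ge0 ?exprn_ge0//.
by rewrite ler_pdivlMr ?ltr0n// mul1r.
Qed.

Lemma bernoulli_le x m : 0 <= x <= 1 -> 1 - m%:R * x <= (1 - x) ^+ m.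
Proof.
move=> /andP[x0 x1]; elim: m => [|m IH]; first by rewrite expr0 mul0r subr0.
rewrite exprS; apply: le_trans (ler_wpM2l _ IH); last by rewrite subr_ge0.
rewrite -natr1; have : 0 <= m%:R * x * x by rewrite !mulr_ge0.
by lra.
Qed.

Lemma ffact_ge n m : ((n - m) ^ m <= n ^_ m)%N.
Proof.
elim: m n => [n|m IH [|n]]; first by rewrite expn0 ffactn0.
  by rewrite sub0n exp0n.
rewrite ffactSS subSS expnS.
by apply: leq_mul; [exact: leq_trans (leq_subr _ _) (leqnSn n)|exact: IH].
Qed.

Lemma bin_ge n m : (n - m)%N%:R ^+ m / m`!%:R <= 'C(n, m)%:R :> R.
Proof.
by rewrite ler_pdivrMr ?ltr0n ?fact_gt0// -natrM bin_ffact -natrX ler_nat ffact_ge.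
Qed.

End Factorials.

(** * Dominant terms of the second-moment sums *)

Section SecondMomentBounds.
Variable R : realType.
Local Notation E := (expR (1 : R)).

(** Moves the dependence on the overlap size into [(s ^+ m * x) ^+ 2]: of the factor [L ^+ (2 * m)],
    half completes the fixed power of [L * Y] and the other half becomes a power of [s]. This is the
    origin of [s] and [u]. *)
Lemma geometric_swap (L Y s x : R) (i m : nat) : 0 < Y -> s ^+ 2 = L / Y ->
  L ^+ i * Y ^+ i * (L ^+ m * x) ^+ 2 = (L * Y) ^+ (i + m) * (s ^+ m * x) ^+ 2.
Proof.
move=> Y0 sE.
have -> : (s ^+ m * x) ^+ 2 = L ^+ m / Y ^+ m * x ^+ 2.
  by rewrite exprMn -exprM mulnC exprM sE expr_div_n.
rewrite !exprD !exprMn.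
have Ym : Y ^+ m != 0 by rewrite expf_neq0// gt_eqF.
by field.
Qed.

Lemma natr_pow_fact_le (a m : nat) : a%:R ^+ m / m`!%:R <= E ^+ a.
Proof. by rewrite -expRM_natl mulr1; apply: expr_fact_le. Qed.

(** The shared part [i ^ i / i!] is at most [E ^+ i], so [Y = E]; the [m = k - i] unshared vertices
    give the term [(s k) ^ m / m!] of the exponential series, squared for the two trees. *)
Lemma second_moment_null_le (p theta L s : R) (k : nat) :
    0 <= L -> 0 <= s -> s ^+ 2 = L / E ->
  second_moment p theta k k L L 0 <= k.+1%:R * ((L * E) ^+ k * expR (s * k%:R) ^+ 2).
Proof.
move=> L0 s0 sE; have E0 := expR_gt0 (1 : R).
apply: (@le_trans _ _ (\sum_(i < k.+1) (L * E) ^+ k * expR (s * k%:R) ^+ 2)); last first.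
  by rewrite sumr_const card_ord -[leLHS]mulr_natl.
rewrite /second_moment; apply: ler_sum => i _.
have X0 : 0 <= (L * E) ^+ k * expR (s * k%:R) ^+ 2.
  by rewrite mulr_ge0 ?exprn_ge0 ?mulr_ge0 ?expR_ge0.
rewrite big_mkcond big_ord1 /= addn0; case: posnP => // i_gt0.
rewrite !subnn !expr0 fact0 !divr1 !mulr1 expr1n !mulr1 mul1r.
set m := (k - i)%N.
apply: (@le_trans _ _ (L ^+ i * E ^+ i * (L ^+ m * (k%:R ^+ m / m`!%:R)) ^+ 2)).
  rewrite ler_wpM2r ?sqr_ge0// ler_wpM2l ?exprn_ge0//; exact: natr_pow_fact_le.
rewrite (geometric_swap _ _ _ E0 sE) subnKC ?leq_ord// ler_wpM2l ?exprn_ge0 ?mulr_ge0 ?(ltW E0)//.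
rewrite lerXn2r ?nnegrE ?expR_ge0 ?mulr_ge0 ?exprn_ge0 ?divr_ge0 ?exprn_ge0//.
by rewrite mulrA -exprMn expr_fact_le// mulr_ge0.
Qed.

(** The factor [(i + j) ^ j / j!] is at most [E ^+ (i + j)]: its excess [E ^+ i] joins the [E ^+ i]
    of the core, so inside [U] the swap has [Y = E ^+ 2] and yields [u]. Outside, [e <= s k] keeps
    the terms below the mode, so an empty overlap there is the worst case. The case [i = 0] gives
    the [theta] term. *)
Lemma second_moment_planted_le (p theta L1 L0 s u A B : R) (k q e : nat) :
    0 < p -> 0 <= L1 -> 0 <= L0 -> 0 <= s -> 0 <= u ->
    s ^+ 2 = L0 / E -> u ^+ 2 = L1 / E ^+ 2 -> e%:R <= s * k%:R ->
    A = L1 ^+ q * (q%:R ^+ q / q`!%:R) -> B = L0 ^+ e * (k%:R ^+ e / e`!%:R) ->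
  second_moment p theta k q L1 L0 e <= (q.+1 * e.+1)%:R *
    ((theta ^+ 2 / p * A ^+ 2 + (L1 * E ^+ 2) ^+ q * expR (u * q%:R) ^+ 2) * B ^+ 2).
Proof.
move=> p0 L10 L00 s0 u0 sE uE esk AE BE; have E0 := expR_gt0 (1 : R).
have E20 : 0 < E ^+ 2 by rewrite exprn_gt0.
have c0 : 0 <= theta ^+ 2 / p by rewrite divr_ge0 ?sqr_ge0// ltW.
pose X := (theta ^+ 2 / p * A ^+ 2 + (L1 * E ^+ 2) ^+ q * expR (u * q%:R) ^+ 2) * B ^+ 2.
have X1 : 0 <= theta ^+ 2 / p * A ^+ 2 by rewrite mulr_ge0 ?sqr_ge0.
have X2 : 0 <= (L1 * E ^+ 2) ^+ q * expR (u * q%:R) ^+ 2.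
  by rewrite mulr_ge0 ?sqr_ge0 ?exprn_ge0 ?mulr_ge0 ?(ltW E20).
have X0 : 0 <= X by rewrite mulr_ge0 ?sqr_ge0 ?addr_ge0.
apply: (@le_trans _ _ (\sum_(i < q.+1) \sum_(j < e.+1) X)); last first.
  by rewrite !sumr_const !card_ord -/X mulr_natl -mulrnA mulnC.
rewrite /second_moment; apply: ler_sum => i _.
rewrite big_mkcond; apply: ler_sum => j _; case: ifP => // _.
set a := L1 ^+ i * _; set b := L1 ^+ (q - i) * _; set m := (e - j)%N.
have outer : (L0 ^+ j * ((i + j)%:R ^+ j / j`!%:R)) *
    (L0 ^+ m * (k%:R ^+ m / m`!%:R)) ^+ 2 <= E ^+ i * B ^+ 2.
  apply: (@le_trans _ _ (E ^+ i * (L0 ^+ j * E ^+ j * (L0 ^+ m * (k%:R ^+ m / m`!%:R)) ^+ 2))).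
    rewrite [leRHS]mulrA ler_wpM2r ?sqr_ge0// [leRHS]mulrCA ler_wpM2l ?exprn_ge0// -exprD.
    exact: natr_pow_fact_le.
  rewrite (geometric_swap _ _ _ E0 sE) subnKC ?leq_ord// ler_wpM2l ?exprn_ge0 ?(ltW E0)//.
  have -> : B ^+ 2 = (L0 * E) ^+ e * (s ^+ e * (k%:R ^+ e / e`!%:R)) ^+ 2.
    by rewrite BE -[e in (L0 * E) ^+ e]add0n -(geometric_swap _ _ _ E0 sE) !expr0 !mul1r.
  rewrite ler_wpM2l ?exprn_ge0 ?mulr_ge0 ?(ltW E0)//.
  rewrite lerXn2r ?nnegrE ?mulr_ge0 ?exprn_ge0 ?divr_ge0 ?exprn_ge0//.
  by rewrite !mulrA -!exprMn expr_fact_mono// leq_subr.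
have a0 : 0 <= a by rewrite mulr_ge0 ?divr_ge0 ?exprn_ge0.
case: posnP => [i0|i_gt0] /=.
  have -> : a = 1 by rewrite /a i0 !expr0 fact0 divr1 mulr1.
  have -> : b = A by rewrite /b AE i0 subn0.
  rewrite mulr1; apply: (@le_trans _ _ (theta ^+ 2 / p * A ^+ 2 * B ^+ 2)).
    by rewrite ler_wpM2l// (le_trans outer)// i0 expr0 mul1r.
  by rewrite ler_wpM2r ?sqr_ge0// lerDl.
rewrite mul1r; apply: (@le_trans _ _ (a * b ^+ 2 * (E ^+ i * B ^+ 2))).
  by rewrite ler_wpM2l// mulr_ge0 ?sqr_ge0.
rewrite [leLHS]mulrA ler_wpM2r ?sqr_ge0//; apply: le_trans (_ : _ <= (L1 * E ^+ 2) ^+ q * expR (u * q%:R) ^+ 2) _; last first.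
  by rewrite lerDr.
apply: (@le_trans _ _ (L1 ^+ i * (E ^+ 2) ^+ i * b ^+ 2)).
  rewrite mulrAC ler_wpM2r ?sqr_ge0// /a -mulrA ler_wpM2l ?exprn_ge0//.
  rewrite exprAC expr2 ler_wpM2r ?exprn_ge0 ?(ltW E0)//; exact: natr_pow_fact_le.
rewrite (geometric_swap _ _ _ E20 uE) subnKC ?leq_ord// ler_wpM2l ?exprn_ge0 ?mulr_ge0 ?(ltW E20)//.
rewrite lerXn2r ?nnegrE ?expR_ge0 ?mulr_ge0 ?exprn_ge0 ?divr_ge0 ?exprn_ge0//.
by rewrite mulrA -exprMn expr_fact_le// mulr_ge0.
Qed.

End SecondMomentBounds.

(** * Signal to noise ratios at fixed size *)

Section FixedSize.
Variables (R : realType) (l0 l1 eps delta : R).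
Local Notation E := (expR (1 : R)).
Hypotheses (l0_gt0 : 0 < l0) (l1_gt0 : 0 < l1) (l1_lt1 : l1 < 1).
(** The optimal fraction of vertices outside [S]: relative to [(l1 E) ^ k], placing [e] vertices
    there weighs [(a k) ^ e / e!], which is largest near [e = a k]. *)
Definition out_ratio : R := l0 / (l1 * E).
Local Notation a := out_ratio.
Local Notation s := (Num.sqrt (l0 / E)).
Local Notation u := (Num.sqrt l1 / E).
Hypotheses (a_lt1 : a < 1) (a_le_s : a <= s) (eps_gt0 : 0 < eps).
Hypothesis delta_eps : expR (- eps) <= 1 - delta.

Let E_gt0 : 0 < E. Proof. exact: expR_gt0. Qed.
Let a_gt0 : 0 < a. Proof. by rewrite divr_gt0// mulr_gt0. Qed.

Variables (N n k : nat) (p0 p1 : R).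
Hypotheses (p0E : N%:R * p0 = l0) (p1E : n%:R * p1 = l1).
Hypotheses (p0_gt0 : 0 < p0) (p01 : p0 <= p1) (p1_le1 : p1 <= 1).
Hypotheses (k_gt0 : (0 < k)%N) (k_small : (16 * k ^ 8 <= n)%N).
Hypothesis n_small : (n + k)%:R <= delta * N%:R.

Definition out_size : nat := Num.trunc (a * k%:R).
Definition core_size : nat := (k - out_size)%N.
Definition edge_root : R := Num.sqrt (Num.sqrt p1).
Local Notation e := out_size.
Local Notation q := core_size.
Local Notation theta := edge_root.
Local Notation A := (l1 ^+ q * (q%:R ^+ q / q`!%:R)).
Local Notation B := (l0 ^+ e * (k%:R ^+ e / e`!%:R)).

Let p1_gt0 : 0 < p1. Proof. exact: lt_le_trans p01. Qed.
Let n_gt0 : (0 < n)%N. Proof. by apply: leq_trans k_small; rewrite muln_gt0 expn_gt0 k_gt0. Qed.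
Let nR_gt0 : 0 < n%:R :> R. Proof. by rewrite ltr0n. Qed.
Let kR_gt0 : 0 < k%:R :> R. Proof. by rewrite ltr0n. Qed.
Let kR_ge1 : 1 <= k%:R :> R. Proof. by rewrite ler1n. Qed.
Let p1_eq : p1 = l1 / n%:R. Proof. by rewrite -p1E mulrAC divff ?mul1r// gt_eqF. Qed.

Lemma out_size_itv : e%:R <= a * k%:R < e.+1%:R.
Proof. by apply: truncn_itv; rewrite mulr_ge0// ltW. Qed.

Lemma out_size_lt : (e < k)%N.
Proof.
rewrite -(ltr_nat R); have /andP[h _] := out_size_itv.
by apply: le_lt_trans h _; rewrite gtr_pMl.
Qed.

Lemma core_size_gt0 : (0 < q)%N. Proof. by rewrite subn_gt0 out_size_lt. Qed.
Lemma core_size_le : (q <= k)%N. Proof. exact: leq_subr. Qed.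
Lemma core_sizeK : (k - q)%N = e. Proof. by rewrite subKn// ltnW// out_size_lt. Qed.

Lemma core_size_ub : q%:R <= (1 - a) * k%:R + 1 :> R.
Proof.
rewrite natrB ?(ltnW out_size_lt)//; have /andP[_] := out_size_itv.
by rewrite -natr1; lra.
Qed.

Lemma edge_root4 : theta ^+ 4 = p1.
Proof.
rewrite (_ : 4 = 2 * 2)%N// exprM !sqr_sqrtr ?sqrtr_ge0//; exact: ltW.
Qed.

Lemma edge_root01 : 0 <= theta <= 1.
Proof.
rewrite sqrtr_ge0 /= -(@ler_pXn2r _ 4)// ?nnegrE ?sqrtr_ge0//.
by rewrite edge_root4 expr1n.
Qed.

Lemma k8_small : 16 * k%:R ^+ 8 <= n%:R :> R.
Proof. by rewrite -natrX -natrM ler_nat. Qed.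

Lemma k2_small : k%:R ^+ 2 / n%:R <= 1 / 2 :> R.
Proof.
rewrite ler_pdivrMr//; have := k8_small.
have : k%:R ^+ 2 <= k%:R ^+ 8 :> R by rewrite ler_weXn2l.
by have : 0 <= k%:R ^+ 8 :> R; [rewrite exprn_ge0|lra].
Qed.

(** Indeed [(2 theta k ^ 2) ^ 4 = 16 k ^ 8 p1 <= n p1 = l1 < 1]; this is the origin of the condition
    [16 * k ^ 8 <= n]. *)
Lemma inflation_le : inflation k theta <= E.
Proof.
have th0 : 0 <= theta by apply: sqrtr_ge0.
apply: (@le_trans _ _ (expR (theta * k%:R) ^+ (2 * k))).
  by rewrite lerXn2r ?nnegrE ?expR_ge0 ?addr_ge0 ?mulr_ge0// expR_ge1Dx.
rewrite -expRM_natl ler_expR -(@ler_pXn2r _ 4)// ?nnegrE ?mulr_ge0//.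
rewrite [leLHS](_ : _ = 16 * k%:R ^+ 8 * theta ^+ 4); last by rewrite natrM; ring.
rewrite edge_root4 expr1n; apply: le_trans (ltW l1_lt1).
by rewrite -p1E ler_wpM2r ?k8_small// ltW.
Qed.

(** The binomial coefficient costs [1/2] inside [S], where [k ^ 2 / n] is small, and [exp (- eps k)]
    outside, where [N - n - k] is at least [(1 - delta) N]; the absent edges cost another [1/2]. *)
Lemma planted_mean_ge :
  A * B / p1 * (expR (- (eps * k%:R)) / (4 * k%:R ^+ 2)) <= planted_mean N n k q p0 p1.
Proof.
rewrite /planted_mean core_sizeK natrM.
have q0 := core_size_gt0; have qk := core_size_le.
have qR0 : 0 < q%:R :> R by rewrite ltr0n.
have p10 := ltW p1_gt0; have p00 := ltW p0_gt0.
have l00 := ltW l0_gt0; have l10 := ltW l1_gt0.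
have A0 : 0 <= A by rewrite mulr_ge0 ?divr_ge0 ?exprn_ge0.
have B0 : 0 <= B by rewrite mulr_ge0 ?divr_ge0 ?exprn_ge0.
have kn : (k <= n)%N.
  by apply: leq_trans k_small; rewrite -{1}(expn1 k) (leq_trans (leq_pexp2l _ (isT : 1 <= 8)%N))// leq_pmull.
have core : A / 2 <= ('C(n, q))%:R * (p1 ^+ q * q%:R ^+ q).
  apply: (@le_trans _ _ ((n - q)%N%:R ^+ q / q`!%:R * (p1 ^+ q * q%:R ^+ q))); last first.
    by rewrite ler_wpM2r ?bin_ge ?mulr_ge0 ?exprn_ge0.
  have -> : (n - q)%N%:R ^+ q / q`!%:R * (p1 ^+ q * q%:R ^+ q) = (1 - q%:R / n%:R) ^+ q * A.
    rewrite natrB ?(leq_trans qk)// p1_eq !exprMn.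
    have -> : 1 - q%:R / n%:R = (n%:R - q%:R) / n%:R :> R by field; rewrite gt_eqF.
    by rewrite !exprMn; ring.
  rewrite mulrC ler_wpM2r// (le_trans _ (bernoulli_le _ _))//; last first.
    by rewrite divr_ge0//= ler_pdivrMr// mul1r ler_nat (leq_trans qk).
  have := k2_small; have : q%:R * (q%:R / n%:R) <= k%:R ^+ 2 / n%:R :> R.
    by rewrite mulrA ler_wpM2r ?invr_ge0// expr2 ler_pM ?ler_nat.
  by lra.
have out : B * expR (- (eps * k%:R)) <= ('C(N - n, e))%:R * (p0 ^+ e * k%:R ^+ e).
  apply: (@le_trans _ _ ((N - n - e)%N%:R ^+ e / e`!%:R * (p0 ^+ e * k%:R ^+ e))); last first.
    by rewrite ler_wpM2r ?bin_ge ?mulr_ge0 ?exprn_ge0.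
  have d1 : 0 <= 1 - delta by apply: le_trans delta_eps; apply: expR_ge0.
  have N0 : 0 < N%:R :> R.
    by rewrite ltr0n lt0n; apply/negP => /eqP N0; move: p0E; rewrite N0 mul0r => /eqP; rewrite lt_eqF.
  have Nne : (1 - delta) * N%:R <= (N - n - e)%N%:R.
    have neN : (n + k <= N)%N.
      rewrite -(ler_nat R) (le_trans n_small)// ler_piMl// ?(ltW N0)//.
      by rewrite -subr_ge0.
    have ek := out_size_lt.
    rewrite -subnDA natrB; last by rewrite (leq_trans _ neN)// leq_add2l ltnW.
    rewrite mulrBl mul1r lerD2l lerN2 (le_trans _ n_small)// ler_nat leq_add2l ltnW//.
  apply: (@le_trans _ _ (((1 - delta) * N%:R) ^+ e / e`!%:R * (p0 ^+ e * k%:R ^+ e))); last first.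
    rewrite ler_wpM2r ?mulr_ge0 ?exprn_ge0// ler_wpM2r ?invr_ge0//.
    by rewrite lerXn2r ?nnegrE ?mulr_ge0.
  have -> : ((1 - delta) * N%:R) ^+ e / e`!%:R * (p0 ^+ e * k%:R ^+ e) = B * (1 - delta) ^+ e.
    by rewrite -p0E !exprMn; ring.
  rewrite ler_wpM2l// (@le_trans _ _ (expR (- eps) ^+ e))//; last by rewrite lerXn2r ?nnegrE ?expR_ge0.
  rewrite -expRM_natl ler_expR mulrN lerN2 mulrC ler_wpM2l ?(ltW eps_gt0)//.
  by rewrite ler_nat ltnW// out_size_lt.
have non_edges : 1 / 2 <= (1 - p1) ^+ (k ^ 2).
  apply: le_trans (bernoulli_le _ _); last by rewrite p10.
  have : (k ^ 2)%N%:R * p1 <= k%:R ^+ 2 / n%:R.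
    by rewrite natrX ler_wpM2l ?exprn_ge0// p1_eq ler_pdivrMr// mulVf ?gt_eqF// ltW.
  by have := k2_small; lra.
have inv_le : k%:R ^- 2 <= (q%:R * k%:R)^-1 :> R.
  by rewrite lef_pV2 ?posrE ?exprn_gt0 ?mulr_gt0// expr2 ler_pM2r// ler_nat.
rewrite [leRHS](_ : _ = ('C(n, q)%:R * (p1 ^+ q * q%:R ^+ q)) * ('C(N - n, e)%:R * (p0 ^+ e * k%:R ^+ e)) *
   (1 - p1) ^+ (k ^ 2) * (q%:R * k%:R)^-1 / p1); last first.
  have -> : p1 ^+ q = p1 * p1 ^+ q.-1 by rewrite -exprS prednK.
  by field; rewrite !gt_eqF.
rewrite [leLHS](_ : _ = (A / 2) * (B * expR (- (eps * k%:R))) * (1 / 2) * k%:R ^- 2 / p1); last first.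
  by field; rewrite !gt_eqF.
rewrite ler_wpM2r ?invr_ge0//.
have h1 : 0 <= B * expR (- (eps * k%:R)) by rewrite mulr_ge0 ?expR_ge0.
by do ?[apply: ler_pM => //]; rewrite ?mulr_ge0 ?divr_ge0 ?invr_ge0 ?exprn_ge0.
Qed.

Let A_ge : (l1 * E) ^+ q / (E * k%:R) <= A.
Proof.
have q0 := core_size_gt0; have qk := core_size_le.
rewrite exprMn -mulrA ler_wpM2l ?exprn_ge0 ?(ltW l1_gt0)//.
apply: le_trans (expr_fact_ge R q0).
have -> : expR q%:R = E ^+ q by rewrite -expRM_natl mulr1.
rewrite ler_wpM2l ?exprn_ge0 ?(ltW E_gt0)// lef_pV2 ?posrE ?mulr_gt0 ?ltr0n//.
by rewrite ler_pM2l// ler_nat.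
Qed.

Let B_ge : (l1 * E) ^+ e * (expR (a * k%:R) / (E ^+ 2 * k%:R)) <= B.
Proof.
have /andP[ek ke] := out_size_itv.
have -> : B = (l1 * E) ^+ e * ((a * k%:R) ^+ e / e`!%:R).
  have l0E : l0 = l1 * E * a by rewrite /out_ratio; field; rewrite !gt_eqF.
  by rewrite {1}l0E !exprMn; ring.
rewrite ler_wpM2l ?exprn_ge0 ?mulr_ge0 ?(ltW l1_gt0) ?(ltW E_gt0)//.
apply: le_trans (expr_fact_floor_ge ek ke).
rewrite ler_wpM2l ?expR_ge0// lef_pV2 ?posrE ?mulr_gt0 ?exprn_gt0 ?ltr0n//.
by rewrite ler_pM2l ?exprn_gt0// ler_nat out_size_lt.
Qed.

Lemma planted_mean_ge_expR :
  n%:R * expR (k%:R * (ln l1 + 1 + a - eps)) / (4 * l1 * E ^+ 3 * k%:R ^+ 4)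
    <= planted_mean N n k q p0 p1.
Proof.
apply: le_trans planted_mean_ge.
have AB : (l1 * E) ^+ k * expR (a * k%:R) / (E ^+ 3 * k%:R ^+ 2) <= A * B.
  apply: le_trans (ler_pM _ _ A_ge B_ge); last 2 first.
  - by rewrite divr_ge0 ?exprn_ge0 ?mulr_ge0 ?(ltW l1_gt0) ?(ltW E_gt0).
  - by rewrite mulr_ge0 ?divr_ge0 ?exprn_ge0 ?mulr_ge0 ?expR_ge0 ?exprn_ge0 ?(ltW l1_gt0) ?(ltW E_gt0).
  rewrite -{1}(subnK (ltnW out_size_lt)) -/core_size exprD le_eqVlt; apply/orP; left; apply/eqP.
  by field; rewrite !gt_eqF.
apply: (@le_trans _ _ ((l1 * E) ^+ k * expR (a * k%:R) / (E ^+ 3 * k%:R ^+ 2) / p1 *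
   (expR (- (eps * k%:R)) / (4 * k%:R ^+ 2)))); last first.
  rewrite ler_wpM2r ?divr_ge0 ?expR_ge0 ?mulr_ge0 ?exprn_ge0//.
  by rewrite ler_wpM2r ?invr_ge0 ?(ltW p1_gt0).
rewrite p1_eq le_eqVlt; apply/orP; left; apply/eqP.
have -> : expR (k%:R * (ln l1 + 1 + a - eps)) =
    (l1 * E) ^+ k * expR (a * k%:R) * expR (- (eps * k%:R)).
  have -> : k%:R * (ln l1 + 1 + a - eps) = k%:R * (ln l1 + 1) + a * k%:R + - (eps * k%:R) by ring.
  by rewrite !expRD expRM_natl expRD lnK.
by field; rewrite !gt_eqF.
Qed.

Lemma planted_mean_gt0 : 0 < planted_mean N n k q p0 p1.
Proof.
apply: lt_le_trans planted_mean_ge_expR.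
by rewrite divr_gt0 ?mulr_gt0 ?exprn_gt0 ?expR_gt0.
Qed.

(** Null trees grow like [(l0 E) ^ k], and [ln l0 + 1] falls short of the planted exponent
    [ln l1 + 1 + a] by exactly [Irate a]. *)
Lemma hitting_mean_le : hitting_mean N n k p0 theta <=
  8 * E ^+ 4 * l1 / l0 * k%:R ^+ 5 * expR (- (k%:R * (Irate a - eps))) *
    planted_mean N n k q p0 p1.
Proof.
have c0 : 0 <= 8 * E ^+ 4 * l1 / l0 * k%:R ^+ 5 * expR (- (k%:R * (Irate a - eps))).
  by rewrite !mulr_ge0 ?invr_ge0 ?exprn_ge0 ?expR_ge0 ?ltW.
apply: le_trans (ler_wpM2l c0 planted_mean_ge_expR).
rewrite /hitting_mean.
apply: (@le_trans _ _ (n%:R * (N%:R ^+ k.-1 / (k.-1)`!%:R) * (E / p0 * (p0 * k%:R) ^+ k))).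
  have pk0 : 0 <= (p0 * k%:R) ^+ k by rewrite exprn_ge0// mulr_ge0// ltW.
  have infl0 : 0 <= inflation k theta.
    by rewrite exprn_ge0// addr_ge0// mulr_ge0// sqrtr_ge0.
  apply: ler_pM.
  - by rewrite mulr_ge0.
  - by rewrite mulr_ge0// divr_ge0// ltW.
  - by rewrite ler_wpM2l// bin_le_expr.
  by apply: ler_wpM2r => //; apply: ler_wpM2r; rewrite ?invr_ge0 ?(ltW p0_gt0)// inflation_le.
have -> : n%:R * (N%:R ^+ k.-1 / (k.-1)`!%:R) * (E / p0 * (p0 * k%:R) ^+ k) =
    n%:R * E * k%:R / l0 * l0 ^+ k * (k%:R ^+ k / k`!%:R).
  have l0k : l0 ^+ k = l0 * (N%:R ^+ k.-1 * p0 ^+ k.-1) by rewrite -exprMn p0E -exprS prednK.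
  have p0k : (p0 * k%:R) ^+ k = p0 * p0 ^+ k.-1 * k%:R ^+ k by rewrite -exprS prednK// exprMn.
  have kf : k`!%:R = k%:R * k.-1`!%:R :> R by rewrite -natrM -{1 2}(prednK k_gt0) factS.
  rewrite l0k p0k kf; field; rewrite !gt_eqF ?ltr0n ?fact_gt0//.
apply: (@le_trans _ _ (n%:R * E * k%:R / l0 * l0 ^+ k * E ^+ k)).
  rewrite ler_wpM2l ?natr_pow_fact_le//.
  by rewrite !mulr_ge0 ?invr_ge0 ?exprn_ge0 ?(ltW E_gt0) ?(ltW l0_gt0).
have l0k : (l0 * E) ^+ k = expR (k%:R * (ln l0 + 1)) by rewrite expRM_natl expRD lnK.
rewrite -mulrA -exprMn l0k.
have -> : k%:R * (ln l0 + 1) = - (k%:R * (Irate a - eps)) + k%:R * (ln l1 + 1 + a - eps).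
  rewrite /Irate /out_ratio lnM ?posrE ?invr_gt0 ?mulr_gt0// lnV ?posrE ?mulr_gt0//.
  by rewrite lnM ?posrE// expRK; ring.
rewrite expRD; set x := expR (- _); set y := expR (k%:R * (_ - eps)).
rewrite [leRHS](_ : _ = 2 * (n%:R * E * k%:R / l0 * (x * y))); last by field; rewrite !gt_eqF.
rewrite ler_peMl ?ler1n// !mulr_ge0 ?invr_ge0 ?expR_ge0 ?(ltW E_gt0) ?(ltW l0_gt0)//.
Qed.

Let s_sq : s ^+ 2 = l0 / E. Proof. by rewrite sqr_sqrtr// divr_ge0// ltW. Qed.
Let s_gt0 : 0 < s. Proof. by rewrite sqrtr_gt0 divr_gt0. Qed.
Let kS : k.+1%:R <= 2 * k%:R :> R. Proof. by rewrite -natr1 mulr2n mulrDl mul1r lerD2l. Qed.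

Lemma null_ratio_le :
  null_variance N k p0 theta / planted_mean N n k q p0 p1 ^+ 2 <=
  32 * E ^+ 7 * l1 ^+ 2 / l0 * k%:R ^+ 9 * (N%:R / n%:R ^+ 2) *
    expR (- (k%:R * (2 * (Irate a - Irate s) - 2 * eps))).
Proof.
have N0 : 0 < N%:R :> R by rewrite -(pmulr_lgt0 _ p0_gt0) p0E.
have p0_eq : p0 = l0 / N%:R by rewrite -p0E mulrAC divff ?mul1r// gt_eqF.
pose M := n%:R * expR (k%:R * (ln l1 + 1 + a - eps)) / (4 * l1 * E ^+ 3 * k%:R ^+ 4).
have M0 : 0 < M by rewrite divr_gt0 ?mulr_gt0 ?exprn_gt0 ?expR_gt0.
pose V := E / p0 * (2 * k%:R * expR (k%:R * (ln l0 + 1 + 2 * s))).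
have V0 : 0 <= V by rewrite !mulr_ge0 ?invr_ge0 ?expR_ge0 ?(ltW p0_gt0).
have hV : null_variance N k p0 theta <= V.
  rewrite /null_variance p0E; apply: ler_pM.
  - rewrite divr_ge0 ?(ltW p0_gt0)// exprn_ge0// addr_ge0// mulr_ge0// sqrtr_ge0//.
  - by apply: second_moment_ge0; rewrite ?edge_root01 ?(ltW l0_gt0).
  - by rewrite ler_wpM2r ?inflation_le// invr_ge0 ltW.
  apply: le_trans (second_moment_null_le _ _ _ _ (ltW s_gt0) s_sq) _; first exact: ltW.
  have -> : expR (k%:R * (ln l0 + 1 + 2 * s)) = (l0 * E) ^+ k * expR (s * k%:R) ^+ 2.
    have -> : k%:R * (ln l0 + 1 + 2 * s) = k%:R * (ln l0 + 1) + 2%:R * (s * k%:R) by ring.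
    by rewrite expRD !expRM_natl expRD lnK.
  by rewrite ler_wpM2r// mulr_ge0 ?exprn_ge0 ?mulr_ge0 ?expR_ge0 ?(ltW l0_gt0).
apply: (@le_trans _ _ (V / M ^+ 2)).
  apply: ler_pM => //.
  - apply: mulr_ge0; last by apply: second_moment_ge0; rewrite ?p0E ?edge_root01 ?(ltW l0_gt0).
    by rewrite divr_ge0 ?(ltW p0_gt0)// exprn_ge0// addr_ge0// mulr_ge0// sqrtr_ge0.
  - by rewrite invr_ge0 exprn_ge0// ltW// planted_mean_gt0.
  rewrite lef_pV2 ?posrE ?exprn_gt0 ?planted_mean_gt0//.
  by rewrite lerXn2r ?nnegrE ?(ltW M0) ?(ltW planted_mean_gt0)// planted_mean_ge_expR.
rewrite le_eqVlt; apply/orP; left; apply/eqP.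
have lnl0 : 0 < l0 / E by rewrite divr_gt0.
have lns : ln s = (ln l0 - 1) / 2.
  have : ln (s ^+ 2) = ln l0 - 1 by rewrite s_sq lnM ?posrE ?invr_gt0// lnV ?posrE// expRK.
  by rewrite lnXn// => <-; rewrite mulr2n; field.
have lna : ln a = ln l0 - ln l1 - 1.
  rewrite /out_ratio lnM ?posrE ?invr_gt0 ?mulr_gt0// lnV ?posrE ?mulr_gt0//.
  by rewrite lnM ?posrE// expRK; ring.
(* The exponent of the variance bound is twice the planted exponent minus [2 (I_a - I_s)]. *)
have key : expR (k%:R * (ln l0 + 1 + 2 * s)) =
    expR (- (k%:R * (2 * (Irate a - Irate s) - 2 * eps))) *
      expR (k%:R * (ln l1 + 1 + a - eps)) ^+ 2.
  by rewrite expr2 -!expRD; congr expR; rewrite /Irate lns lna; field.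
rewrite /V /M key p0_eq; set x := expR (- _); set y := expR (k%:R * (_ - eps)).
have y0 : y != 0 by rewrite gt_eqF ?expR_gt0.
by field; rewrite y0 !gt_eqF.
Qed.

(** The outside factor [B] cancels. Pairs disjoint inside [S] leave [theta ^+ 2 = sqrt p1]; the
    others leave [W / A ^+ 2], whose exponent is [2 * Irate u = 2 * u - ln l1] per core vertex. *)
Lemma planted_ratio_le :
  planted_variance N n k q p0 p1 theta / planted_mean N n k q p0 p1 ^+ 2 <=
  32 * E * k%:R ^+ 6 * expR (k%:R * (2 * eps)) *
    (Num.sqrt (l1 / n%:R) + l1 / n%:R * (E ^+ 2 * k%:R ^+ 2 *
       expR (2 * Irate u * ((1 - a) * k%:R + 1)))).
Proof.
have q0 := core_size_gt0; have qk := core_size_le.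
have u0 : 0 < u by rewrite divr_gt0 ?sqrtr_gt0.
have u_sq : u ^+ 2 = l1 / E ^+ 2.
  by rewrite expr_div_n sqr_sqrtr// ltW.
have lnu : ln u = ln l1 / 2 - 1.
  have : ln (u ^+ 2) = ln l1 - 2.
    by rewrite u_sq lnM ?posrE ?invr_gt0 ?exprn_gt0// lnV ?posrE ?exprn_gt0// lnXn// expRK mulr2n.
  by rewrite lnXn// mulr2n => h; lra.
have Iu : 2 * Irate u = 2 * u - ln l1 by rewrite /Irate lnu; field.
have Iu0 : 0 <= 2 * Irate u.
  rewrite Iu addr_ge0 ?mulr_ge0 ?(ltW u0)// oppr_ge0 -(@ln1 R) ler_ln ?posrE// ltW//.
have A0 : 0 < A by rewrite mulr_gt0 ?divr_gt0 ?exprn_gt0 ?ltr0n ?fact_gt0.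
have B0 : 0 < B by rewrite mulr_gt0 ?divr_gt0 ?exprn_gt0 ?ltr0n ?fact_gt0.
pose x := expR (- (eps * k%:R)) / (4 * k%:R ^+ 2).
have x0 : 0 < x by rewrite divr_gt0 ?expR_gt0 ?mulr_gt0 ?exprn_gt0.
pose W := (l1 * E ^+ 2) ^+ q * expR (u * q%:R) ^+ 2.
have W0 : 0 <= W by rewrite mulr_ge0 ?sqr_ge0// exprn_ge0// mulr_ge0 ?exprn_ge0 ?(ltW E_gt0) ?(ltW l1_gt0).
have th2 : theta ^+ 2 = Num.sqrt (l1 / n%:R) by rewrite sqr_sqrtr ?sqrtr_ge0// p1_eq.
pose V := E / p1 * ((2 * k%:R ^+ 2) * ((theta ^+ 2 / p1 * A ^+ 2 + W) * B ^+ 2)).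
have infl0 : 0 <= inflation k theta / p1.
  by rewrite divr_ge0 ?(ltW p1_gt0)// exprn_ge0// addr_ge0// mulr_ge0// sqrtr_ge0.
have SM0 : 0 <= second_moment p1 theta k q (n%:R * p1) (N%:R * p0) (k - q).
  by apply: second_moment_ge0; rewrite ?p0E ?p1E ?edge_root01 ?(ltW l0_gt0) ?(ltW l1_gt0).
have AWB : 0 <= (theta ^+ 2 / p1 * A ^+ 2 + W) * B ^+ 2.
  by rewrite mulr_ge0 ?sqr_ge0// addr_ge0// mulr_ge0 ?sqr_ge0// divr_ge0 ?sqr_ge0// ltW.
have hV : planted_variance N n k q p0 p1 theta <= V.
  rewrite /planted_variance; apply: ler_pM => //.
    by rewrite ler_wpM2r ?inflation_le// invr_ge0 ltW.
  rewrite p0E p1E core_sizeK.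
  apply: le_trans (second_moment_planted_le (s := s) (u := u) _ _ _ _ _ _ s_sq u_sq _ erefl erefl) _;
    rewrite ?(ltW l0_gt0) ?(ltW l1_gt0) ?(ltW s_gt0) ?(ltW u0)//.
    by have /andP[h _] := out_size_itv; apply: le_trans h _; rewrite ler_wpM2r.
  rewrite ler_wpM2r// natrM.
  apply: (@le_trans _ _ (2 * k%:R * k%:R)); last by rewrite expr2 mulrA.
  apply: ler_pM => //; last by rewrite ler_nat out_size_lt.
  by apply: le_trans kS; rewrite ler_nat ltnS.
pose M := A * B / p1 * x.
have M0 : 0 < M by rewrite mulr_gt0// divr_gt0// mulr_gt0.
have V0 : 0 <= V.
  by rewrite mulr_ge0 ?divr_ge0 ?(ltW E_gt0) ?(ltW p1_gt0)// mulr_ge0// mulr_ge0 ?sqr_ge0.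
apply: (@le_trans _ _ (V / M ^+ 2)).
  apply: ler_pM => //.
  - exact: mulr_ge0.
  - by rewrite invr_ge0 exprn_ge0// ltW// planted_mean_gt0.
  rewrite lef_pV2 ?posrE ?exprn_gt0 ?planted_mean_gt0//.
  by rewrite lerXn2r ?nnegrE ?(ltW M0) ?(ltW planted_mean_gt0)// planted_mean_ge.
have -> : V / M ^+ 2 = 32 * E * k%:R ^+ 6 * expR (k%:R * (2 * eps)) * (theta ^+ 2 + p1 * (W / A ^+ 2)).
  have -> : expR (k%:R * (2 * eps)) = (expR (- (eps * k%:R)) ^+ 2)^-1.
    by rewrite -expRM_natl -expRN; congr expR; ring.
  rewrite /V /M /x; set z := expR (- _).
  have z0 : z != 0 by rewrite gt_eqF ?expR_gt0.
  have A1 : A != 0 by rewrite gt_eqF.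
  have B1 : B != 0 by rewrite gt_eqF.
  move: A1 B1; set A' := A; set B' := B => A1 B1.
  by field; rewrite z0 A1 B1 !gt_eqF.
rewrite th2 -p1_eq ler_wpM2l ?mulr_ge0 ?exprn_ge0 ?expR_ge0 ?(ltW E_gt0)// lerD2l.
rewrite ler_wpM2l ?(ltW p1_gt0)//.
apply: (@le_trans _ _ (W / ((l1 * E) ^+ q / (E * k%:R)) ^+ 2)).
  have lE0 : 0 < (l1 * E) ^+ q / (E * k%:R) by rewrite divr_gt0 ?exprn_gt0 ?mulr_gt0.
  rewrite ler_wpM2l// lef_pV2 ?posrE ?exprn_gt0//.
  by rewrite lerXn2r ?nnegrE ?(ltW lE0) ?(ltW A0)// A_ge.
have -> : W / ((l1 * E) ^+ q / (E * k%:R)) ^+ 2 = E ^+ 2 * k%:R ^+ 2 * expR (2 * Irate u * q%:R).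
  have -> : expR (2 * Irate u * q%:R) = expR (u * q%:R) ^+ 2 / l1 ^+ q.
    rewrite Iu mulrBl expRD expRN; congr (_ * _^-1).
      by rewrite -expRM_natl; congr expR; ring.
    by rewrite expRM_natr lnK.
  rewrite /W !exprMn; field.
  by rewrite ?expf_neq0 ?gt_eqF.
rewrite ler_wpM2l ?mulr_ge0 ?exprn_ge0 ?(ltW E_gt0)// ler_expR ler_wpM2l//.
exact: core_size_ub.
Qed.

End FixedSize.

(** * Asymptotics *)

Local Open Scope classical_set_scope.
Local Open Scope ring_scope.

Section Asymptotics.
Variable R : realType.
Implicit Types x y c g : R.
Local Notation E := (expR (1 : R)).

Lemma expr_le_expR (eps : R) (m : nat) : 0 < eps ->
  exists2 C, 0 < C & forall k : nat, k%:R ^+ m <= C * expR (eps * k%:R).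
Proof.
move=> eps0; have em : 0 < eps ^+ m by rewrite exprn_gt0.
exists (m`!%:R / eps ^+ m); first by rewrite divr_gt0// ltr0n fact_gt0.
move=> k; have := @expr_fact_le R (eps * k%:R) m (mulr_ge0 (ltW eps0) (ler0n _ _)).
rewrite exprMn ler_pdivrMr ?ltr0n ?fact_gt0// => h.
by rewrite mulrAC ler_pdivlMr// mulrC [leRHS]mulrC.
Qed.

Lemma expR_decay C g x : 0 <= C -> 0 < g -> 0 < x ->
  exists M, forall y, M <= y -> C * expR (- (g * y)) <= x.
Proof.
move=> C0 g0 x0; exists (C / (x * g)) => y; rewrite ler_pdivrMr ?mulr_gt0// => Cy.
rewrite expRN ler_pdivrMr ?expR_gt0//.
apply: (@le_trans _ _ (x * (1 + g * y))); last by rewrite ler_pM2l// expR_ge1Dx.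
have -> : x * (1 + g * y) = x + y * (x * g) by ring.
by rewrite (le_trans Cy)// lerDr ltW.
Qed.

Lemma ln_le_subr1 x : 0 < x -> ln x <= x - 1.
Proof. by move=> x0; have := expR_ge1Dx (ln x); rewrite lnK ?posrE//; lra. Qed.

Lemma Irate_ge0 x : 0 < x -> 0 <= Irate x.
Proof. by move=> /ln_le_subr1; rewrite /Irate; lra. Qed.

Lemma Irate_decr x y : 0 < x -> x < y -> y < 1 -> Irate y < Irate x.
Proof.
move=> x0 xy y1; have y0 := lt_trans x0 xy.
have := ln_le_subr1 (divr_gt0 x0 y0); rewrite lnM ?posrE ?invr_gt0// lnV ?posrE//.
have -> : x / y - 1 = - ((y - x) / y) by field; rewrite gt_eqF.
have : y - x < (y - x) / y by rewrite ltr_pdivlMr// gtr_pMr// subr_gt0.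
by rewrite /Irate; lra.
Qed.

Lemma limn_esup_lt (f : nat -> R) y : (limn_esup (fun N => (f N)%:E) < y%:E)%E ->
  exists2 x, x < y & \forall N \near \oo, f N <= x.
Proof.
rewrite /limn_esup /limf_esup => /ereal_inf_lt[_ [V Voo <-]].
have leV N : V N -> ((f N)%:E <= ereal_sup [set (f n)%:E | n in V])%E.
  by move=> VN; apply: ereal_sup_ubound; exists N.
(* If the supremum is [-oo], any value below [y] serves. *)
move: leV; case: (ereal_sup _) => [r|//|] leV; last first.
  move=> _; exists (y - 1); first by rewrite ltrBlDr ltrDl.
  by apply: filterS Voo => N /leV; rewrite leeNy_eq.
by rewrite lte_fin => ry; exists r => //; apply: filterS Voo => N /leV; rewrite lee_fin.
Qed.

(** An admissible [c] lies strictly between [L / (2 D)], needed against the null variance, and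
    [1 / J], needed for concentration inside [S]. The midpoint is taken, and [eps] uses at most half
    of each remaining slack. *)
Lemma rates_exist (D I J L : R) : 0 < D -> 0 < I -> 0 < J -> 0 < L -> L < 2 * D / J ->
  exists c eps, [/\ 0 < c, 0 < eps, L < c * (2 * D - 3 * eps) /\ c * (3 * eps + J) < 1,
    3 * eps * c < 1 / 2 & 2 * eps < I].
Proof.
move=> D0 I0 J0 L0 LDJ.
have lt_c : L / (2 * D) < 1 / J.
  by rewrite ltr_pdivrMr ?mulr_gt0// mulrAC -mulrA mul1r.
pose c := (L / (2 * D) + 1 / J) / 2.
have c0 : 0 < c by rewrite divr_gt0// addr_gt0// divr_gt0// mulr_gt0.
have cL : L < c * (2 * D) by rewrite -ltr_pdivrMr ?mulr_gt0// /c; lra.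
have cJ : c * J < 1 by rewrite -ltr_pdivlMr// /c; lra.
have lb (x y : R) : 0 < x -> 0 < y -> exists2 z, 0 < z & z <= x /\ z <= y.
  by move=> x0 y0; have [xy|yx] := lerP x y; [exists x|exists y => //; split=> //; apply: ltW].
have c60 : 0 < 6 * c by rewrite mulr_gt0.
have c120 : 0 < 12 * c by rewrite mulr_gt0.
have [z1 z10 [z1a z1b]] := lb ((c * (2 * D) - L) / (6 * c)) ((1 - c * J) / (6 * c))
  ltac:(by rewrite divr_gt0// subr_gt0) ltac:(by rewrite divr_gt0// subr_gt0).
have [z2 z20 [z2a z2b]] := lb (1 / (12 * c)) (I / 4) ltac:(by rewrite divr_gt0) ltac:(by rewrite divr_gt0).
have [eps eps0 [ez1 ez2]] := lb _ _ z10 z20.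
have e1 : eps * (6 * c) <= c * (2 * D) - L by rewrite -ler_pdivlMr// (le_trans ez1).
have e2 : eps * (6 * c) <= 1 - c * J by rewrite -ler_pdivlMr// (le_trans ez1).
have e3 : eps * (12 * c) <= 1 by rewrite -ler_pdivlMr// (le_trans ez2).
have e4 : eps <= I / 4 by rewrite (le_trans ez2).
have ec : 0 < eps * c by rewrite mulr_gt0.
by exists c, eps; split=> //; [split|..]; lra.
Qed.

Section FixedParameters.
Variables (l0 l1 c eps L : R).
Local Notation a := (out_ratio l0 l1).
Local Notation s := (Num.sqrt (l0 / E)).
Local Notation u := (Num.sqrt l1 / E).
Local Notation D := (Irate a - Irate s).
Local Notation J := (2 * Irate u * (1 - a)).
Hypotheses (l0_gt0 : 0 < l0) (l1_gt0 : 0 < l1) (l1_lt1 : l1 < 1).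
Hypotheses (a_lt1 : a < 1) (a_le_s : a <= s).
Hypotheses (c_gt0 : 0 < c) (eps_gt0 : 0 < eps) (L_gt0 : 0 < L).
Hypotheses (rate1 : L < c * (2 * D - 3 * eps)) (rate2 : 2 * eps < Irate a).

Definition threshold (N n k : nat) (p0 p1 : R) : R :=
  null_mean N k p0 + planted_mean N n k (core_size l0 l1 k) p0 p1 / 2.

(** The three terms come from the variance of trees at null rates, from planted pairs disjoint
    inside [S] and from those that overlap there. In the exponents, [2 * eps] is the squared loss in
    [planted_mean] and the third [eps] absorbs the powers of [k]. *)
Lemma risk_threshold_le : exists C M : R, 0 < C /\
  forall (N n k : nat) (p0 p1 : R), (0 < n)%N ->
    N%:R * p0 = l0 -> n%:R * p1 = l1 -> 0 < p0 -> p0 <= p1 -> p1 <= 1 ->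
    M <= ln n%:R -> `|k%:R - c * ln n%:R| < 1 ->
    2 * n%:R <= (1 - expR (- eps)) * N%:R -> ln (N%:R / n%:R ^+ 2) <= L * ln n%:R ->
  risk n p0 p1 (fun G : graph N => threshold N n k p0 p1 <= (ntree k G)%:R) <=
    C * expR (- ((c * (2 * D - 3 * eps) - L) * ln n%:R)) +
    (C * expR (- ((1 / 2 - 3 * eps * c) * ln n%:R)) +
     C * expR (- ((1 - c * (3 * eps + J)) * ln n%:R))).
Proof.
have E0 : 0 < E := expR_gt0 1.
have D3 : 0 < 2 * D - 3 * eps by rewrite -(pmulr_rgt0 _ c_gt0) (lt_trans L_gt0).
have [C9 C90 hC9] := expr_le_expR 9 eps_gt0.
have c2 : 0 < 1 / (2 * c) by rewrite divr_gt0// mulr_gt0.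
(* As [k] is close to [c ln n], [exp (k / (2 c))] is of order [sqrt n], which puts [16 k ^ 8] below
   [n]. *)
have [C8 C80 hC8] := expr_le_expR 8 c2.
have half0 : 0 < 1 / 2 :> R by rewrite divr_gt0.
have eighth0 : 0 < 1 / 8 :> R by rewrite divr_gt0.
have [M2 hM2] := @expR_decay (16 * C8 * expR (1 / (2 * c))) (1 / 2) 1
  (mulr_ge0 (mulr_ge0 (ler0n _ 16) (ltW C80)) (expR_ge0 _)) half0 ltr01.
pose I2 := Irate a - 2 * eps; have I20 : 0 < I2 by rewrite subr_gt0.
pose H := 8 * E ^+ 4 * l1 / l0 * C9 * expR I2.
have H0 : 0 < H by rewrite !mulr_gt0 ?invr_gt0 ?exprn_gt0 ?expR_gt0.
have [M3 hM3] := @expR_decay H (I2 * c) (1 / 8) (ltW H0) (mulr_gt0 I20 c_gt0) eighth0.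
(* The last exponential of each constant absorbs the rounding error of less than one in [k]. *)
pose K1 := 68 * (32 * E ^+ 7 * l1 ^+ 2 / l0) * C9 * expR (2 * D - 3 * eps).
pose K2 := 16 * 32 * E * C9 * expR (3 * eps).
pose K3 := 16 * 32 * E ^+ 3 * C9 * expR (2 * Irate u) * expR (3 * eps + J).
have K10 : 0 < K1 by rewrite !mulr_gt0 ?invr_gt0 ?exprn_gt0 ?expR_gt0.
have K20 : 0 < K2 by rewrite !mulr_gt0 ?expR_gt0.
have K30 : 0 < K3 by rewrite !mulr_gt0 ?exprn_gt0 ?expR_gt0.
exists (K1 + K2 + K3), (`|2 / c| + `|M2| + `|M3|); split.
  by rewrite !addr_gt0.
move=> N n k p0 p1 n0 p0E p1E p00 p01 p11; set l := ln n%:R => lM.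
have [m1 /hM2 m2 /hM3 m3] : [/\ 2 / c <= l, M2 <= l & M3 <= l].
  have := (ler_norm (2 / c), ler_norm M2, ler_norm M3) => -[[]].
  by have := normr_ge0 (2 / c); have := normr_ge0 M2; have := normr_ge0 M3; split; lra.
move=> /ltr_normlP[kl1 kl2] nN LN.
have nR0 : 0 < n%:R :> R by rewrite ltr0n.
have nE : n%:R = expR l by rewrite lnK// posrE.
have cl : 2 <= c * l by rewrite mulrC -ler_pdivrMr.
have kge : c * l - 1 <= k%:R by lra.
have kle : k%:R <= c * l + 1 by lra.
have k1 : 1 <= k%:R :> R by lra.
have k0 : (0 < k)%N by rewrite -(ler1n R).
have k8 : (16 * k ^ 8 <= n)%N.
  rewrite -(ler_nat R) natrM natrX nE.
  apply: (@le_trans _ _ (16 * C8 * expR (1 / (2 * c)) * expR (- (1 / 2 * l)) * expR l)); last first.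
    by rewrite ler_piMl ?expR_ge0.
  have key : expR (1 / (2 * c)) * (expR (- (1 / 2 * l)) * expR l) =
      expR (1 / (2 * c) * (c * l + 1)).
    by rewrite -!expRD; congr expR; field; rewrite gt_eqF.
  rewrite [leRHS](_ : _ = 16 * (C8 * expR (1 / (2 * c) * (c * l + 1)))); last first.
    by rewrite -key; ring.
  rewrite ler_wpM2l// (le_trans (hC8 k))// ler_wpM2l ?(ltW C80)// ler_expR.
  by rewrite ler_wpM2l// ltW.
have kn : (k <= n)%N.
  by apply: leq_trans k8; rewrite -{1}(expn1 k) (leq_trans (leq_pexp2l _ (isT : 1 <= 8)%N))// leq_pmull.
have n_small : (n + k)%:R <= (1 - expR (- eps)) * N%:R.
  by apply: le_trans nN; rewrite natrD mulr2n mulrDl mul1r lerD2l ler_nat.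
have de : expR (- eps) <= 1 - (1 - expR (- eps)) by rewrite opprB addrC subrK.
have N0 : 0 < N%:R :> R by rewrite -(pmulr_lgt0 _ p00) p0E.
have k9 : k%:R ^+ 9 <= C9 * expR (eps * k%:R) := hC9 k.
have kpow m : (m <= 9)%N -> k%:R ^+ m <= C9 * expR (eps * k%:R).
  by move=> m9; apply: le_trans k9; rewrite ler_weXn2l.
have sz := out_size_lt l0_gt0 l1_gt0 a_lt1 k0.
have pm0 := planted_mean_gt0 l0_gt0 l1_gt0 l1_lt1 a_lt1 eps_gt0 de p0E p1E p00 p01 p11 k0 k8 n_small.
have T1 := null_ratio_le l0_gt0 l1_gt0 l1_lt1 a_lt1 eps_gt0 de p0E p1E p00 p01 p11 k0 k8 n_small.
have T2 := planted_ratio_le l0_gt0 l1_gt0 l1_lt1 a_lt1 a_le_s eps_gt0 de p0E p1E p00 p01 p11 k0 k8 n_small.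
have T3 := hitting_mean_le l0_gt0 l1_gt0 l1_lt1 a_lt1 eps_gt0 de p0E p1E p00 p01 p11 k0 k8 n_small.
have th01 := edge_root01 p00 p01 p11.
have th4 : p1 <= edge_root p1 ^+ 4 by rewrite (edge_root4 p00 p01).
have hit_small : hitting_mean N n k p0 (edge_root p1) <=
    planted_mean N n k (core_size l0 l1 k) p0 p1 / 8.
  apply: le_trans T3 _; rewrite [leRHS]mulrC ler_wpM2r ?(ltW pm0)// -[8^-1]mul1r.
  apply: le_trans m3.
  apply: (@le_trans _ _ (8 * E ^+ 4 * l1 / l0 * (C9 * expR (eps * k%:R)) *
      expR (- (k%:R * (Irate a - eps))))).
    rewrite ler_wpM2r ?expR_ge0// ler_wpM2l ?kpow//.
    by rewrite !mulr_ge0 ?invr_ge0 ?exprn_ge0 ?(ltW l1_gt0) ?(ltW l0_gt0) ?(ltW E0).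
  rewrite [leLHS](_ : _ = 8 * E ^+ 4 * l1 / l0 * C9 * expR (- (k%:R * I2))); last first.
    have -> : - (k%:R * I2) = eps * k%:R + - (k%:R * (Irate a - eps)) by rewrite /I2; ring.
    by rewrite expRD; ring.
  rewrite /H -[leRHS]mulrA -expRD ler_wpM2l//.
    by rewrite !mulr_ge0 ?invr_ge0 ?exprn_ge0 ?(ltW l1_gt0) ?(ltW l0_gt0) ?(ltW E0) ?(ltW C90).
  rewrite ler_expR; have := ler_wpM2l (ltW I20) kge.
  by lra.
apply: le_trans (risk_le p00 p01 p11 th01 th4 _ _ pm0 hit_small) _.
- exact: core_size_gt0.
- exact: core_size_le.
apply: lerD.
  apply: (@le_trans _ _ (K1 * expR (- ((c * (2 * D - 3 * eps) - L) * l)))); last first.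
    by rewrite ler_wpM2r ?expR_ge0// -addrA lerDl addr_ge0 ?(ltW K20) ?(ltW K30).
  have ratio : N%:R / n%:R ^+ 2 <= expR (L * l).
    have q0 : 0 < N%:R / n%:R ^+ 2 :> R by rewrite divr_gt0 ?exprn_gt0.
    by rewrite -[leLHS]lnK ?posrE// ler_expR.
  rewrite -[leLHS]mulrA.
  apply: (@le_trans _ _ (68 * (32 * E ^+ 7 * l1 ^+ 2 / l0 * (C9 * expR (eps * k%:R)) * expR (L * l) *
      expR (- (k%:R * (2 * D - 2 * eps)))))).
    rewrite ler_wpM2l// (le_trans T1)// ler_wpM2r ?expR_ge0//.
    have cst0 : 0 <= 32 * E ^+ 7 * l1 ^+ 2 / l0.
      by rewrite !mulr_ge0 ?invr_ge0 ?exprn_ge0 ?(ltW l1_gt0) ?(ltW l0_gt0) ?(ltW E0).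
    apply: ler_pM; [by rewrite mulr_ge0 ?exprn_ge0| |by rewrite ler_wpM2l|exact: ratio].
    by rewrite divr_ge0 ?exprn_ge0 ?(ltW N0).
  rewrite [leLHS](_ : _ = 68 * (32 * E ^+ 7 * l1 ^+ 2 / l0) * C9 * expR (L * l - k%:R * (2 * D - 3 * eps))).
    rewrite /K1 -[leRHS]mulrA -expRD ler_wpM2l//.
      by rewrite !mulr_ge0 ?invr_ge0 ?exprn_ge0 ?(ltW l1_gt0) ?(ltW l0_gt0) ?(ltW E0) ?(ltW C90).
    rewrite ler_expR; have := ler_wpM2l (ltW D3) kge.
    by lra.
  have -> : L * l - k%:R * (2 * D - 3 * eps) = eps * k%:R + (L * l + - (k%:R * (2 * D - 2 * eps))) by ring.
  by rewrite !expRD; ring.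
rewrite -[leLHS]mulrA; apply: le_trans (ler_wpM2l (ler0n R 16) T2) _.
set X := 32 * E * _ * _; rewrite mulrDr mulrDr; apply: lerD.
  apply: (@le_trans _ _ (K2 * expR (- ((1 / 2 - 3 * eps * c) * l)))); last first.
    by rewrite ler_wpM2r ?expR_ge0// -addrA addrCA lerDl addr_ge0 ?(ltW K10) ?(ltW K30).
  have sq : Num.sqrt (l1 / n%:R) <= expR (- (1 / 2 * l)).
    rewrite -[leRHS]ger0_norm ?expR_ge0// -sqrtr_sqr; apply: ler_wsqrtr.
    rewrite expr2 -expRD ler_pdivrMr// nE -expRD.
    have -> : - (1 / 2 * l) + - (1 / 2 * l) + l = 0 by field.
    by rewrite expR0 ltW.
  apply: (@le_trans _ _ (16 * (32 * E * (C9 * expR (eps * k%:R)) * expR (k%:R * (2 * eps)) *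
      expR (- (1 / 2 * l))))).
    rewrite ler_wpM2l//; apply: ler_pM; rewrite ?sqrtr_ge0//.
      by rewrite !mulr_ge0 ?exprn_ge0 ?expR_ge0.
    rewrite /X ler_wpM2r ?expR_ge0// ler_wpM2l ?kpow// mulr_ge0// ltW//.
  rewrite [leLHS](_ : _ = 16 * 32 * E * C9 * expR (3 * eps * k%:R - 1 / 2 * l)).
    rewrite /K2 -[leRHS]mulrA -expRD ler_wpM2l ?mulr_ge0 ?(ltW E0) ?(ltW C90)//.
    rewrite ler_expR; have := ler_wpM2l (ltW eps_gt0) kle.
    by lra.
  have -> : 3 * eps * k%:R - 1 / 2 * l = eps * k%:R + (k%:R * (2 * eps) + - (1 / 2 * l)) by ring.
  by rewrite !expRD; ring.
apply: (@le_trans _ _ (K3 * expR (- ((1 - c * (3 * eps + J)) * l)))); last first.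
  by rewrite ler_wpM2r ?expR_ge0// addrC lerDl addr_ge0 ?(ltW K10) ?(ltW K20).
have u0 : 0 < u by rewrite divr_gt0 ?sqrtr_gt0.
have J0 : 0 <= J by rewrite mulr_ge0 ?subr_ge0 ?(ltW a_lt1)// mulr_ge0 ?Irate_ge0.
set w := expR (2 * Irate u * ((1 - a) * k%:R + 1)).
have w0 : 0 <= w by apply: expR_ge0.
rewrite [leLHS](_ : _ = 16 * 32 * E ^+ 3 * k%:R ^+ 8 * expR (k%:R * (2 * eps)) * (l1 / n%:R) * w); last first.
  by rewrite /X; ring.
apply: (@le_trans _ _ (16 * 32 * E ^+ 3 * (C9 * expR (eps * k%:R)) * expR (k%:R * (2 * eps)) * expR (- l) * w)).
  rewrite ler_wpM2r//; apply: ler_pM.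
  - by rewrite !mulr_ge0 ?exprn_ge0 ?expR_ge0 ?(ltW E0).
  - by rewrite divr_ge0 ?(ltW l1_gt0).
  - rewrite ler_wpM2r ?expR_ge0// ler_wpM2l ?kpow// mulr_ge0 ?exprn_ge0// ltW//.
  by rewrite ler_pdivrMr// nE -expRD addNr expR0 ltW.
rewrite [leLHS](_ : _ = 16 * 32 * E ^+ 3 * C9 * expR (2 * Irate u) * expR ((3 * eps + J) * k%:R - l)).
  rewrite /K3 -[leRHS]mulrA -expRD ler_wpM2l ?mulr_ge0 ?exprn_ge0 ?expR_ge0 ?(ltW E0) ?(ltW C90)//.
  have eJ0 : 0 <= 3 * eps + J by rewrite addr_ge0// mulr_ge0// ltW.
  rewrite ler_expR; have := ler_wpM2l eJ0 kle.
  by lra.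
have -> : (3 * eps + J) * k%:R - l = eps * k%:R + (k%:R * (2 * eps) + (- l + J * k%:R)) by ring.
have -> : w = expR (2 * Irate u) * expR (J * k%:R) by rewrite /w -expRD; congr expR; ring.
by rewrite !expRD; ring.
Qed.

End FixedParameters.
End Asymptotics.

(** * Choice of the rates and conclusion *)

Theorem theorem3 (R : realType) (lambda0 lambda1 : R)
    (n : nat -> nat) (p0 p1 : nat -> R)
    (p_range : \forall N \near \oo, 0 <= p0 N /\ p0 N < p1 N /\ p1 N <= 1)
    (n_infty : n @ \oo --> \oo)
    (n_small : (n N)%:R / N%:R @[N --> \oo] --> (0 : R))
    (n_large : (n N)%:R / ln N%:R @[N --> \oo] --> +oo_R)
    (N2p0_infty : N%:R ^+ 2 * p0 N @[N --> \oo] --> +oo_R)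
    (n2p1_infty : (n N)%:R ^+ 2 * p1 N @[N --> \oo] --> +oo_R)
    (lambda0E : \forall N \near \oo, N%:R * p0 N = lambda0)
    (lambda1E : \forall N \near \oo, (n N)%:R * p1 N = lambda1)
    (sqrt_gt0 : 0 < Num.sqrt (lambda0 / expR 1))
    (sqrt_lt : Num.sqrt (lambda0 / expR 1) < lambda1)
    (lambda1_lt1 : lambda1 < 1)
    (limsup_lt :
      (limn_esup (fun N =>
         (ln (N%:R / (n N)%:R ^+ 2 : R) / ln (n N)%:R)%:E) <
       ((Irate (lambda0 / (lambda1 * expR 1)) - Irate (Num.sqrt (lambda0 / expR 1))) /
        ((1 - lambda0 / (lambda1 * expR 1)) * Irate (Num.sqrt lambda1 / expR 1)))%:E)%E) :
  exists2 c : R, 0 < c &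
    forall k : nat -> nat,
      (\forall N \near \oo, `|(k N)%:R - c * ln (n N)%:R| < 1) ->
      asymptotically_powerful n p0 p1
        (fun N (G : graph N) => (ntree (k N) G)%:R).
Proof.
have E0 : 0 < expR 1 :> R := expR_gt0 1.
have l0E0 : 0 < lambda0 / expR 1 by rewrite -sqrtr_gt0.
have l00 : 0 < lambda0 by rewrite -(pmulr_lgt0 _ (_ : 0 < (expR 1 : R)^-1)) ?invr_gt0.
have l10 : 0 < lambda1 by apply: lt_trans sqrt_lt.
set s := Num.sqrt (lambda0 / expR 1) in sqrt_gt0 sqrt_lt limsup_lt.
set a := lambda0 / (lambda1 * expR 1) in limsup_lt.
(* Since [a = s ^+ 2 / lambda1], the hypothesis [s < lambda1] says exactly that [a < s]. *)
have aE : a = s * (s / lambda1).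
  by rewrite mulrA -expr2 sqr_sqrtr ?(ltW l0E0)// /a; field; rewrite !gt_eqF.
have a0 : 0 < a by rewrite divr_gt0// mulr_gt0.
have a_s : a < s by rewrite aE gtr_pMr// ltr_pdivrMr// mul1r.
have s1 : s < 1 := lt_trans sqrt_lt lambda1_lt1.
have a1 : a < 1 := lt_trans a_s s1.
have Ias : Irate s < Irate a := Irate_decr a0 a_s s1.
have Ia0 : 0 < Irate a by apply: le_lt_trans Ias; apply: Irate_ge0.
set u := Num.sqrt lambda1 / expR 1 in limsup_lt.
have u0 : 0 < u by rewrite divr_gt0 ?sqrtr_gt0.
have u1 : u < (expR 1)^-1.
  rewrite ltr_pdivrMr// mulVf ?gt_eqF// -(@ltr_pXn2r _ 2)// ?nnegrE ?sqrtr_ge0//.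
  by rewrite sqr_sqrtr ?(ltW l10)// expr1n.
have e1 : (expR 1)^-1 < 1 :> R by rewrite invf_lt1// -expR0 ltr_expR.
have Iu0 : 0 < Irate u.
  by apply: le_lt_trans (Irate_decr u0 u1 e1); apply: Irate_ge0; rewrite invr_gt0.
have [L1 L1lt hL1] := limn_esup_lt limsup_lt.
set bound := (X in L1 < X) in L1lt.
have J0 : 0 < 2 * Irate u * (1 - a) by rewrite mulr_gt0 ?subr_gt0// mulr_gt0.
have boundE : bound = 2 * (Irate a - Irate s) / (2 * Irate u * (1 - a)).
  by rewrite /bound; field; apply/andP; split; [rewrite subr_eq0 gt_eqF|rewrite gt_eqF].
have D0 : 0 < Irate a - Irate s by rewrite subr_gt0.
have bound0 : 0 < bound by rewrite boundE divr_gt0// mulr_gt0.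
(* [L1] may be negative or zero, as can happen when [N <= n ^ 2]; the choice of [c] asks for a
   positive bound. *)
have [L [L0 L1L Llt]] : exists L, [/\ 0 < L, L1 <= L & L < bound].
  have [h|h] := lerP L1 (bound / 2); last by exists L1; split=> //; apply: lt_trans h; rewrite divr_gt0.
  by exists (bound / 2); rewrite divr_gt0// h; split=> //; lra.
have [c [eps [c0 eps0 [rate1 rate2] rate3 rate4]]] : exists c eps, [/\ 0 < c, 0 < eps,
    L < c * (2 * (Irate a - Irate s) - 3 * eps) /\ c * (3 * eps + 2 * Irate u * (1 - a)) < 1,
    3 * eps * c < 1 / 2 & 2 * eps < Irate a].
  by apply: rates_exist => //; rewrite -boundE.
exists c => // k kP.
have [C [M [C0 HM]]] := risk_threshold_le l00 l10 lambda1_lt1 a1 (ltW a_s) c0 eps0 L0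
  rate1 rate4.
exists (fun N => threshold lambda0 lambda1 N (n N) (k N) (p0 N) (p1 N)).
have ln_n (A : R) : \forall N \near \oo, A <= ln (n N)%:R.
  have /cvgnyPge/(_ (Num.trunc (expR A)).+1) := n_infty.
  apply: filterS => N nN; rewrite -ler_expR lnK ?posrE ?ltr0n ?(leq_trans _ nN)//.
  by apply: ltW; apply: lt_le_trans (truncnS_gt _) _; rewrite ler_nat.
(* Half of [1 - exp (- eps)]: of the resulting [2 * n], one [n] is the planted set and the other
   dominates [k]. *)
have del0 : 0 < (1 - expR (- eps)) / 2.
  by rewrite divr_gt0// subr_gt0 -expR0 ltr_expR oppr_lt0.
have n_del : \forall N \near \oo, `|(n N)%:R / N%:R| < (1 - expR (- eps)) / 2.
  by have /cvgr0Pnorm_lt := n_small; apply.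
apply/cvgr0Pnorm_le => x x0.
have x3 : 0 < x / 3 by rewrite divr_gt0.
have g1 : 0 < c * (2 * (Irate a - Irate s) - 3 * eps) - L by rewrite subr_gt0.
have g2 : 0 < 1 / 2 - 3 * eps * c by rewrite subr_gt0.
have g3 : 0 < 1 - c * (3 * eps + 2 * Irate u * (1 - a)) by rewrite subr_gt0.
have [M1 hM1] := expR_decay (ltW C0) g1 x3.
have [M2 hM2] := expR_decay (ltW C0) g2 x3.
have [M3 hM3] := expR_decay (ltW C0) g3 x3.
near=> N.
have pN : 0 <= p0 N /\ p0 N < p1 N /\ p1 N <= 1 by near: N.
have [p0_ge0 [p0_lt p1_le]] := pN.
have p0N : N%:R * p0 N = lambda0 by near: N.
have p1N : (n N)%:R * p1 N = lambda1 by near: N.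
have p0_gt0 : 0 < p0 N.
  rewrite lt_neqAle p0_ge0 andbT; apply/eqP => p00.
  by move: l00; rewrite -p0N -p00 mulr0 ltxx.
have n_gt0 : (0 < n N)%N.
  rewrite lt0n; apply/eqP => nN0; move: l10.
  by rewrite -p1N nN0 mul0r ltxx.
have N_gt0 : 0 < N%:R :> R by rewrite -(pmulr_lgt0 _ p0_gt0) p0N.
have l_gt0 : (1 : R) <= ln (n N)%:R by near: N; apply: ln_n.
rewrite ger0_norm; last by apply: risk_ge0 => //; apply: ltW.
have bnd : risk (n N) (p0 N) (p1 N) (fun G : graph N =>
    threshold lambda0 lambda1 N (n N) (k N) (p0 N) (p1 N) <= (ntree (k N) G)%:R) <=
    x / 3 + (x / 3 + x / 3).
  apply: le_trans (HM N (n N) (k N) (p0 N) (p1 N) n_gt0 p0N p1N p0_gt0 (ltW p0_lt) p1_le _ _ _ _) _.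
  - by near: N; apply: ln_n.
  - by near: N.
  - have : `|(n N)%:R / N%:R| < (1 - expR (- eps)) / 2 by near: N.
    rewrite ger0_norm ?divr_ge0// ltr_pdivrMr// => /ltW h.
    rewrite mulrC -ler_pdivlMr// (le_trans h)// le_eqVlt; apply/orP; left; apply/eqP; ring.
  - have : ln (N%:R / (n N)%:R ^+ 2) / ln (n N)%:R <= L1 by near: N.
    move=> /le_trans/(_ L1L); rewrite ler_pdivrMr//.
    exact: lt_le_trans l_gt0.
  apply: lerD; first by apply: hM1; near: N; apply: ln_n.
  by apply: lerD; [apply: hM2|apply: hM3]; near: N; apply: ln_n.
apply: le_trans bnd _; rewrite le_eqVlt; apply/orP; left; apply/eqP; field.
Unshelve. all: by end_near.
Qed.
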